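(* Assume the standing setup below and that $\beta_n n^{-\alpha}\to\gamma\in(0,\infty)$. Let $\mathcal N$ be a Poisson point process on $\mathbb R_+=[0,\infty)$ with intensity measure $\Lambda$ given by $\Lambda([0,y])=C(q)(y/\gamma)^{1/\alpha}$ for $y\ge0$, and let $0<Y_1<Y_2<\cdots$ be its atoms in increasing order. Then for every fixed $k\ge1$, $(A_{(1)},\dots,A_{(k)})\to(W_1,\dots,W_k)$ in distribution, where $W_i=e^{-Y_i}/\sum_{j=1}^\infty e^{-Y_j}$.
   Context: Standing setup: Fix an integer $d\ge 2$; let $\mathbb S^{d-1}\subset\mathbb R^d$ be the unit sphere with surface measure $\sigma$. Fix $q\in\mathbb S^{d-1}$. Let $x_1,x_2,\dots$ be i.i.d. random vectors on $\mathbb S^{d-1}$ with law $\rho(x)\,d\sigma(x)$, where $\rho$ is a $C^2$ probability density on $\mathbb S^{d-1}$ with $\rho(q)>0$. Let $(\beta_n)_{n\ge1}$ be positive reals and set $\alpha=2/(d-1)$. Define $T_i=1-\langle q,x_i\rangle\in[0,2]$, $Z_n=\sum_{j=1}^n e^{-\beta_nT_j}$, attention weights $A_i=e^{-\beta_nT_i}/Z_n$ ($1\le i\le n$), and let $A_{(1)}\ge\cdots\ge A_{(n)}$ be their decreasing rearrangement. Let $C(q)=\frac{2^{1/\alpha}\sigma_{d-2}}{d-1}\rho(q)$, where $\sigma_{d-2}$ is the surface area of $\mathbb S^{d-2}$. *)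

(* Defs.v *)
From HB Require Import structures.
From mathcomp Require Import all_boot all_order all_algebra.
From mathcomp Require Import all_classical all_reals all_analysis measurable_realfun.
Set Implicit Arguments. Unset Strict Implicit. Unset Printing Implicit Defensive.
Import Order.TTheory GRing.Theory Num.Theory.
Import numFieldNormedType.Exports.
Local Open Scope classical_set_scope.
Local Open Scope ring_scope.

Section defs.
Variable R : realType.

Definition dotp (d : nat) (x y : 'rV[R]_d) : R := \sum_(i < d) x 0 i * y 0 i.
Definition enorm (d : nat) (x : 'rV[R]_d) : R := Num.sqrt (dotp x x).
Definition sphere (d : nat) : set 'rV[R]_d := [set x | enorm x = 1].

Definition borel_rV (d : nat) (B : set 'rV[R]_d) : Prop :=
  <<s [set O : set 'rV[R]_d | open O] >> B.

(** Lebesgue integral over R^n of a nonnegative function, as the iterated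
    one-dimensional Lebesgue integral (Tonelli); coordinates are indexed by
    nat, only the first n are used. *)
Fixpoint iter_leb_int (n : nat) (g : (nat -> R) -> \bar R) : \bar R :=
  match n with
  | 0 => g (fun _ => 0)
  | n'.+1 => (\int[@lebesgue_measure R]_t
               iter_leb_int n' (fun v => g (fun i => if i == n' then t else v i)))%E
  end.

Definition leb_int (d : nat) (g : 'rV[R]_d -> \bar R) : \bar R :=
  iter_leb_int d (fun v => g (\row_(i < d) v i)).

(** Integral against the surface measure sigma of S^{d-1}, through the
    standard definition  sigma(A) = d * Leb_d {r a | a in A, 0 < r <= 1}
    (Folland, Real Analysis, Thm 2.49), i.e.
    int f dsigma = d * int_{0<|x|<=1} f(x/|x|) dx. *)
Definition cone_integrand (d : nat) (f : 'rV[R]_d -> R) (x : 'rV[R]_d) : \bar R :=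
  if (0 < enorm x) && (enorm x <= 1) then (f ((enorm x)^-1 *: x))%:E else 0%E.
Definition sphere_int (d : nat) (f : 'rV[R]_d -> R) : \bar R :=
  ((d%:R)%:E * leb_int (cone_integrand f))%E.

Definition sphere_area (m : nat) : R := fine (sphere_int (fun _ : 'rV[R]_m => 1)).

(** C^2 on the sphere: the 0-homogeneous extension x |-> rho(x/|x|) has
    continuous partial derivatives up to order 2 on R^d \ {0}. *)
Definition ebasis (d : nat) (i : 'I_d) : 'rV[R]_d := delta_mx 0 i.
Definition hom_ext (d : nat) (rho : 'rV[R]_d -> R) (x : 'rV[R]_d) : R :=
  rho ((enorm x)^-1 *: x).
Definition C2_on_sphere (d : nat) (rho : 'rV[R]_d -> R) : Prop :=
  forall x : 'rV[R]_d, x != 0 ->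
    [/\ {for x, continuous (hom_ext rho)},
        forall i, derivable (hom_ext rho) x (ebasis i),
        forall i, {for x, continuous ('D_(ebasis i) (hom_ext rho))},
        forall i j, derivable ('D_(ebasis i) (hom_ext rho)) x (ebasis j) &
        forall i j, {for x, continuous ('D_(ebasis j) ('D_(ebasis i) (hom_ext rho)))}].

Definition C2_density_on_sphere (d : nat) (rho : 'rV[R]_d -> R) : Prop :=
  [/\ forall x, @sphere d x -> 0 <= rho x,
      sphere_int rho = 1%E &
      C2_on_sphere rho].

(** i.i.d. random vectors x_0, x_1, ... (paper's x_1, x_2, ...) with law rho dsigma *)
Definition iid_law_density {dO : measure_display} {Om : measurableType dO}
  (P : probability Om R) (d : nat) (x : nat -> Om -> 'rV[R]_d)
  (rho : 'rV[R]_d -> R) : Prop :=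
  [/\ (forall i B, borel_rV B -> measurable (x i @^-1` B)),
      (forall i B, borel_rV B ->
          P (x i @^-1` B) = sphere_int (fun y => \1_B y * rho y)) &
      (forall (J : seq nat) (B : nat -> set 'rV[R]_d), uniq J ->
          (forall j, borel_rV (B j)) ->
          P (\bigcap_(j in [set j | j \in J]) (x j @^-1` B j)) =
          (\prod_(j <- J) P (x j @^-1` B j))%E)].

(** T_i, Z_n, attention weights A_i (i = 0..n-1) and their decreasing
    rearrangement A_(1) >= ... >= A_(n); A_(i) := 0 for i > n (irrelevant). *)
Definition T_ (d : nat) (q y : 'rV[R]_d) : R := 1 - dotp q y.
Definition Z_ (d : nat) (q : 'rV[R]_d) (b : R) (n : nat) (xs : nat -> 'rV[R]_d) : R :=
  \sum_(j < n) expR (- b * T_ q (xs j)).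
Definition attn (d : nat) (q : 'rV[R]_d) (b : R) (n : nat) (xs : nat -> 'rV[R]_d)
  (i : nat) : R := expR (- b * T_ q (xs i)) / Z_ q b n xs.
Definition attn_sorted (d : nat) (q : 'rV[R]_d) (b : R) (n : nat)
  (xs : nat -> 'rV[R]_d) : seq R :=
  sort (fun a c : R => c <= a) [seq attn q b n xs i | i <- iota 0 n].
Definition top_attn (d k : nat) (q : 'rV[R]_d) (b : R) (n : nat)
  (xs : nat -> 'rV[R]_d) : 'rV[R]_k :=
  \row_(i < k) nth 0 (attn_sorted q b n xs) i.

(** Poisson probabilities, with the convention Po(0) = delta_0 *)
Definition poisson_p (lam : R) (m : nat) : R := lam ^+ m / (m`!)%:R * expR (- lam).

(** Poisson point process on R with intensity measure Lam (Last-Penrose, Def 3.1):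
    a random integer-valued measure N, N(B) ~ Po(Lam B) (Po(oo) = delta_oo), and
    N(B_1), ..., N(B_m) independent for pairwise disjoint B_i. *)
Definition is_PPP {dO : measure_display} {Om : measurableType dO}
  (P : probability Om R) (N : Om -> {measure set R -> \bar R})
  (Lam : {measure set R -> \bar R}) : Prop :=
  [/\ (forall w (B : set R), measurable B ->
         N w B = +oo%E \/ exists m : nat, N w B = (m%:R)%:E),
      (forall B : set R, measurable B -> measurable_fun setT (fun w => N w B)),
      (forall B : set R, measurable B -> (Lam B < +oo)%E ->
         forall m : nat, P [set w | N w B = (m%:R)%:E] = (poisson_p (fine (Lam B)) m)%:E),
      (forall B : set R, measurable B -> Lam B = +oo%E ->
         P [set w | N w B = +oo%E] = 1%E) &
      (forall (m : nat) (B : 'I_m -> set R) (E : 'I_m -> set (\bar R)),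
         (forall i, measurable (B i)) -> (forall i, measurable (E i)) ->
         (forall i j, i != j -> B i `&` B j = set0) ->
         P (\bigcap_(i in [set: 'I_m]) [set w | E i (N w (B i))]) =
         (\prod_(i < m) P [set w | E i (N w (B i))])%E)].

(** Y enumerates the atoms of N in increasing order (Y 0 = paper's Y_1) *)
Definition atoms_increasing (N : {measure set R -> \bar R}) (Y : nat -> R) : Prop :=
  [/\ 0 < Y 0%N, (forall i, Y i < Y i.+1) &
      forall B : set R, measurable B ->
        N B = (\sum_(j <oo) ((\1_B (Y j))%:E))%E].

Definition W_vec (k : nat) (Y : nat -> R) : 'rV[R]_k :=
  \row_(i < k) (expR (- Y i) / limn (fun n => \sum_(j < n) expR (- Y j))).

Definition cvg_in_distribution {dO dO' : measure_display}
  {Om : measurableType dO} {Om' : measurableType dO'} (k : nat)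
  (P : probability Om R) (X : nat -> Om -> 'rV[R]_k)
  (P' : probability Om' R) (Xlim : Om' -> 'rV[R]_k) : Prop :=
  forall f : 'rV[R]_k -> R, continuous f -> (exists M : R, forall v, `|f v| <= M) ->
    (fun n => \int[P]_w (f (X n w))%:E)%E @ \oo --> (\int[P']_w (f (Xlim w))%:E)%E.

End defs.

(* Main.v *)
Require Import Defs.
From HB Require Import structures.
From mathcomp Require Import all_boot all_order all_algebra.
From mathcomp Require Import all_classical all_reals all_analysis measurable_realfun.
From mathcomp Require Import ring lra.
Import Order.TTheory GRing.Theory Num.Theory.
Import numFieldNormedType.Exports.
Local Open Scope classical_set_scope.
Local Open Scope ring_scope.
Set Implicit Arguments. Unset Strict Implicit. Unset Printing Implicit Defensive.

(* With F(t) = P(T_1 <= t), the law of a spherical cap, cone integration and a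
   rotation taking q to a coordinate axis give F(t) ~ C t^p as t -> 0, with
   p = (d-1)/2 = 1/alpha; hence n F(y/beta_n) -> Lambda [0,y].  Cut [0,M] into
   cells of width 1/r.  The counts of the points beta_n T_i in the cells are
   multinomial and converge to the independent Poisson counts of the limit
   process.  Up to an error controlled by r, by the event that [0,L] contains no
   point and by the sum of e^{-y} over the points y beyond M, the top k
   normalised weights are a function of the cell counts alone, on the sample side and on
   the Poisson side.  The tail sum has mean O(e^{-M/2}) uniformly in n, since
   n F(y/beta_n) <= D y^p for all y > 0.  So both expectations of f are close to
   the same finite combination of cell-count probabilities. *)

(** No measurability of the limit weights in the sample point is given: only the counts [N w B] are
    measurable, while [Y] is just some enumeration valid almost surely. Hence each integral of [f]
    is trapped between integrals of step functions carried by cell-count events, up to a measurable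
    exceptional event. The same device covers the decreasing rearrangement on the sample side.

    Both sides enter through one pathwise interface: values [b i] and counts [K y] with
    [expR (- y) <= b i] exactly when [i < K y]. The approximation is proved once for this interface
    and applied twice. The finite family of count vectors is chosen from the Poisson law alone; the
    sample inherits it, because finitely many probabilities converge together.

    Surface measure is an iterated one-dimensional integral, so rotation invariance is derived from
    translations, reflections and Tonelli. The cap volume is not computed: the cone over the cap
    lies between flat-based cones of heights [1 - t] and 1, whose volumes have ratio tending to
    1. *)

Section nonneg_integral.
Local Open Scope ereal_scope.
Context d (T : measurableType d) (R : realType) (mu : {measure set T -> \bar R}).

(** The integral of a nonnegative function is a supremum over the simple functions below it, so
    enlarging the function enlarges the set of competitors. Arbitrary [f] and [g] are allowed
    because the test function of the weights and the cone integrand of [rho] come with no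
    measurability. *)
Lemma ge0_le_integral_nonmeas (f g : T -> \bar R) :
  (forall x, 0 <= f x) -> (forall x, f x <= g x) ->
  \int[mu]_x f x <= \int[mu]_x g x.
Proof.
move=> f0 fg.
have g0 x : 0 <= g x by exact: le_trans (fg x).
rewrite !ge0_integralTE//; apply: ereal_sup_le => _ [h /= hf <-].
by exists h => // x; apply: le_trans (fg x).
Qed.

End nonneg_integral.

(** * Translations, dilations and reflection of the line *)

Section affine_change.
Local Open Scope ereal_scope.
Context {R : realType}.
Notation mu := (@lebesgue_measure R).

(** The image measure gives every interval []a, b]] its length, which characterises Lebesgue
    measure; the dilation below is treated in the same way after multiplying the image measure by
    [c]. *)
Lemma lebesgue_measure_shift (c : R) (A : set (measurableTypeR R)) : measurable A ->
  pushforward mu (fun t : measurableTypeR R => (t + c)%R : measurableTypeR R) A = mu A.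
Proof.
have mf : measurable_fun setT (fun t : measurableTypeR R => (t + c)%R : measurableTypeR R).
  by apply: measurable_funD.
move=> mA; apply/esym.
apply: (@lebesgue_measure_unique R (pushforward mu (fun t : measurableTypeR R => (t + c)%R : measurableTypeR R))) => //= _ [[a b]] _ <-.
rewrite /pushforward.
rewrite (_ : _ @^-1` _ = `](a - c)%R, (b - c)%R]%classic); last first.
  by apply/seteqP; split => x /=; rewrite !in_itv/= ltrBlDr lerBrDr.
rewrite /= !lebesgue_measure_itv/= !lte_fin ltrBlDr subrK.
case: ifP => // _. rewrite -!EFinD; congr (_%:E); lra.
Qed.

Lemma integral_shift (c : R) (f : R -> \bar R) : measurable_fun setT f ->
  (forall t, 0 <= f t) -> \int[mu]_t f (t + c)%R = \int[mu]_t f t.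
Proof.
move=> mf f0.
have mg : measurable_fun setT (fun t : measurableTypeR R => (t + c)%R : measurableTypeR R).
  by apply: measurable_funD.
have := @ge0_integral_pushforward _ _ (measurableTypeR R) (measurableTypeR R) R _ mg mu setT f measurableT mf.
rewrite preimage_setT /= => <-//.
by apply: eq_measure_integral => A mA _; exact: lebesgue_measure_shift.
Qed.

Lemma lebesgue_measure_scale (c : R) (c0 : (0 < c)%R) (A : set (measurableTypeR R)) : measurable A ->
  pushforward mu (fun t : measurableTypeR R => (c * t)%R : measurableTypeR R) A = (c^-1)%:E * mu A.
Proof.
have mf : measurable_fun setT (fun t : measurableTypeR R => (c * t)%R : measurableTypeR R).
  by apply: measurable_funM.
move=> mA.
have c0' : (0 <= c)%R by exact: ltW.
have := @lebesgue_measure_unique R (mscale (NngNum c0') (pushforward mu (fun t : measurableTypeR R => (c * t)%R : measurableTypeR R))).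
move=> H.
rewrite H//= /mscale/= ?muleA -?EFinM ?mulVf ?gt_eqF ?mul1e//.
move=> _ [[a b]] _ <-.
rewrite /mscale/= /pushforward.
rewrite (_ : _ @^-1` _ = `](a / c)%R, (b / c)%R]%classic); last first.
  by apply/seteqP; split => x /=; rewrite !in_itv/= ltr_pdivrMr// ler_pdivlMr// mulrC.
rewrite !lebesgue_measure_itv/= !lte_fin ltr_pM2r ?invr_gt0//.
case: ifP => // _; last by rewrite mule0.
rewrite -!EFinD -EFinM; congr (_%:E); field. by rewrite gt_eqF.
Qed.

Lemma integral_scale (c : R) (f : R -> \bar R) : (0 < c)%R -> measurable_fun setT f ->
  (forall t, 0 <= f t) -> \int[mu]_t f (c * t)%R = (c^-1)%:E * \int[mu]_t f t.
Proof.
move=> c0 mf f0.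
have mg : measurable_fun setT (fun t : measurableTypeR R => (c * t)%R : measurableTypeR R).
  by apply: measurable_funM.
have := @ge0_integral_pushforward _ _ (measurableTypeR R) (measurableTypeR R) R _ mg mu setT f measurableT mf.
rewrite preimage_setT /= => <-//.
have ci : (0 <= c^-1)%R by rewrite invr_ge0 ltW.
transitivity (\int[mscale (NngNum ci) mu]_t f t).
  by apply: eq_measure_integral => A mA _; exact: lebesgue_measure_scale.
by rewrite ge0_integral_mscale.
Qed.

Lemma integral_reflect (f : R -> \bar R) : measurable_fun setT f ->
  (forall t, 0 <= f t) -> \int[mu]_t f (- t)%R = \int[mu]_t f t.
Proof.
move=> mf f0.
have mg : measurable_fun setT (fun t : measurableTypeR R => (- t)%R : measurableTypeR R) by exact: measurable_funN.
have := @ge0_integral_pushforward _ _ (measurableTypeR R) (measurableTypeR R) R _ mg mu setT f measurableT mf.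
rewrite preimage_setT /= => <-//.
by apply: eq_measure_integral => A mA _; exact: lebesgue_measureN.
Qed.

End affine_change.

(** * Rotation invariance in the plane *)

Section plane.
Local Open Scope ereal_scope.
Context {R : realType}.
Notation mu := (@lebesgue_measure R).
Notation RR := (measurableTypeR R).

Definition meas2 (G : R -> R -> \bar R) :=
  measurable_fun setT (fun z : RR * RR => G z.1 z.2).

Lemma meas2_comp d (T : measurableType d) (G : R -> R -> \bar R) (u v : T -> RR) :
  meas2 G -> measurable_fun setT u -> measurable_fun setT v ->
  measurable_fun setT (fun t => G (u t) (v t)).
Proof.
move=> mG mu' mv.
exact: (measurableT_comp mG (measurable_fun_pair mu' mv)).
Qed.

Lemma tonelli2 (G : R -> R -> \bar R) : meas2 G -> (forall t s, 0 <= G t s) ->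
  \int[mu]_t \int[mu]_s G t s = \int[mu]_s \int[mu]_t G t s.
Proof.
move=> mG G0.
exact: (@fubini_tonelli _ _ RR RR R mu mu (fun z => G z.1 z.2) mG (fun z => G0 _ _)).
Qed.

Lemma shear_inner (b : R) (G : R -> R -> \bar R) : meas2 G -> (forall t s, 0 <= G t s) ->
  \int[mu]_t \int[mu]_s G t (s + b * t)%R = \int[mu]_t \int[mu]_s G t s.
Proof.
move=> mG G0; apply: eq_integral => t _.
apply: (@integral_shift R (b * t) (G t)) => //.
apply: (@meas2_comp _ RR G (cst t) id) => //; exact: measurable_cst.
Qed.

(** The outer variable moves by an amount depending on the inner one, so Tonelli exchanges the
    integrations before the translation and restores them after it. *)
Lemma shear_outer (a : R) (G : R -> R -> \bar R) : meas2 G -> (forall t s, 0 <= G t s) ->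
  \int[mu]_t \int[mu]_s G (t + a * s)%R s = \int[mu]_t \int[mu]_s G t s.
Proof.
move=> mG G0.
have mD : measurable_fun setT (fun z : RR * RR => (z.1 + a * z.2)%R : RR).
  by apply: measurable_funD => //; apply: measurable_funM.
have m2 : measurable_fun setT (fun z : RR * RR => z.2 : RR) by exact: measurable_snd.
have mG' : meas2 (fun t s => G (t + a * s)%R s) by exact: (meas2_comp mG mD m2).
transitivity (\int[mu]_s \int[mu]_t G (t + a * s)%R s).
  exact: (tonelli2 mG' (fun t s => G0 _ _)).
transitivity (\int[mu]_s \int[mu]_t G t s); last exact/esym/(tonelli2 mG G0).
apply: eq_integral => s _.
apply: (@integral_shift R (a * s) (fun t => G t s)) => //.
by apply: (@meas2_comp _ RR G id (cst s)).
Qed.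

(* A rotation which is not a half-turn is a product of three shears. *)
Lemma rotation_invariance (c s : R) (G : R -> R -> \bar R) : s != 0%R ->
  (c ^+ 2 + s ^+ 2 = 1)%R -> meas2 G -> (forall x y, 0 <= G x y) ->
  \int[mu]_x \int[mu]_y G (c * x - s * y)%R (s * x + c * y)%R =
  \int[mu]_x \int[mu]_y G x y.
Proof.
(* With [c] and [s] the cosine and sine of the angle, [a] is minus the tangent of the half-angle:
   the shears have coefficients [a], [s], [a]. The identity [e2] below is
   [(c - 1) * (c + 1) = - s ^+ 2] divided by [s]. *)
move=> s0 cs mG G0; pose a := ((c - 1) / s)%R.
have m1 : measurable_fun setT (fun z : RR * RR => z.1 : RR) by exact: measurable_fst.
have m2 : measurable_fun setT (fun z : RR * RR => z.2 : RR) by exact: measurable_snd.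
have mD1 : measurable_fun setT (fun z : RR * RR => (z.1 + a * z.2)%R : RR).
  by apply: measurable_funD => //; apply: measurable_funM.
have mG1 : meas2 (fun x y => G (x + a * y)%R y) by exact: (meas2_comp mG mD1 m2).
have mD2 : measurable_fun setT (fun z : RR * RR => (z.2 + s * z.1)%R : RR).
  by apply: measurable_funD => //; apply: measurable_funM.
have mG2 : meas2 (fun x y => G (x + a * (y + s * x))%R (y + s * x)%R).
  exact: (meas2_comp mG1 m1 mD2).
have e1 : (1 + a * s = c)%R by rewrite /a; field.
have e2 : (2 * a + a ^+ 2 * s = - s)%R.
  have e0 : (a * s = c - 1)%R by rewrite -e1; ring.
  apply: (mulIf s0).
  transitivity ((a * s) * (2 + a * s))%R; first by ring.
  by rewrite e0; lra.
pose G2 x y := G (x + a * (y + s * x))%R (y + s * x)%R.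
transitivity (\int[mu]_x \int[mu]_y G2 (x + a * y)%R y).
  apply: eq_integral => x _; apply: eq_integral => y _.
  rewrite /G2; congr G.
    transitivity ((1 + a * s) * x + (2 * a + a ^+ 2 * s) * y)%R; last by ring.
    by rewrite e1 e2 mulNr.
  transitivity (s * x + (1 + a * s) * y)%R; last by ring.
  by rewrite e1.
transitivity (\int[mu]_x \int[mu]_y G2 x y).
  exact: (shear_outer a mG2 (fun x y => G0 _ _)).
transitivity (\int[mu]_x \int[mu]_y G (x + a * y)%R y).
  exact: (shear_inner s mG1 (fun x y => G0 _ _)).
exact: (shear_outer a mG G0).
Qed.

Lemma plane_align (p q : R) (H : R -> R -> \bar R) :
  meas2 H -> (forall x y, 0 <= H x y) ->
  \int[mu]_t \int[mu]_s H (t ^+ 2 + s ^+ 2)%R (p * t + q * s)%R =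
  \int[mu]_t \int[mu]_s H (t ^+ 2 + s ^+ 2)%R (Num.sqrt (p ^+ 2 + q ^+ 2) * t)%R.
Proof.
move=> mH H0.
have mq : measurable_fun setT (fun z : RR * RR => (z.1 ^+ 2 + z.2 ^+ 2)%R : RR).
  by apply: measurable_funD; apply: measurable_funX.
have ml (a b : R) : measurable_fun setT (fun z : RR * RR => (a * z.1 + b * z.2)%R : RR).
  by apply: measurable_funD; apply: measurable_funM.
have mF : meas2 (fun x y => H (x ^+ 2 + y ^+ 2)%R (p * x + q * y)%R).
  exact: (meas2_comp mH mq (ml p q)).
(* For [q = 0] the aligning rotation is the identity or a half-turn, which the shears do not reach;
   a reflection of the first variable supplies the absolute value of [p]. *)
have [q0|q0] := eqVneq q 0%R.
  rewrite q0 expr0n/= addr0 sqrtr_sqr.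
  have [p0|p0] := ger0P p.
    by apply: eq_integral => x _; apply: eq_integral => y _; rewrite mul0r addr0.
  rewrite -(@integral_reflect R (fun t => \int[mu]_s H (t ^+ 2 + s ^+ 2)%R (p * t + 0 * s)%R)).
  - apply: eq_integral => x _; apply: eq_integral => y _.
    by rewrite sqrrN; congr H; ring.
  - have := @measurable_fun_fubini_tonelli_F _ _ RR RR R mu (fun z => H (z.1 ^+ 2 + z.2 ^+ 2)%R (p * z.1 + 0 * z.2)%R).
    by apply => //; exact: (meas2_comp mH mq (ml p 0%R)).
  - by move=> t; exact: integral_ge0.
have r0 : (0 < p ^+ 2 + q ^+ 2)%R.
  by rewrite ltr_wpDl ?sqr_ge0// exprn_even_gt0.
set r := Num.sqrt _.
have rp : (0 < r)%R by rewrite sqrtr_gt0.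
have rr : (r ^+ 2 = p ^+ 2 + q ^+ 2)%R by rewrite sqr_sqrtr// ltW.
have rn : r != 0%R by rewrite gt_eqF.
have hq : (q / r != 0)%R by rewrite mulf_eq0 invr_eq0 negb_or q0.
have hpq : ((p / r) ^+ 2 + (q / r) ^+ 2 = 1)%R.
  by rewrite !expr_div_n -mulrDl -rr divff// expf_neq0.
transitivity (\int[mu]_x \int[mu]_y
   (fun x y => H (x ^+ 2 + y ^+ 2)%R (p * x + q * y)%R)
     (p / r * x - q / r * y)%R (q / r * x + p / r * y)%R).
  exact/esym/(rotation_invariance hq hpq mF (fun _ _ => H0 _ _)).
apply: eq_integral => x _; apply: eq_integral => y _; congr H.
  transitivity ((p ^+ 2 + q ^+ 2) / r ^+ 2 * (x ^+ 2 + y ^+ 2))%R; first by field.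
  by rewrite -rr divff ?mul1r// expf_neq0.
transitivity ((p ^+ 2 + q ^+ 2) / r * x)%R; first by field.
by rewrite -rr expr2 mulfK.
Qed.

End plane.

(** * Iterated integrals: measurability, alignment of a linear form, homogeneity *)

Section iterated_integral.
Local Open Scope ereal_scope.
Context {R : realType}.
Notation mu := (@lebesgue_measure R).
Notation RR := (measurableTypeR R).
Implicit Types (n : nat) (g : (nat -> R) -> \bar R).

(** Measurability in an infinite sequence of coordinates, expressed by composition with arbitrary
    measurable coordinate functions. The property survives the substitution of an integration
    variable for one coordinate, which is what the inductions on [iter_leb_int] do. *)
Definition jointly_measurable d (T : measurableType d) (h : T -> (nat -> R) -> \bar R) :=
  forall d' (T' : measurableType d') (u : T' -> T) (v : T' -> nat -> RR),
    measurable_fun setT u -> (forall i, measurable_fun setT (fun t => v t i)) ->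
    measurable_fun setT (fun t => h (u t) (v t)).

Lemma iter_leb_intS n g : iter_leb_int n.+1 g =
  \int[mu]_t iter_leb_int n (fun v => g (fun i => if i == n then t else v i)).
Proof. by []. Qed.

Lemma iter_leb_int_ge0 n g : (forall v, 0 <= g v) -> 0 <= iter_leb_int n g.
Proof. by elim: n g => [|n IH] g g0 //=; apply: integral_ge0 => t _; exact: IH. Qed.

Lemma le_iter_leb_int n g1 g2 : (forall v, 0 <= g1 v) -> (forall v, g1 v <= g2 v) ->
  iter_leb_int n g1 <= iter_leb_int n g2.
Proof.
elim: n g1 g2 => [|n IH] g1 g2 g0 g12 //=.
by apply: ge0_le_integral_nonmeas => t; [exact: iter_leb_int_ge0|exact: IH].
Qed.

(** The induction moves the outermost integration variable into the parameter space, replacing [T]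
    by [T * RR]; partial integrals over a product are then measurable. *)
Lemma measurable_iter_leb_int n d (T : measurableType d) (h : T -> (nat -> R) -> \bar R) :
  jointly_measurable h -> (forall t v, 0 <= h t v) ->
  measurable_fun setT (fun t => iter_leb_int n (h t)).
Proof.
elim: n d T h => [|n IH] d T h mh h0 /=.
  exact: (mh _ T id (fun _ _ => 0%R)).
pose h' (z : T * RR) := fun v => h z.1 (fun i => if i == n then z.2 else v i).
have mh' : jointly_measurable h'.
  move=> d' T' u v mu' mv; apply: (mh _ T' (fun t => (u t).1) (fun t i => if i == n then (u t).2 else v t i)).
    exact: (measurableT_comp measurable_fst mu').
  by move=> i; case: (i == n) => //; exact: (measurableT_comp measurable_snd mu').
have mI : measurable_fun setT (fun z => iter_leb_int n (h' z)).
  by apply: IH => // z v; exact: h0.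
apply: (@measurable_fun_fubini_tonelli_F _ _ T RR R mu _ mI) => z.
by apply: iter_leb_int_ge0 => v; exact: h0.
Qed.

Lemma jointly_measurable_sq d (T : measurableType d) n (G : T -> R -> R -> \bar R)
    (q : nat -> R) :
  measurable_fun setT (fun z : T * (RR * RR) => G z.1 z.2.1 z.2.2) ->
  jointly_measurable (fun t v => G t (\sum_(i < n) v i ^+ 2)%R (\sum_(i < n) q i * v i)%R).
Proof.
move=> mG d' T' u v mu' mv.
have m1 : measurable_fun setT (fun t => (\sum_(i < n) v t i ^+ 2)%R : RR).
  by apply: measurable_sum => i; exact: (measurable_funX 2 (mv i)).
have m2 : measurable_fun setT (fun t => (\sum_(i < n) q i * v t i)%R : RR).
  by apply: measurable_sum => i; apply: measurable_funM => //; exact: mv.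
exact: (measurableT_comp mG (measurable_fun_pair mu' (measurable_fun_pair m1 m2))).
Qed.

Lemma eq_iter_leb_int n g1 g2 : g1 =1 g2 -> iter_leb_int n g1 = iter_leb_int n g2.
Proof. by move=> /funext ->. Qed.

Lemma sum_upd n (F : nat -> R -> R) (v : nat -> R) (t : R) :
  (\sum_(i < n.+1) F i (if (i : nat) == n then t else v i) = \sum_(i < n) F i (v i) + F n t)%R.
Proof.
rewrite big_ord_recr/= eqxx; congr (_ + _)%R.
by apply: eq_bigr => i _; rewrite ltn_eqF.
Qed.

(** Induction on the dimension. The hypothesis turns the linear form in all coordinates but the
    outermost into [r * s], with [r] the norm of its coefficients; a plane rotation then merges
    [r * s] with the outermost term. Only integrands that depend on the squared norm and the linear
    form are stable under this. *)
Lemma iter_leb_int_align n (q : nat -> R) (G : R -> R -> \bar R) :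
  meas2 G -> (forall x y, 0 <= G x y) ->
  iter_leb_int n.+1 (fun v => G (\sum_(i < n.+1) v i ^+ 2)%R (\sum_(i < n.+1) q i * v i)%R) =
  iter_leb_int n.+1 (fun v => G (\sum_(i < n.+1) v i ^+ 2)%R
     (Num.sqrt (\sum_(i < n.+1) q i ^+ 2) * v n)%R).
Proof.
elim: n G => [|n IH] G mG G0.
  rewrite /= !(big_ord_recr, big_ord0)/= !add0r.
  have [q0|q0] := ger0P (q 0%N).
    by apply: eq_integral => t _; rewrite !(big_ord_recr, big_ord0)/= !add0r sqrtr_sqr ger0_norm.
  transitivity (\int[mu]_t (fun t => G (t ^+ 2)%R (q 0%N * t)%R) (- t)%R).
    rewrite (@integral_reflect R (fun t => G (t ^+ 2)%R (q 0%N * t)%R))//.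
    - by apply: eq_integral => t _; rewrite !(big_ord_recr, big_ord0)/= !add0r.
    - apply: (@meas2_comp R _ RR G (fun t => t ^+ 2)%R (fun t => q 0%N * t)%R) => //.
      exact: mulrl_measurable.
  apply: eq_integral => t _.
  by rewrite !(big_ord_recr, big_ord0)/= !add0r sqrtr_sqr ltr0_norm// sqrrN mulrN mulNr.
pose r := Num.sqrt (\sum_(i < n.+1) q i ^+ 2).
have rr : (r ^+ 2 = \sum_(i < n.+1) q i ^+ 2)%R.
  by rewrite sqr_sqrtr// sumr_ge0// => i _; exact: sqr_ge0.
(* Integrating out the inner [n] coordinates leaves a function of the two variables in play, through
   the sum of their squares and the linear form. *)
pose H a b := iter_leb_int n (fun v => G (\sum_(i < n) v i ^+ 2 + a)%R b).
have mH : meas2 H.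
  pose h (z : RR * RR) := fun v : nat -> R => G (\sum_(i < n) v i ^+ 2 + z.1)%R z.2.
  apply: (@measurable_iter_leb_int n _ _ h) => [d' T' u v mu' mv|z v]; last exact: G0.
  apply: (meas2_comp mG).
    apply: measurable_funD; last exact: (measurableT_comp measurable_fst mu').
    by apply: measurable_sum => i; exact: (measurable_funX 2 (mv i)).
  exact: (measurableT_comp measurable_snd mu').
have H0 a b : 0 <= H a b by exact: iter_leb_int_ge0.
transitivity (\int[mu]_t \int[mu]_s H (t ^+ 2 + s ^+ 2)%R (q n.+1 * t + r * s)%R).
  rewrite iter_leb_intS; apply: eq_integral => t _.
  pose Gt a b := G (a + t ^+ 2)%R (b + q n.+1 * t)%R.
  transitivity (iter_leb_int n.+1 (fun v => Gt (\sum_(i < n.+1) v i ^+ 2)%R (\sum_(i < n.+1) q i * v i)%R)).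
    apply: eq_iter_leb_int => v.
    by rewrite (sum_upd _ (fun _ x => x ^+ 2)%R) (sum_upd _ (fun i x => q i * x)%R).
  have mGt : meas2 Gt.
    by apply: (meas2_comp mG); apply: measurable_funD.
  have Gt0 x y : 0 <= Gt x y by exact: G0.
  rewrite (IH _ mGt Gt0).
  rewrite iter_leb_intS; apply: eq_integral => s _; apply: eq_iter_leb_int => v.
  rewrite (sum_upd _ (fun _ x => x ^+ 2)%R) eqxx -/r /Gt; congr G; ring.
rewrite (plane_align (q n.+1) r mH H0) iter_leb_intS.
under [RHS]eq_integral do rewrite iter_leb_intS.
apply: eq_integral => t _; apply: eq_integral => s _; apply: eq_iter_leb_int => v.
rewrite (@sum_upd n.+1 (fun _ x => x ^+ 2)%R (fun i => if i == n then s else v i)) (@sum_upd n (fun _ x => x ^+ 2)%R) eqxx.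
rewrite (@big_ord_recr _ _ _ n.+1)/= -rr; congr G; first by ring.
by congr (Num.sqrt _ * _)%R; rewrite addrC.
Qed.

Lemma iter_leb_intZ n (c : R) g : (0 <= c)%R -> jointly_measurable (fun _ : unit => g) ->
  (forall v, 0 <= g v) ->
  iter_leb_int n (fun v => c%:E * g v) = c%:E * iter_leb_int n g.
Proof.
move=> c0; elim: n g => [|n IH] g mg g0 //=.
rewrite -ge0_integralZl//.
- apply: eq_integral => t _; rewrite IH// => d T u v mu' mv.
  by apply: (mg _ T u (fun s i => if i == n then t else v s i)) => // i; case: (i == n).
- apply: (@measurable_iter_leb_int n _ RR (fun (t : RR) v => g (fun i => if i == n then t else v i))) => // d T u v mu' mv.
  by apply: (mg _ T (fun=> tt) (fun s i => if i == n then u s else v s i)) => // i; case: (i == n).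
- by move=> t _; exact: iter_leb_int_ge0.
Qed.

Lemma iter_leb_int_scale n (c : R) g : (0 < c)%R -> jointly_measurable (fun _ : unit => g) ->
  (forall v, 0 <= g v) ->
  iter_leb_int n (fun v => g (fun i => c * v i)%R) = ((c ^- n)%:E * iter_leb_int n g).
Proof.
move=> c0; elim: n g => [|n IH] g mg g0 /=.
  by rewrite expr0 invr1 mul1e; congr g; apply/funext => i; rewrite mulr0.
pose h t := iter_leb_int n (fun v => g (fun i => if i == n then t else v i)).
have mh : measurable_fun setT (h : RR -> _).
  apply: (@measurable_iter_leb_int n _ RR (fun (t : RR) v => g (fun i => if i == n then t else v i))) => // d T u v mu' mv.
  by apply: (mg _ T (fun=> tt) (fun s i => if i == n then u s else v s i)) => // i; case: (i == n).
have h0 t : 0 <= h t by exact: iter_leb_int_ge0.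
have cn : (0 <= c ^- n)%R by rewrite invr_ge0 exprn_ge0// ltW.
transitivity (\int[mu]_t ((c ^- n)%:E * h (c * t)%R)).
  apply: eq_integral => t _.
  rewrite /h -IH//; last first.
    move=> d T u v mu' mv.
    by apply: (mg _ T u (fun s i => if i == n then (c * t)%R else v s i)) => // i; case: (i == n).
  apply: eq_iter_leb_int => v; congr g; apply/funext => i; by case: ifP.
rewrite ge0_integralZl//; last first.
  by apply: (measurableT_comp mh); exact: measurable_funM.
by rewrite integral_scale// muleA -EFinM exprS invfM mulrC.
Qed.

End iterated_integral.

(** * Volumes of balls *)

Section ball_volume.
Local Open Scope ereal_scope.
Context {R : realType}.
Notation mu := (@lebesgue_measure R).
Notation RR := (measurableTypeR R).
Implicit Types (n : nat) (a : R).

Definition ereal_of_bool (b : bool) : \bar R := if b then 1 else 0.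

Lemma ereal_of_bool_ge0 b : 0 <= ereal_of_bool b.
Proof. by case: b => //=; rewrite lee01. Qed.

Lemma le_ereal_of_bool (b1 b2 : bool) : (b1 -> b2) -> ereal_of_bool b1 <= ereal_of_bool b2.
Proof. by case: b1; case: b2 => //= h; rewrite /ereal_of_bool ?lee01//; have := h isT. Qed.

Lemma measurable_ereal_of_bool d (T : measurableType d) (b : T -> bool) :
  measurable_fun setT b -> measurable_fun setT (fun t => ereal_of_bool (b t)).
Proof. by move=> mb; apply: measurable_fun_ifT. Qed.

Definition sumsq n (v : nat -> R) : R := (\sum_(i < n) v i ^+ 2)%R.

Lemma sumsq_ge0 n v : (0 <= sumsq n v)%R.
Proof. by apply: sumr_ge0 => i _; exact: sqr_ge0. Qed.

Lemma measurable_sumsq n d (T : measurableType d) (v : T -> nat -> RR) :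
  (forall i, measurable_fun setT (fun t => v t i)) ->
  measurable_fun setT (fun t => sumsq n (v t) : RR).
Proof. by move=> mv; apply: measurable_sum => i; exact: (measurable_funX 2 (mv i)). Qed.

(** The argument [a] is a squared radius. The origin is left out, as in the cone integral that
    defines the surface measure; [cball_vol] keeps it, which is the form in which the slices of the
    cone over a cap are bounded above. *)
Definition ball_vol n a :=
  iter_leb_int n (fun v => ereal_of_bool ((0 < sumsq n v) && (sumsq n v <= a))%R).
Definition cball_vol n a :=
  iter_leb_int n (fun v => ereal_of_bool (sumsq n v <= a)%R).

Lemma ball_vol_ge0 n a : 0 <= ball_vol n a.
Proof. by apply: iter_leb_int_ge0 => v; exact: ereal_of_bool_ge0. Qed.

Lemma jm_ball n a : jointly_measurable (fun (_ : unit) v =>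
  ereal_of_bool ((0 < sumsq n v) && (sumsq n v <= a))%R).
Proof.
move=> d T u v mu' mv; apply: measurable_ereal_of_bool; apply: measurable_and.
  by apply: measurable_fun_ltr; [exact: measurable_cst|exact: measurable_sumsq].
by apply: measurable_fun_ler; [exact: measurable_sumsq|exact: measurable_cst].
Qed.

Lemma ball_vol_scale n (r : R) : (0 < r)%R -> ball_vol n (r ^+ 2)%R = (r ^+ n)%:E * ball_vol n 1.
Proof.
move=> r0.
have := @iter_leb_int_scale R n r _ r0 (@jm_ball n (r ^+ 2)%R) (fun=> ereal_of_bool_ge0 _).
rewrite (_ : iter_leb_int n _ = ball_vol n 1).
  move=> ->; rewrite muleA -EFinM divff ?mul1e// expf_neq0// gt_eqF//.
apply: eq_iter_leb_int => v; congr ereal_of_bool.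
have -> : sumsq n (fun i => r * v i)%R = (r ^+ 2 * sumsq n v)%R.
  by rewrite /sumsq mulr_sumr; apply: eq_bigr => i _; rewrite exprMn.
have r2 : (0 < r ^+ 2)%R by rewrite exprn_gt0.
by rewrite pmulr_rgt0// -[X in (_ <= X)%R]mulr1 ler_pM2l.
Qed.

(** The unit ball lies in the cube with sides [[-1, 1]], whose iterated integral is at most
    [2 ^+ n]. *)
Lemma ball_vol_lty n : ball_vol n 1 < +oo.
Proof.
have H : forall m, iter_leb_int m (fun v : nat -> R => ereal_of_bool [forall i : 'I_m, `|v i| <= 1]%R)
    <= (2 ^+ m)%:E.
  elim=> [|m IH] /=.
    by rewrite expr0 /ereal_of_bool; case: ifP => //; rewrite ?lee_fin ?ler01.
  apply: (@le_trans _ _ (\int[mu]_t ((2 ^+ m)%:E * (\1_(`[(-1)%R, 1%R] : set R) t)%:E))).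
    apply: ge0_le_integral_nonmeas => t.
      by apply: iter_leb_int_ge0 => v; exact: ereal_of_bool_ge0.
    rewrite indicE; case: (boolP (t \in _)) => ht.
      rewrite mule1; apply: le_trans IH; apply: le_iter_leb_int => v; first exact: ereal_of_bool_ge0.
      apply: le_ereal_of_bool => /forallP h; apply/forallP => i.
      by have := h (widen_ord (leqnSn m) i); rewrite /= ltn_eqF.
    rewrite mule0; rewrite (_ : iter_leb_int _ _ = iter_leb_int m (fun=> 0)).
      elim: {IH ht} m => //= m IH.
      by under eq_integral do rewrite (_ : iter_leb_int m _ = iter_leb_int m (fun=> 0))//;
         apply: (le_trans _ IH); rewrite integral0_eq ?iter_leb_int_ge0// => x _;
         apply/eqP; rewrite eq_le IH iter_leb_int_ge0.
    apply: eq_iter_leb_int => v; rewrite /ereal_of_bool; case: ifP => // /forallP/(_ ord_max).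
    rewrite /= eqxx => ht'; move: ht; rewrite notin_setE /= in_itv/= -ler_norml ht'.
    by case.
  rewrite ge0_integralZl//; last exact/measurable_EFinP/measurable_indic.
  have -> : \int[mu]_x (\1_(`[(-1)%R, 1%R] : set R) x)%:E = mu (`[(-1)%R, 1%R] : set RR).
    by rewrite integral_indic// setIT.
  rewrite lebesgue_measure_itv/= lte_fin ifT; last by lra.
  by rewrite -EFinD -EFinM lee_fin exprS; lra.
apply: (@le_lt_trans _ _ (2 ^+ n)%:E); last by rewrite ltry.
apply: (le_trans _ (H n)); apply: le_iter_leb_int => v; first exact: ereal_of_bool_ge0.
apply: le_ereal_of_bool => /andP[_ h]; apply/forallP => i.
rewrite -(@ler_pXn2r _ 2)// ?nnegrE// expr1n real_normK ?num_real//.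
by apply: le_trans h; rewrite /sumsq (bigD1 i)//= lerDl sumr_ge0// => j _; exact: sqr_ge0.
Qed.

Lemma ball_vol_fin n : ball_vol n 1 \is a fin_num.
Proof. by rewrite ge0_fin_numE ?ball_vol_lty// ball_vol_ge0. Qed.

Lemma sumsq_upd n v t :
  sumsq n.+1 (fun i => if i == n then t else v i) = (sumsq n v + t ^+ 2)%R.
Proof. exact: (@sum_upd R n (fun _ x => x ^+ 2)%R). Qed.

(** The integrands can differ only where the outermost coordinate is 0, a null set of the line;
    hence the dimension is at least one. *)
Lemma cball_volE n a : cball_vol n.+1 a = ball_vol n.+1 a.
Proof.
rewrite /cball_vol /ball_vol !iter_leb_intS.
have m1 (P : R -> bool) : measurable_fun setT P ->
   measurable_fun setT (fun t : RR => iter_leb_int n (fun v =>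
     ereal_of_bool (P (sumsq n.+1 (fun i => if i == n then t else v i))))).
  move=> mP; apply: (@measurable_iter_leb_int R n _ RR (fun t v => ereal_of_bool (P (sumsq n.+1 (fun i => if i == n then t else v i))))) => [d T u v mu' mv|t v].
    apply: measurable_ereal_of_bool; apply: (measurableT_comp mP).
    apply: (@measurable_sumsq n.+1 _ T (fun s i => if i == n then u s else v s i)) => i.
    by case: (i == n).
  exact: ereal_of_bool_ge0.
apply: ge0_ae_eq_integral => //.
- by apply: (m1 (fun s => s <= a)%R); apply: measurable_fun_ler => //; exact: measurable_cst.
- apply: (m1 (fun s => (0 < s) && (s <= a))%R); apply: measurable_and.
    by apply: measurable_fun_ltr => //; exact: measurable_cst.
  by apply: measurable_fun_ler => //; exact: measurable_cst.
- by move=> t _; apply: iter_leb_int_ge0 => v; exact: ereal_of_bool_ge0.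
- by move=> t _; apply: iter_leb_int_ge0 => v; exact: ereal_of_bool_ge0.
exists [set 0%R]; split => //; first exact: lebesgue_measure_set1.
move=> t /= /not_implyP[_ h]; apply: contrapT => t0; apply: h.
apply: eq_iter_leb_int => v; congr ereal_of_bool; rewrite sumsq_upd.
by rewrite ltr_wpDl ?sumsq_ge0// exprn_even_gt0//=; apply/eqP.
Qed.

Lemma integral_exprn n (tau : R) : (0 < tau)%R ->
  \int[mu]_s (((s ^+ n)%:E * ereal_of_bool ((0 < s) && (s <= tau))%R)) = (tau ^+ n.+1 / n.+1%:R)%:E.
Proof.
move=> t0.
transitivity (\int[mu]_(s in `]0%R, tau]) (s ^+ n)%:E).
  rewrite [RHS]integral_mkcond; apply: eq_integral => s _.
  rewrite patchE mem_setE in_itv/= /ereal_of_bool.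
  by case: ifP; rewrite ?mule1 ?mule0.
rewrite integral_itv_obnd_cbnd; last first.
  by apply/measurable_EFinP; apply: measurable_funTS; exact: exprn_measurable.
rewrite (@continuous_FTC2 _ _ (fun x => x ^+ n.+1 / n.+1%:R)%R)//=.
- by rewrite expr0n/= mul0r sube0.
- by apply: continuous_in_subspaceT => x _; exact: exprn_continuous.
- split.
  + by move=> x _; apply: derivableM => //=; exact: exprn_derivable.
  + apply: cvgM; last exact: cvg_cst.
    by apply: cvg_at_right_filter; exact: exprn_continuous.
  + apply: cvgM; last exact: cvg_cst.
    by apply: cvg_at_left_filter; exact: exprn_continuous.
- move=> x _; rewrite derive1Mr//; last exact: exprn_derivable.
  by rewrite exp_derive1 -mulrA mulrC mulfVK.
Qed.

End ball_volume.

(** * Volume of the cone over a spherical cap *)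

Section cap_volume.
Local Open Scope ereal_scope.
Context {R : realType}.
Notation mu := (@lebesgue_measure R).
Notation RR := (measurableTypeR R).
Implicit Types (n : nat) (q : nat -> R).

(** To be read with [a] the squared norm of a vector v and [b] its inner product with q: v is in the
    punctured unit ball and v/|v| has [T_] at most [t], the denominator being cleared. *)
Definition in_cap (t a b : R) :=
  [&& (0 < a)%R, (a <= 1)%R & ((1 - t) * Num.sqrt a <= b)%R].

Definition cap_vol n q (t : R) :=
  iter_leb_int n (fun v => ereal_of_bool (in_cap t (sumsq n v) (\sum_(i < n) q i * v i)%R)).

Lemma meas2_cap t : meas2 (fun a b : R => ereal_of_bool (in_cap t a b)).
Proof.
apply: measurable_ereal_of_bool; apply: measurable_and.
  by apply: measurable_fun_ltr; [exact: measurable_cst|exact: measurable_fst].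
apply: measurable_and.
  by apply: measurable_fun_ler; [exact: measurable_fst|exact: measurable_cst].
apply: measurable_fun_ler; last exact: measurable_snd.
apply: measurable_funM => //.
have ms : measurable_fun setT (@Num.sqrt R : RR -> RR).
  by apply: continuous_measurable_fun; exact: sqrt_continuous.
exact: (measurableT_comp ms measurable_fst).
Qed.

(** After alignment the outermost variable [s] is the component along [q], and the remaining
    integral measures the slice of the cone at height [s]. *)
Lemma cap_vol_align n q (t : R) : (\sum_(i < n.+1) q i ^+ 2 = 1)%R ->
  cap_vol n.+1 q t = \int[mu]_s iter_leb_int n (fun v =>
    ereal_of_bool (in_cap t (sumsq n v + s ^+ 2)%R s)).
Proof.
move=> q1; rewrite /cap_vol.
rewrite (@iter_leb_int_align R n q _ (meas2_cap t)); last by move=> *; exact: ereal_of_bool_ge0.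
rewrite q1 sqrtr1 iter_leb_intS; apply: eq_integral => s _.
apply: eq_iter_leb_int => v; rewrite eqxx mul1r; congr (ereal_of_bool (in_cap _ _ _)).
exact: sumsq_upd.
Qed.

Lemma integral_exprn_scale n (tau c : R) : (0 < tau)%R -> (0 <= c)%R ->
  \int[mu]_s (c%:E * ((s ^+ n)%:E * ereal_of_bool ((0 < s) && (s <= tau))%R)) =
  (c * tau ^+ n.+1 / n.+1%:R)%:E.
Proof.
move=> t0 c0; have h0 s : 0 <= (s ^+ n)%:E * ereal_of_bool ((0 < s) && (s <= tau))%R.
  rewrite /ereal_of_bool; case: ifP; rewrite ?mule0// mule1 lee_fin => /andP[s0 _].
  by rewrite exprn_ge0// ltW.
rewrite ge0_integralZl//.
  by rewrite integral_exprn// -EFinM mulrA.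
apply: emeasurable_funM.
  by apply/measurable_EFinP; exact: exprn_measurable.
apply: measurable_ereal_of_bool; apply: measurable_and.
  by apply: measurable_fun_ltr => //; exact: measurable_cst.
by apply: measurable_fun_ler => //; exact: measurable_cst.
Qed.

Lemma iter_leb_int0 n : @iter_leb_int R n (fun=> 0) = 0.
Proof. by elim: n => [|m IH] //; rewrite iter_leb_intS integral0_eq. Qed.

Section bounds.
Variables (n : nat) (q : nat -> R) (t : R).
Hypotheses (q1 : (\sum_(i < n.+2) q i ^+ 2 = 1)%R) (t01 : (0 < t < 1)%R).
(** The squared tangent of the angle whose cosine is [1 - t]: the slice at height [s] of the
    infinite cone over the cap is a ball of radius [kappa * s]. *)
Let kappa2 : R := ((2 * t - t ^+ 2) / (1 - t) ^+ 2)%R.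
Let kappa : R := Num.sqrt kappa2.
Let V : R := fine (ball_vol n.+1 1).

Let t1 : (0 < 1 - t)%R. Proof. by move: t01 => /andP[]; lra. Qed.
Let kappa2_gt0 : (0 < kappa2)%R.
Proof. by rewrite divr_gt0 ?exprn_gt0//; move: t01 => /andP[]; nra. Qed.
Let kappa_gt0 : (0 < kappa)%R. Proof. by rewrite sqrtr_gt0. Qed.
Let kappaE : (kappa ^+ 2 = kappa2)%R. Proof. by rewrite sqr_sqrtr// ltW. Qed.

Let ball_kappa (s : R) : (0 < s)%R ->
  ball_vol n.+1 (kappa2 * s ^+ 2)%R = ((kappa ^+ n.+1 * V)%:E * ((s ^+ n.+1)%:E)).
Proof.
move=> s0; rewrite -kappaE -exprMn ball_vol_scale ?mulr_gt0// exprMn.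
rewrite -(@fineK _ (ball_vol n.+1 1)) ?ball_vol_fin// -!EFinM; congr (_%:E).
by rewrite -/V; ring.
Qed.

Let V0 : (0 <= V)%R. Proof. by rewrite fine_ge0// ball_vol_ge0. Qed.

Let in_capP (s a : R) : (0 < s)%R -> (0 <= a)%R ->
  ((1 - t) * Num.sqrt (a + s ^+ 2) <= s)%R = (a <= kappa2 * s ^+ 2)%R.
Proof.
move=> s0 a0.
have s2 : (0 < s ^+ 2)%R by rewrite exprn_gt0.
rewrite -(@ler_pXn2r _ 2)// ?nnegrE ?mulr_ge0 ?sqrtr_ge0 ?(ltW s0) ?(ltW t1)//.
rewrite exprMn sqr_sqrtr ?addr_ge0 ?(ltW s2)// /kappa2 [X in _ = (_ <= X)%R]mulrAC ler_pdivlMr ?exprn_gt0//.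
apply/idP/idP; nra.
Qed.

(** Relaxing the unit-ball condition to [s <= 1] encloses the body in a flat-based cone of height 1,
    whose slices have volume [kappa ^+ n.+1 * V * s ^+ n.+1]. *)
Lemma cap_vol_le : cap_vol n.+2 q t <= (kappa ^+ n.+1 * V / n.+2%:R)%:E.
Proof.
rewrite cap_vol_align//.
have := @integral_exprn_scale n.+1 1 (kappa ^+ n.+1 * V)%R ltr01.
rewrite expr1n mulr1 => <-; last by rewrite mulr_ge0// exprn_ge0// ltW.
apply: ge0_le_integral_nonmeas => s.
  by apply: iter_leb_int_ge0 => v; exact: ereal_of_bool_ge0.
rewrite muleA; case: (ltP 0%R s) => s0; rewrite ?andTb ?andFb; last first.
  rewrite mule0 (_ : iter_leb_int _ _ = iter_leb_int n.+1 (fun=> 0)).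
    by rewrite iter_leb_int0.
  apply: eq_iter_leb_int => v; rewrite /ereal_of_bool ifF//; apply/negbTE/negP => /and3P[h1 _ h2].
  have : (0 < (1 - t) * Num.sqrt (sumsq n.+1 v + s ^+ 2))%R by rewrite mulr_gt0// sqrtr_gt0.
  by rewrite ltNge (le_trans h2).
case: (leP s 1%R) => s1; last first.
  rewrite mule0 (_ : iter_leb_int _ _ = iter_leb_int n.+1 (fun=> 0)).
    by rewrite iter_leb_int0.
  apply: eq_iter_leb_int => v; rewrite /ereal_of_bool ifF//; apply/negbTE/negP => /and3P[_ h1 _].
  have := sumsq_ge0 n.+1 v; nra.
rewrite mule1 -ball_kappa// -cball_volE.
apply: le_iter_leb_int => v; first exact: ereal_of_bool_ge0.
by apply: le_ereal_of_bool => /and3P[_ _]; rewrite in_capP// sumsq_ge0.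
Qed.

(** Up to height [1 - t] the whole slice stays in the unit ball, because [kappa2 + 1] is the inverse
    of [(1 - t) ^+ 2]. The flat-based cone of that height therefore fits inside. *)
Lemma cap_vol_ge : (kappa ^+ n.+1 * V * (1 - t) ^+ n.+2 / n.+2%:R)%:E <= cap_vol n.+2 q t.
Proof.
rewrite cap_vol_align// -integral_exprn_scale//; last by rewrite mulr_ge0// exprn_ge0// ltW.
apply: ge0_le_integral_nonmeas => s.
  rewrite mule_ge0 ?lee_fin ?mulr_ge0 ?exprn_ge0 ?(ltW kappa_gt0)//.
  rewrite /ereal_of_bool; case: ifP; rewrite ?mule0// mule1 lee_fin => /andP[s0 _].
  by rewrite exprn_ge0// ltW.
rewrite muleA {1}/ereal_of_bool; case: (boolP ((0 < s)%R && (s <= 1 - t)%R)) => [/andP[s0 s1]|]; last first.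
  by move=> _; rewrite mule0 iter_leb_int_ge0// => v; exact: ereal_of_bool_ge0.
rewrite mule1 -ball_kappa//.
apply: le_iter_leb_int => v; first exact: ereal_of_bool_ge0.
apply: le_ereal_of_bool => /andP[h1 h2]; apply/and3P; split.
- by rewrite ltr_wpDr// sqr_ge0.
- apply: (@le_trans _ _ (kappa2 * s ^+ 2 + s ^+ 2)%R); first by rewrite lerD2r.
  rewrite -[X in (_ + X <= _)%R]mul1r -mulrDl.
  have -> : (kappa2 + 1 = ((1 - t) ^+ 2)^-1)%R by rewrite /kappa2; field; rewrite gt_eqF.
  rewrite mulrC ler_pdivrMr ?exprn_gt0// mul1r.
  by rewrite ler_pXn2r// nnegrE ltW.
- by rewrite in_capP// sumsq_ge0.
Qed.

End bounds.

End cap_volume.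

(** * The law of a cap under the density *)

Section cap_on_sphere.
Local Open Scope ereal_scope.
Context {R : realType}.
Notation mu := (@lebesgue_measure R).
Notation RR := (measurableTypeR R).

Lemma dotp_ge0 d (x : 'rV[R]_d) : (0 <= dotp x x)%R.
Proof. by apply: sumr_ge0 => i _; rewrite -expr2 sqr_ge0. Qed.

Lemma enorm_ge0 d (x : 'rV[R]_d) : (0 <= enorm x)%R.
Proof. exact: sqrtr_ge0. Qed.

Lemma enorm_sq d (x : 'rV[R]_d) : (enorm x ^+ 2 = dotp x x)%R.
Proof. by rewrite sqr_sqrtr// dotp_ge0. Qed.

Lemma dotpZr d (c : R) (x y : 'rV[R]_d) : (dotp x (c *: y) = c * dotp x y)%R.
Proof. by rewrite /dotp mulr_sumr; apply: eq_bigr => i _; rewrite mxE; ring. Qed.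

Lemma enormZ d (c : R) (x : 'rV[R]_d) : (0 <= c)%R -> (enorm (c *: x) = c * enorm x)%R.
Proof.
move=> c0; rewrite /enorm dotpZr.
have -> : (dotp (c *: x) x = c * dotp x x)%R.
  by rewrite /dotp mulr_sumr; apply: eq_bigr => i _; rewrite mxE; ring.
by rewrite mulrA -expr2 sqrtrM ?sqr_ge0// sqrtr_sqr ger0_norm.
Qed.

Lemma sphere_normalize d (x : 'rV[R]_d) : (0 < enorm x)%R -> sphere ((enorm x)^-1 *: x)%R.
Proof. by move=> x0; rewrite /sphere/= enormZ ?invr_ge0 ?enorm_ge0// mulVf// gt_eqF. Qed.

Lemma dotp_row d (v : nat -> R) : dotp (\row_(i < d) v i) (\row_(i < d) v i) = sumsq d v.
Proof. by apply: eq_bigr => i _; rewrite !mxE expr2. Qed.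

Lemma sphere_areaE m : sphere_area R m = (m%:R * fine (ball_vol m 1 : \bar R))%R.
Proof.
have e : leb_int (cone_integrand (fun _ : 'rV[R]_m => 1%R)) = ball_vol m 1.
  rewrite /leb_int /ball_vol; apply: eq_iter_leb_int => v.
  rewrite /cone_integrand /enorm dotp_row sqrtr_gt0 -[X in (_ <= X)%R]sqrtr1.
  by rewrite ler_sqrt.
by rewrite /sphere_area /sphere_int e fineM// ball_vol_fin.
Qed.

(** On the unit sphere the squared Euclidean distance is [2 * T_ q y]. The bound is coordinatewise
    because the balls of the topology on row vectors are sup-norm balls. *)
Lemma sphere_near d (q y : 'rV[R]_d) (t : R) : sphere q -> sphere y ->
  (T_ q y <= t)%R -> forall i, (`|q 0%R i - y 0%R i| <= Num.sqrt (2 * t))%R.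
Proof.
move=> q1 y1 Tt i.
have dq : dotp q q = 1%R by rewrite -enorm_sq q1 expr1n.
have dy : dotp y y = 1%R by rewrite -enorm_sq y1 expr1n.
have h : (\sum_j (q 0%R j - y 0%R j) ^+ 2 <= 2 * t)%R.
  have -> : (\sum_j (q 0%R j - y 0%R j) ^+ 2 = dotp q q + dotp y y - 2 * dotp q y)%R.
    rewrite /dotp mulr_sumr -big_split/= -sumrB; apply: eq_bigr => j _; ring.
  rewrite dq dy; move: Tt; rewrite /T_; lra.
rewrite -sqrtr_sqr ler_sqrt.
  apply: le_trans h; rewrite (bigD1 i)//= lerDl sumr_ge0// => j _; exact: sqr_ge0.
by apply: le_trans h; apply: sumr_ge0 => j _; exact: sqr_ge0.
Qed.

Section law.
Variables (n : nat) (q : 'rV[R]_n.+2) (rho : 'rV[R]_n.+2 -> R).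
Hypothesis q1 : sphere q.
Hypothesis rho0 : forall x, sphere x -> (0 <= rho x)%R.
Hypothesis crho : {for q, continuous (hom_ext rho)}.

Definition cap_law (t : R) : \bar R :=
  sphere_int (fun y => \1_[set y | (T_ q y <= t)%R] y * rho y)%R.

Let qn (i : nat) : R := q 0%R (inord i).

Let dotp_qn (v : nat -> R) : dotp q (\row_(i < n.+2) v i) = (\sum_(i < n.+2) qn i * v i)%R.
Proof. by apply: eq_bigr => i _; rewrite mxE /qn inord_val. Qed.

Let integrandE (t : R) (v : nat -> R) :
  cone_integrand (fun y => \1_[set y | (T_ q y <= t)%R] y * rho y)%R (\row_(i < n.+2) v i) =
  if in_cap t (sumsq n.+2 v) (\sum_(i < n.+2) qn i * v i)%R
  then (rho ((enorm (\row_(i < n.+2) v i))^-1 *: (\row_(i < n.+2) v i))%R)%:E else 0.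
Proof.
rewrite /cone_integrand /in_cap.
set x := (\row_i v i)%R.
have ex : enorm x = Num.sqrt (sumsq n.+2 v) by rewrite /enorm dotp_row.
rewrite -dotp_qn -/x -ex.
have -> : (0 < sumsq n.+2 v)%R = (0 < enorm x)%R by rewrite ex sqrtr_gt0.
have -> : (sumsq n.+2 v <= 1)%R = (enorm x <= 1)%R by rewrite ex -[X in _ = (_ <= X)%R]sqrtr1 ler_sqrt.
case: (ltP 0%R (enorm x)) => //= x0; case: (leP (enorm x) 1%R) => //= x1.
rewrite indicE.
have -> : (((enorm x)^-1 *: x)%R \in [set y | (T_ q y <= t)%R]) = ((1 - t) * enorm x <= dotp q x)%R.
  transitivity (T_ q ((enorm x)^-1 *: x) <= t)%R; first by apply/idP/idP; rewrite inE.
  rewrite /T_ dotpZr lerBlDr -lerBlDl.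
  by rewrite [X in (_ <= X)%R = _]mulrC ler_pdivlMr.
by case: ifP => _; rewrite ?mul1r ?mul0r.
Qed.

(** On a small cap continuity at [q] keeps [rho] within [eps] of [rho q], so the law is a volume up
    to constants; [n.+2] is the dimension factor in the definition of the surface measure. *)
Lemma cap_law_bounds (eps : R) : (0 < eps < rho q)%R ->
  exists2 t0 : R, (0 < t0 < 1)%R & forall t, (0 < t < t0)%R ->
    ((n.+2%:R * (rho q - eps))%:E * cap_vol n.+2 qn t <= cap_law t) /\
    (cap_law t <= (n.+2%:R * (rho q + eps))%:E * cap_vol n.+2 qn t).
Proof.
move=> /andP[e0 eq].
have hq : hom_ext rho q = rho q by rewrite /hom_ext q1 invr1 scale1r.
have := crho; rewrite /continuous_at => /cvgrPdist_lt /(_ eps e0).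
rewrite hq => /nbhs_ballP[d /= d0 Hd].
(* Points of the cap are within [Num.sqrt (2 * t)] of [q] in each coordinate, and this is less than
   [d] when [t < d ^+ 2 / 4]. *)
exists (Num.min (1 / 2) (d ^+ 2 / 4))%R.
  have d4 : (0 < d ^+ 2 / 4)%R by rewrite divr_gt0// exprn_gt0.
  by rewrite lt_min gt_min d4; apply/andP; split; [apply/andP; split|]; lra.
move=> t /andP[tp]; rewrite lt_min => /andP[t2 td].
have close v : in_cap t (sumsq n.+2 v) (\sum_(i < n.+2) qn i * v i)%R ->
   (`|rho q - rho ((enorm (\row_(i < n.+2) v i))^-1 *: (\row_(i < n.+2) v i))%R| < eps)%R.
  set x := (\row_i v i)%R.
  have ex : enorm x = Num.sqrt (sumsq n.+2 v) by rewrite /enorm dotp_row.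
  move=> /and3P[h1 h2 h3].
  have x0 : (0 < enorm x)%R by rewrite ex sqrtr_gt0.
  set y := (_ *: x)%R.
  have y1 : sphere y by exact: sphere_normalize.
  have hy : hom_ext rho y = rho y by rewrite /hom_ext y1 invr1 scale1r.
  rewrite -hy; apply: Hd.
  have Ty : (T_ q y <= t)%R.
    rewrite /T_ dotpZr lerBlDr -lerBlDl.
    by rewrite [X in (_ <= X)%R]mulrC ler_pdivlMr// dotp_qn ex.
  split => // i j; rewrite ord1 /ball /= /ball_.
  apply: (le_lt_trans (sphere_near q1 y1 Ty j)).
  rewrite -[X in (_ < X)%R]ger0_norm ?(ltW d0)// -sqrtr_sqr ltr_sqrt ?exprn_gt0//.
  have : (d ^+ 2 / 4 * 4 = d ^+ 2)%R by field.
  nra.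
have jm : jointly_measurable (fun (_ : unit) v => ereal_of_bool (in_cap t (sumsq n.+2 v) (\sum_(i < n.+2) qn i * v i)%R)).
  have := @jointly_measurable_sq R _ unit n.+2 (fun _ a b => ereal_of_bool (in_cap t a b)) qn.
  apply; exact: (measurableT_comp (meas2_cap t) measurable_snd).
have c0 : (0 <= n.+2%:R :> R)%R by [].
split.
- rewrite /cap_law /sphere_int EFinM -muleA lee_pmul2l ?lte_fin ?ltr0n// -iter_leb_intZ//; last 2 first.
  + by lra.
  + by move=> v; exact: ereal_of_bool_ge0.
  apply: le_iter_leb_int => v; first by rewrite mule_ge0 ?ereal_of_bool_ge0// lee_fin; lra.
  rewrite integrandE /ereal_of_bool; case: ifP => [/close|_]; last by rewrite mule0.
  by rewrite mule1 lee_fin ltr_norml => /andP[]; lra.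
- rewrite /cap_law /sphere_int EFinM -muleA lee_pmul2l ?lte_fin ?ltr0n// -iter_leb_intZ//; last 2 first.
  + by lra.
  + by move=> v; exact: ereal_of_bool_ge0.
  apply: le_iter_leb_int => v.
    rewrite integrandE; case: ifP => // /and3P[h1 _ _]; rewrite lee_fin rho0//.
    by apply: sphere_normalize; rewrite /enorm dotp_row sqrtr_gt0.
  rewrite integrandE /ereal_of_bool; case: ifP => [/close|_]; last by rewrite mule0.
  by rewrite mule1 lee_fin ltr_norml => /andP[]; lra.
Qed.

End law.

End cap_on_sphere.

(** * Behaviour of the cap law at 0 *)

Section cap_limit.
Context {R : realType}.
Variables (n : nat) (q : 'rV[R]_n.+2) (rho : 'rV[R]_n.+2 -> R).
Hypothesis q1 : sphere q.
Hypothesis rho0 : forall x, sphere x -> (0 <= rho x)%R.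
Hypothesis rhoq : (0 < rho q)%R.
Hypothesis crho : {for q, continuous (hom_ext rho)}.

Let V : R := fine (ball_vol n.+1 1 : \bar R).
Let p : R := n.+1%:R / 2.
(** The factor of [kappa ^+ n.+1] left after extracting [t ^ p]; it tends to [2 ^ p] at 0, the
    origin of the power of 2 in the limiting constant. *)
Let w (t : R) : R := ((2 - t) / (1 - t) ^+ 2) `^ p.

Let V0 : 0 <= V. Proof. by rewrite fine_ge0// ball_vol_ge0. Qed.

Let kappaE (t : R) : 0 < t < 1 ->
  Num.sqrt ((2 * t - t ^+ 2) / (1 - t) ^+ 2) ^+ n.+1 = t `^ p * w t.
Proof.
move=> /andP[t0 t1].
have t10 : 0 < 1 - t by lra.
rewrite -[Num.sqrt _]powR12_sqrt; last first.
  by rewrite divr_ge0 ?sqr_ge0//; nra.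
rewrite -(@powR_mulrn _ _ n.+1) ?powR_ge0// -powRrM.
rewrite (_ : (2 * t - t ^+ 2) / (1 - t) ^+ 2 = t * ((2 - t) / (1 - t) ^+ 2)); last first.
  by field; rewrite gt_eqF.
rewrite powRM ?(ltW t0) ?divr_ge0 ?sqr_ge0//; last by lra.
by rewrite /w /p; congr (_ `^ _ * _ `^ _); rewrite mulrC.
Qed.

Lemma cap_law_ratio_bounds (eps : R) : 0 < eps < rho q ->
  exists2 t0 : R, 0 < t0 < 1 & forall t, 0 < t < t0 ->
    exists2 c : R, cap_law q rho t = (c * t `^ p)%:E &
      (rho q - eps) * (V * w t * (1 - t) ^+ n.+2) <= c <= (rho q + eps) * (V * w t).
Proof.
move=> e0; have [t0 /andP[t00 t01] H] := cap_law_bounds q1 rho0 crho e0.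
exists t0; first by rewrite t00.
move=> t /andP[tp tt]; have [|h1 h2] := H t; first by rewrite tp.
have t11 : 0 < t < 1 by rewrite tp (lt_trans tt).
have q1' : \sum_(i < n.+2) (fun i : nat => q 0%R (inord i)) i ^+ 2 = 1.
  transitivity (dotp q q); last by rewrite -enorm_sq q1 expr1n.
  by apply: eq_bigr => i _; rewrite inord_val expr2.
have hu := @cap_vol_le R n (fun i : nat => q 0%R (inord i)) t q1' t11.
have hl := @cap_vol_ge R n (fun i : nat => q 0%R (inord i)) t q1' t11.
have n2 : (0 : R) < n.+2%:R by rewrite ltr0n.
have tp0 : 0 < t `^ p by rewrite powR_gt0.
move: e0 => /andP[e0 e1].
have lo : (((rho q - eps) * (V * w t * (1 - t) ^+ n.+2) * t `^ p)%:E <= cap_law q rho t)%E.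
  apply: le_trans h1.
  rewrite (_ : (_ * _ * t `^ p)%R = n.+2%:R * (rho q - eps) *
    ((Num.sqrt ((2 * t - t ^+ 2) / (1 - t) ^+ 2)) ^+ n.+1 * V * (1 - t) ^+ n.+2 / n.+2%:R)); last first.
    by rewrite kappaE//; field; rewrite gt_eqF.
  by rewrite [X in (X <= _)%E]EFinM lee_pmul2l// lte_fin mulr_gt0 ?subr_gt0.
have up : (cap_law q rho t <= ((rho q + eps) * (V * w t) * t `^ p)%:E)%E.
  apply: (le_trans h2).
  rewrite (_ : (_ * _ * t `^ p)%R = n.+2%:R * (rho q + eps) *
    ((Num.sqrt ((2 * t - t ^+ 2) / (1 - t) ^+ 2)) ^+ n.+1 * V / n.+2%:R)); last first.
    by rewrite kappaE//; field; rewrite gt_eqF.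
  by rewrite [X in (_ <= X)%E]EFinM lee_pmul2l// lte_fin mulr_gt0 ?addr_gt0.
have fin : cap_law q rho t \is a fin_num.
  by rewrite fin_numE -ltNye -ltey (lt_le_trans _ lo) ?ltNyr// (le_lt_trans up) ?ltry.
exists (fine (cap_law q rho t) / t `^ p); first by rewrite divfK ?gt_eqF// fineK.
rewrite ler_pdivlMr// ler_pdivrMr//.
by rewrite -!lee_fin fineK// lo up.
Qed.

Lemma cap_law_cvg :
  fine (cap_law q rho t) / t `^ p @[t --> 0^'+] --> rho q * (V * 2 `^ p).
Proof.
set A := V * 2 `^ p.
have A0 : 0 <= A by rewrite mulr_ge0 ?powR_ge0.
have cw : w t @[t --> (0 : R)^'+] --> 2 `^ p.
  apply: cvg_at_right_filter.
  rewrite (_ : 2 `^ p = w 0); last by rewrite /w !subr0 expr1n divr1.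
  have h : {for (0 : R), continuous (fun t : R => (2 - t) / (1 - t) ^+ 2)}.
    apply: cvgM; first by apply: cvgB; [exact: cvg_cst|exact: cvg_id].
    apply: cvgV; first by rewrite subr0 expr1n oner_neq0.
    apply: (@continuous_comp _ _ _ (fun t : R => 1 - t) (fun x => x ^+ 2)).
      by apply: cvgB; [exact: cvg_cst|exact: cvg_id].
    exact: exprn_continuous.
  have h2 : {for (2 : R), continuous (fun x : R => x `^ p)}.
    apply/differentiable_continuous/derivable1_diffP.
    by apply: derivable_powR; rewrite in_itv/= ltr0n.
  apply: (@continuous_comp _ _ _ (fun t : R => (2 - t) / (1 - t) ^+ 2) (fun x => x `^ p)) => //.
  by rewrite subr0 subr0 expr1n divr1.
have cu : V * w t @[t --> (0 : R)^'+] --> A by apply: cvgM => //; exact: cvg_cst.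
have cl : V * w t * (1 - t) ^+ n.+2 @[t --> (0 : R)^'+] --> A.
  rewrite -[A]mulr1; apply: cvgM => //.
  apply: cvg_at_right_filter.
  rewrite [X in _ --> X](_ : 1 = (1 - (0 : R)) ^+ n.+2); last by rewrite subr0 expr1n.
  apply: (@continuous_comp _ _ _ (fun t : R => 1 - t) (fun x => x ^+ n.+2)).
    by apply: cvgB; [exact: cvg_cst|exact: cvg_id].
  exact: exprn_continuous.
apply/cvgrPdist_lt => e e0.
(* The first bound keeps [eps] below [rho q]; the second makes [eps * A] at most [e / 2], with
   [A + 1] in the denominator so that [A = 0] needs no separate case. The convergence of the two
   bounds costs a further [e / 4]. *)
pose eps := Num.min (rho q / 2) (e / (2 * (A + 1))).
have A1 : 0 < 2 * (A + 1) by lra.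
have eps0 : 0 < eps < rho q.
  rewrite lt_min gt_min divr_gt0// (divr_gt0 e0 A1)/=.
  by move: rhoq => r0; apply/orP; left; lra.
have epsA : eps * A < e / 2 + e / 4.
  have h : eps <= e / (2 * (A + 1)) by rewrite ge_min lexx orbT.
  have h2 : e / (2 * (A + 1)) * (2 * (A + 1)) = e by rewrite divfK// gt_eqF.
  nra.
have [t0 /andP[t00 t01] H] := cap_law_ratio_bounds eps0.
have cu' : (rho q + eps) * (V * w t) @[t --> (0 : R)^'+] --> (rho q + eps) * A.
  by apply: cvgM => //; exact: cvg_cst.
have cl' : (rho q - eps) * (V * w t * (1 - t) ^+ n.+2) @[t --> (0 : R)^'+] --> (rho q - eps) * A.
  by apply: cvgM => //; exact: cvg_cst.
have e4 : 0 < e / 4 by lra.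
move/cvgrPdist_lt : cu' => /(_ _ e4) cu'.
move/cvgrPdist_lt : cl' => /(_ _ e4) cl'.
near=> t.
have tp : 0 < t by near: t; exact: nbhs_right_gt.
have tt : t < t0 by near: t; exact: nbhs_right_lt.
have [|c -> /andP[hl hu]] := H t; first by rewrite tp.
rewrite /= mulfK ?gt_eqF ?powR_gt0//.
have : `|(rho q + eps) * A - (rho q + eps) * (V * w t)| < e / 4 by near: t; exact: cu'.
have : `|(rho q - eps) * A - (rho q - eps) * (V * w t * (1 - t) ^+ n.+2)| < e / 4 by near: t; exact: cl'.
rewrite !ltr_norml => /andP[_ k1] /andP[k2 _].
apply/andP; split; nra.
Unshelve. all: by end_near.
Qed.

End cap_limit.

(** * From a power law at 0 to the scaled intensity *)

Section regular_variation.
Context {R : realType}.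
Variables (F : R -> R) (p L : R) (beta : nat -> R) (gamma : R).
Hypothesis F01 : forall t, 0 <= F t <= 1.
Hypothesis p0 : 0 < p.
Hypothesis FL : F t / t `^ p @[t --> 0^'+] --> L.
Hypothesis beta0 : forall n, (0 < n)%N -> 0 < beta n.
Hypothesis gamma0 : 0 < gamma.
Hypothesis cbeta : beta n * n%:R `^ (- p^-1) @[n --> \oo] --> gamma.

(** Below some [e] the limit gives the constant [|L| + 1]; above [e] the bound [F t <= 1] is at most
    [(t / e) ^ p]. *)
Lemma le_powR_global : exists2 K : R, 0 < K & forall t, 0 < t -> F t <= K * t `^ p.
Proof.
move/cvgrPdist_lt : FL => /(_ 1 ltr01) [e /= e0 He].
have L1 : 0 < `|L| + 1 by rewrite ltr_wpDl.
have e1 : 0 < (e `^ p)^-1 by rewrite invr_gt0 powR_gt0.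
exists (Num.max (`|L| + 1) (e `^ p)^-1); first by rewrite lt_max L1.
move=> t t0; have tp : 0 < t `^ p by rewrite powR_gt0.
have [te|te] := ltP t e.
  have := He t; rewrite /ball/= sub0r normrN gtr0_norm// => /(_ te t0).
  rewrite ltr_norml => /andP[h _].
  have : F t / t `^ p <= `|L| + 1 by have := ler_norm L; lra.
  rewrite ler_pdivrMr// => /le_trans; apply.
  by rewrite ler_pM2r// le_max lexx.
apply: (@le_trans _ _ 1); first by have /andP[] := F01 t.
apply: (@le_trans _ _ ((e `^ p)^-1 * t `^ p)).
  rewrite mulrC ler_pdivlMr ?powR_gt0// mul1r.
  by rewrite ge0_ler_powR ?nnegrE ?(ltW p0) ?(ltW e0) ?(ltW t0).
by rewrite ler_pM2r// le_max lexx orbT.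
Qed.

Let c (n : nat) : R := beta n * n%:R `^ (- p^-1).

Let nFE (n : nat) (y : R) : (0 < n)%N -> 0 < y ->
  n%:R * (y / beta n) `^ p = y `^ p / (c n) `^ p.
Proof.
move=> n0 y0; have b0 := beta0 n0; have n0' : (0 : R) < n%:R by rewrite ltr0n.
have bp : 0 < beta n `^ p by rewrite powR_gt0.
rewrite /c !powRM ?powR_ge0 ?(ltW y0) ?(ltW b0) ?invr_ge0 ?(ltW b0)//.
rewrite -powRrM mulNr mulVf ?gt_eqF// powR_inv1 ?ltW//.
rewrite -powR_inv1 ?ltW// -powRrM mulN1r powRN.
by field; rewrite !gt_eqF.
Qed.

(** Eventually [beta n] exceeds [gamma / 2] times [n ^ p^-1], which is unbounded. *)
Lemma cvg_scale_to0 (y : R) : 0 < y -> y / beta n @[n --> \oo] --> 0.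
Proof.
move=> y0.
have c2 : \forall n \near \oo, gamma / 2 < c n.
  have g2 : 0 < gamma / 2 by rewrite divr_gt0.
  move/cvgrPdist_lt : cbeta => /(_ _ g2); apply: filterS => n.
  by rewrite ltr_norml /c => /andP[_]; lra.
apply/cvgrPdist_lt => e e0.
have y2 : 0 < y / (gamma / 2) by rewrite divr_gt0// divr_gt0.
have e2 : 0 < e / (y / (gamma / 2)) by rewrite divr_gt0.
near=> n.
have n0 : (0 < n)%N by near: n; exact: nbhs_infty_gt.
have n0' : (0 : R) < n%:R by rewrite ltr0n.
have b0 := beta0 n0.
rewrite sub0r normrN gtr0_norm ?divr_gt0//.
have np : 0 < n%:R `^ (- p^-1) :> R by rewrite powR_gt0.
have cn : gamma / 2 < c n by near: n.
have -> : y / beta n = y / c n * n%:R `^ (- p^-1).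
  by rewrite /c; field; rewrite !gt_eqF.
apply: (@lt_trans _ _ (y / (gamma / 2) * n%:R `^ (- p^-1))).
  rewrite ltr_pM2r// ltr_pM2l// ltf_pV2 ?posrE//; last by rewrite divr_gt0.
  by apply: lt_trans cn; rewrite divr_gt0.
rewrite mulrC -ltr_pdivlMr//.
have nb : (e / (y / (gamma / 2))) `^ (- p) < n%:R.
  by near: n; exact: nbhs_infty_gtr.
have -> : e / (y / (gamma / 2)) = ((e / (y / (gamma / 2))) `^ (- p)) `^ (- p^-1).
  by rewrite -powRrM mulrNN mulfV ?gt_eqF// powRr1// ltW.
rewrite [X in X < _]powRN [X in _ < X]powRN ltf_pV2 ?posrE ?powR_gt0//.
by rewrite gt0_ltr_powR ?invr_gt0// ?nnegrE ?powR_ge0 ?ltW.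
Unshelve. all: by end_near.
Qed.

(** With u = y / beta n, the quantity factors as F(u) / u^p, which tends to [L] because u tends to 0
    from the right, times n u^p, which tends to [(y / gamma) ^ p]. *)
Lemma scaled_cvg (y : R) : 0 < y ->
  n%:R * F (y / beta n) @[n --> \oo] --> L * (y / gamma) `^ p.
Proof.
move=> y0.
have h1 : (y / beta n) @[n --> \oo] --> 0^'+.
  move=> A /= [e e0 He]; have := cvg_scale_to0 y0.
  move=> /cvgrPdist_lt/(_ e e0) h.
  suff : \forall n \near \oo, A (y / beta n) by [].
  near=> n; apply: He => /=.
    by near: n.
  by rewrite divr_gt0// beta0//; near: n; exact: nbhs_infty_gt.
have h2 := cvg_comp _ _ h1 FL.
have h3 : y `^ p / (c n) `^ p @[n --> \oo] --> (y / gamma) `^ p.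
  rewrite powRM ?ltW ?invr_gt0// -[gamma^-1]powR_inv1 ?ltW// -powRrM mulN1r powRN.
  apply: cvgM; first exact: cvg_cst.
  apply: cvgV; first by rewrite gt_eqF// powR_gt0.
  have cp : {for gamma, continuous (fun x : R => x `^ p)}.
    apply/differentiable_continuous/derivable1_diffP.
    by apply: derivable_powR; rewrite in_itv/= andbT.
  exact: (cvg_comp _ _ cbeta cp).
apply: cvg_trans (cvgM h2 h3); apply: near_eq_cvg.
near=> n.
have n0 : (0 < n)%N by near: n; exact: nbhs_infty_gt.
rewrite /= -nFE//.
have b0 := beta0 n0.
have : 0 < (y / beta n) `^ p by rewrite powR_gt0// divr_gt0.
by move=> h; field; rewrite gt_eqF.
Unshelve. all: by end_near.
Qed.

(** The global power bound on [F] makes the threshold on [n] independent of [y]: all that is asked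
    of [n] is positivity and [gamma / 2 < c n]. The means of the counts up to every level are thus
    dominated at once. *)
Lemma scaled_bound : exists2 D : R, 0 < D &
  \forall n \near \oo, forall y, 0 < y -> n%:R * F (y / beta n) <= D * y `^ p.
Proof.
have [K K0 HK] := le_powR_global.
exists (K / (gamma / 2) `^ p); first by rewrite divr_gt0// powR_gt0// divr_gt0.
have c2 : \forall n \near \oo, gamma / 2 < c n.
  have g2 : 0 < gamma / 2 by rewrite divr_gt0.
  move/cvgrPdist_lt : cbeta => /(_ _ g2); apply: filterS => n.
  by rewrite ltr_norml /c => /andP[_]; lra.
near=> n => y y0.
have n0 : (0 < n)%N by near: n; exact: nbhs_infty_gt.
have b0 := beta0 n0.
have cn : gamma / 2 < c n by near: n.
have g2 : 0 < gamma / 2 by rewrite divr_gt0.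
apply: (@le_trans _ _ (n%:R * (K * (y / beta n) `^ p))).
  by rewrite ler_wpM2l// HK// divr_gt0.
rewrite mulrCA nFE// mulrAC -mulrA ler_pM2l//.
have c0 : 0 < c n by exact: lt_trans cn.
rewrite ler_pM2l ?powR_gt0// lef_pV2 ?posrE ?powR_gt0//.
by rewrite ltW// gt0_ltr_powR// nnegrE ltW.
Unshelve. all: by end_near.
Qed.

End regular_variation.

(** * Rounding to a geometric grid *)

Section discretization.
Context {R : realType}.

(** The values of e^{-y} at the right endpoints of [J] cells of width 1/r, continued by 0 so that
    summation by parts has no boundary term. *)
Definition grid (r J j : nat) : R := if (j < J)%N then expR (- (j.+1%:R / r%:R)) else 0.
(* The largest grid value at most [b], or 0 if there is none; as a telescoping sum
   it turns, after summation over the points, into cell counts. *)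
Definition phi (r J : nat) (b : R) : R :=
  \sum_(j < J) (grid r J j - grid r J j.+1) * (grid r J j <= b)%R%:R.

Lemma grid_ge0 r J j : 0 <= grid r J j.
Proof. by rewrite /grid; case: ifP => // _; exact: expR_ge0. Qed.

Lemma grid_decr r J j : grid r J j.+1 <= grid r J j.
Proof.
rewrite /grid; case: ifP => h; last by exact: grid_ge0.
by rewrite ltnW// ler_expR lerN2 ler_wpM2r ?invr_ge0// ler_nat.
Qed.

Lemma grid_nincr r J : {homo grid r J : i j / (i <= j)%N >-> j <= i}.
Proof.
by move=> i j ij; have /nonincreasing_seqP := grid_decr r J; apply.
Qed.

(** A layer-cake sum: the increments of [g] from the first index with [g j <= b] on telescope to
    that value. The boundary term at [J] lets the induction shift [g] by one index. *)
Lemma layer_le (g : nat -> R) (J : nat) (b : R) : 0 <= b ->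
  {homo g : i j / (i <= j)%N >-> j <= i} ->
  \sum_(j < J) (g j - g j.+1) * (g j <= b)%R%:R + g J * (g J <= b)%R%:R <= b.
Proof.
elim: J g => [|J IH] g b0 gh.
  by rewrite big_ord0 add0r; case: (boolP (g 0%N <= b)) => h; rewrite ?mulr1 ?mulr0.
have [h|h] := boolP (g 0%N <= b).
  have hj j : (g j <= b) = true by apply: le_trans h; exact: gh.
  under eq_bigr do rewrite hj mulr1.
  rewrite hj mulr1.
  have := telescope_sumr g (leq0n J.+1).
  rewrite big_mkord => /(congr1 -%R); rewrite opprB -sumrN.
  rewrite (eq_bigr (fun i : 'I_J.+1 => g i - g i.+1)) => [->|i _]; last by rewrite opprB.
  by rewrite subrK.
rewrite big_ord_recl (negbTE h).
rewrite mulr0 add0r.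
by apply: (IH (fun j => g j.+1)) => // i j ij; exact: gh.
Qed.

Lemma phi_le r J b : 0 <= b -> phi r J b <= b.
Proof.
move=> b0; apply: le_trans (layer_le J b0 (@grid_nincr r J)).
by rewrite lerDl mulr_ge0 ?grid_ge0.
Qed.

Lemma phi_ge0 r J b : 0 <= phi r J b.
Proof. by apply: sumr_ge0 => j _; rewrite mulr_ge0// subr_ge0 grid_decr. Qed.

Lemma grid_le_phi r J b j : (j < J)%N -> grid r J j <= b -> grid r J j <= phi r J b.
Proof.
move=> jJ gb.
have := @telescope_sumr R j J (grid r J) (ltnW jJ).
have -> : grid r J J = 0 by rewrite /grid ltnn.
rewrite sub0r => /(congr1 -%R); rewrite opprK -sumrN => <-.
rewrite /phi -(big_mkord xpredT (fun j => (grid r J j - grid r J j.+1) * (grid r J j <= b)%R%:R)).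
rewrite (@big_cat_nat _ _ _ j 0 J)//= ?(ltnW jJ)//.
rewrite ler_wpDl//.
  by apply: sumr_ge0 => i _; rewrite mulr_ge0// subr_ge0 grid_decr.
rewrite !big_nat; apply: ler_sum => i /andP[ji _].
by rewrite opprB (le_trans _ gb) ?mulr1// grid_nincr.
Qed.

(** Consecutive grid values have ratio e^{-1/r}, so rounding down loses at most this factor as long
    as [b] lies between the last grid value e^{-M} and 1. *)
Lemma phi_ge (r M : nat) b : (0 < r)%N -> (0 < M)%N -> expR (- M%:R) <= b -> b <= 1 ->
  expR (- r%:R^-1) * b <= phi r (M * r) b.
Proof.
move=> r0 M0 Mb b1.
have rn : (r%:R : R) != 0 by rewrite pnatr_eq0 -lt0n.
have J0 : (0 < M * r)%N by rewrite muln_gt0 M0.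
have ex : exists j, (j < M * r)%N && (grid r (M * r) j <= b).
  exists (M * r).-1; rewrite prednK// leqnn /grid prednK// leqnn.
  by apply: le_trans Mb; rewrite natrM mulfK.
case: (ex_minnP ex) => j /andP[jJ gj] jmin.
apply: le_trans (grid_le_phi jJ gj).
(* If the very first grid value e^{-1/r} is at most [b], then [b <= 1] suffices; otherwise
   minimality bounds [b] by the preceding grid value. *)
case: j jJ gj jmin => [|j] jJ gj jmin.
  by rewrite /grid jJ mul1r ler_piMr// expR_ge0.
have jJ' : (j < M * r)%N by exact: ltnW.
have gb : b <= grid r (M * r) j.
  rewrite leNgt; apply/negP => /ltW h.
  by have := jmin j; rewrite jJ' h ltnn => /(_ isT).
have -> : grid r (M * r) j.+1 = expR (- r%:R^-1) * grid r (M * r) j.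
  rewrite /grid jJ jJ' -expRD; congr expR.
  by rewrite -[j.+2%:R]natr1 mulrDl; ring.
by rewrite ler_pM2l ?expR_gt0.
Qed.

End discretization.

Lemma sum_ltn_minn N k : (\sum_(i < N) (i < k) = minn N k)%N.
Proof.
elim: N => [|N IH]; first by rewrite big_ord0 min0n.
rewrite big_ord_recr/= IH; case: (ltnP N k) => h.
  by rewrite !(minn_idPl _) ?addn1 // ltnW.
by rewrite !(minn_idPr _) ?addn0 // ltnW.
Qed.

(** * Pathwise error of the weights computed from cell counts *)

Section discretized_weights.
Context {R : realType}.
(* [b i] is exp(- y_i) for points y_0 <= y_1 <= ... and [K y] counts the points
   in [0, y]; [bK] expresses both the ordering and the counting. *)
Variables (b : nat -> R) (K : R -> nat) (M r : nat) (eta L : R).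
Hypothesis b01 : forall i, 0 <= b i <= 1.
Hypothesis bK : forall y i, 0 <= y -> (expR (- y) <= b i) = (i < K y)%N.
Hypothesis M0 : (0 < M)%N.
Hypothesis r0 : (0 < r)%N.
Hypothesis tail : forall M', \sum_(M <= m < M') expR (- m%:R) * (K m.+1%:R)%:R <= eta.
Hypothesis L0 : 0 <= L.
Hypothesis KL : (0 < K L)%N.

Let J := (M * r)%N.
Let theta : R := expR (- r%:R^-1).
Let Kj (j : nat) : nat := K (j.+1%:R / r%:R).

(** This is [phi] of the i-th value, with the test [grid r J j <= b i] replaced by the equivalent
    [i < Kj j], so that only counts occur; [Z_tilde] is its sum over all [i]. *)
Definition top_tilde (g : nat -> R) (J : nat) (Kj : nat -> nat) (i : nat) : R :=
  \sum_(j < J) (g j - g j.+1) * (i < Kj j)%N%:R.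
Definition Z_tilde (g : nat -> R) (J : nat) (Kj : nat -> nat) : R :=
  \sum_(j < J) (g j - g j.+1) * (Kj j)%:R.

Let g := grid r J : nat -> R.
Let bt := top_tilde g J Kj.
Let Zt := Z_tilde g J Kj.
Let S (N : nat) : R := \sum_(i < N) b i.
Let Z : R := limn S.

Let theta_gt0 : 0 < theta. Proof. exact: expR_gt0. Qed.
Let theta_le1 : theta <= 1.
Proof. by rewrite /theta -[X in _ <= X]expR0 ler_expR oppr_le0 invr_ge0. Qed.

Let b_ge0 i : 0 <= b i. Proof. by have /andP[] := b01 i. Qed.

Let btE i : bt i = phi r J (b i).
Proof.
apply: eq_bigr => j _; rewrite /g /Kj -bK ?divr_ge0//.
by rewrite {5}/grid ltn_ord.
Qed.

(** A value of at least e^{-M} loses a factor at least [theta] in the rounding. A smaller positive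
    one satisfies e^{-(m+1)} <= b i <= e^{-m} for some [m >= M], so it is bounded by the term of
    index [m] of the tail sum, once [M'] is beyond [m]. *)
Let b_phi i : exists M1, forall M', (M1 <= M')%N ->
  b i - phi r J (b i) <= (1 - theta) * b i + \sum_(M <= m < M') expR (- m%:R) * (i < K m.+1%:R)%N%:R.
Proof.
have pos M' : 0 <= \sum_(M <= m < M') expR (- m%:R) * (i < K m.+1%:R)%N%:R :> R.
  by apply: sumr_ge0 => m _; rewrite mulr_ge0 ?expR_ge0.
have [h|h] := leP (expR (- M%:R)) (b i).
  exists 0%N => M' _; apply: ler_wpDr; first exact: pos.
  have /andP[_ b1] := b01 i.
  by have := phi_ge r0 M0 h b1; rewrite -/J -/theta; lra.
(* The value 0 does occur: a finite sample is continued by zeros after its last point. *)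
have [b0|b0] := leP (b i) 0.
  have e0 : b i = 0 by apply/eqP; rewrite eq_le b0 b_ge0.
  exists 0%N => M' _; apply: ler_wpDr; first exact: pos.
  by rewrite e0 mulr0 sub0r oppr_le0 phi_ge0.
have ex : exists m, expR (- m.+1%:R) <= b i.
  exists (Num.truncn (- ln (b i))); rewrite -[X in _ <= X]lnK ?posrE// ler_expR lerNl.
  by rewrite ltW// truncnS_gt.
case: (ex_minnP ex) => m hm mmin.
have Mm : (M <= m)%N.
  rewrite leqNgt; apply/negP => mM.
  by move: h; rewrite ltNge (le_trans _ hm)// ler_expR lerN2 ler_nat.
have bm : b i <= expR (- m%:R).
  case: m hm mmin Mm => [|m] hm mmin Mm.
    by rewrite oppr0 expR0; have /andP[] := b01 i.
  rewrite leNgt; apply/negP => /ltW hh; have := mmin m hh.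
  by rewrite ltnn.
exists m.+1 => M' mM'.
have : b i <= \sum_(M <= m < M') expR (- m%:R) * (i < K m.+1%:R)%N%:R.
  apply: (le_trans bm).
  rewrite (bigD1_seq m) ?iota_uniq ?mem_index_iota ?Mm//=.
  by rewrite -bK// hm mulr1 lerDl sumr_ge0// => k _; rewrite mulr_ge0 ?expR_ge0.
have := phi_ge0 r J (b i).
have : 0 <= (1 - theta) * b i by rewrite mulr_ge0 ?subr_ge0.
lra.
Qed.

(** Exchanging the sums turns the tests [i < K m.+1%:R] into [minn N (K m.+1%:R)], so the tail
    contributes at most [eta] whatever [N] is. *)
Let sum_b_phi N : \sum_(i < N) (b i - phi r J (b i)) <= (1 - theta) * S N + eta.
Proof.
have [M1 H] : exists M1, forall M', (M1 <= M')%N -> \sum_(i < N) (b i - phi r J (b i)) <=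
    (1 - theta) * S N + \sum_(M <= m < M') expR (- m%:R) * (\sum_(i < N) (i < K m.+1%:R)%N)%:R.
  rewrite /S; elim: N => [|N [M1 IH]].
    exists 0%N => M' _; rewrite !big_ord0 mulr0 add0r sumr_ge0// => m _; rewrite mulr_ge0 ?expR_ge0.
  have [M2 H2] := b_phi N; exists (maxn M1 M2) => M'.
  rewrite geq_max => /andP[h1 h2].
  rewrite big_ord_recr/=; apply: (le_trans (lerD (IH _ h1) (H2 _ h2))).
  rewrite [in X in _ <= X]big_ord_recr/= mulrDr -!addrA lerD2l addrCA lerD2l -big_split/=.
  by rewrite ler_sum// => m _; rewrite big_ord_recr/= natrD mulrDr.
apply: (le_trans (H _ (leqnn M1))); rewrite lerD2l; apply: le_trans (tail M1).
apply: ler_sum => m _; rewrite ler_wpM2l ?expR_ge0// ler_nat.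
by rewrite sum_ltn_minn geq_minr.
Qed.

Let phi_sum N : (forall j, (j < J)%N -> (Kj j <= N)%N) ->
  \sum_(i < N) phi r J (b i) = Zt.
Proof.
move=> KN; under eq_bigr do rewrite -btE.
rewrite /bt /top_tilde exchange_big/=; apply: eq_bigr => j _.
rewrite -mulr_sumr; congr (_ * _).
by rewrite -natr_sum sum_ltn_minn (minn_idPr _)// KN.
Qed.

Let exN : exists N0, forall N, (N0 <= N)%N -> \sum_(i < N) phi r J (b i) = Zt.
Proof.
exists (\max_(j < J) Kj j) => N hN; apply: phi_sum => j jJ.
by apply: leq_trans hN; exact: (leq_bigmax (Ordinal jJ)).
Qed.

Let S_nd : nondecreasing_seq S.
Proof.
by apply/nondecreasing_seqP => n; rewrite /S big_ord_recr/= lerDl.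
Qed.

(** The previous estimate bounds [S N - Zt] by [(1 - theta) * S N + eta]; since [theta > 0] it can
    be solved for [S N]. Summability of [b] is thus a consequence of the tail bound. *)
Let S_bounded : exists B, forall N, S N <= B.
Proof.
have [N0 HN] := exN.
exists ((Zt + eta) / theta) => N.
apply: (@le_trans _ _ (S (maxn N0 N))); first by apply: S_nd; exact: leq_maxr.
have := sum_b_phi (maxn N0 N); rewrite sumrB HN ?leq_maxl// -/(S _).
rewrite ler_pdivlMr//; lra.
Qed.

Let cvgS : cvgn S.
Proof.
apply: nondecreasing_is_cvgn => //; have [B HB] := S_bounded.
by exists B => _ [N _ <-].
Qed.

Let S_le N : S N <= Z. Proof. exact: nondecreasing_cvgn_le. Qed.

Let Z_ge : expR (- L) <= Z.
Proof.
have : expR (- L) <= b 0%N by rewrite bK.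
move/le_trans; apply; apply: le_trans (S_le 1%N).
by rewrite /S big_ord1.
Qed.

Let Z_gt0 : 0 < Z. Proof. exact: lt_le_trans (expR_gt0 _) Z_ge. Qed.

Let Z_Zt : Z - Zt <= (1 - theta) * Z + eta.
Proof.
have [N0 HN] := exN.
suff : Z <= Zt + ((1 - theta) * Z + eta) by lra.
apply: limr_le => //; near=> N.
have NN : (N0 <= N)%N by near: N; exact: nbhs_infty_ge.
have := sum_b_phi N; rewrite sumrB HN// -/(S _).
have : (1 - theta) * S N <= (1 - theta) * Z by rewrite ler_wpM2l ?subr_ge0.
lra.
Unshelve. all: by end_near.
Qed.

Let Zt_ge0 : 0 <= Zt.
Proof. by apply: sumr_ge0 => j _; rewrite mulr_ge0// subr_ge0 grid_decr. Qed.

Let diff_le i : b i - bt i <= Z - Zt.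
Proof.
have [N0 HN] := exN; pose N := maxn N0 i.+1.
apply: (@le_trans _ _ (S N - Zt)); last by rewrite lerD2r.
rewrite -(HN N) ?leq_maxl// /S -sumrB btE.
have iN : (i < N)%N by rewrite leq_maxr.
rewrite (bigD1 (Ordinal iN))//= lerDl sumr_ge0// => k _.
by rewrite subr_ge0 phi_le.
Qed.

Let bt_ge0 i : 0 <= bt i. Proof. by rewrite btE phi_ge0. Qed.
Let bt_le i : bt i <= b i. Proof. by rewrite btE phi_le. Qed.

Let bt_Zt i : bt i <= Zt.
Proof.
have [N0 HN] := exN; pose N := maxn N0 i.+1.
rewrite -(HN N) ?leq_maxl// btE.
have iN : (i < N)%N by rewrite leq_maxr.
rewrite (bigD1 (Ordinal iN))//= lerDl sumr_ge0// => k _.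
exact: phi_ge0.
Qed.

Let b_Z i : b i <= Z.
Proof.
apply: le_trans (S_le i.+1); rewrite /S big_ord_recr/= lerDr.
by apply: sumr_ge0.
Qed.

Lemma weight_ge0_le1 i : 0 <= b i / Z <= 1.
Proof. by rewrite divr_ge0 ?(ltW Z_gt0)//= ler_pdivrMr// mul1r. Qed.

Lemma weight_tilde_ge0_le1 i : 0 <= bt i / Zt <= 1.
Proof.
(* When no point falls in a cell, [Zt] is 0 and the quotient is 0 by the convention on inverses. *)
rewrite divr_ge0//=; have [->|Zt0] := eqVneq Zt 0; first by rewrite invr0 mulr0.
by rewrite ler_pdivrMr ?mul1r// lt_neqAle eq_sym Zt0.
Qed.

(** All rounding errors are nonnegative and sum to [Z - Zt], which therefore controls numerator and
    denominator alike. Relative to [Z] it is at most [1 - theta] plus [eta / Z], and the point in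
    [0, L] gives [Z >= expR (- L)]. *)
Lemma weight_approx i : `|b i / Z - bt i / Zt| <= (1 - theta) + eta * expR L.
Proof.
have eta0 : 0 <= eta by have := tail 0%N; rewrite big_geq.
have D : (Z - Zt) / Z <= (1 - theta) + eta * expR L.
  rewrite ler_pdivrMr//; apply: (le_trans Z_Zt).
  rewrite [X in _ <= X]mulrDl lerD2l -mulrA ler_peMr//.
  by rewrite -ler_pdivrMl ?expR_gt0// mulr1 -expRN.
apply: le_trans D.
have [Zt0|Zt0] := eqVneq Zt 0.
  have bt0 : bt i = 0 by apply/eqP; rewrite eq_le bt_ge0 -Zt0 bt_Zt.
  rewrite bt0 mul0r subr0 ger0_norm ?divr_ge0 ?(ltW Z_gt0)//.
  by rewrite ler_pM2r ?invr_gt0//; have := diff_le i; rewrite bt0 subr0.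
have Ztp : 0 < Zt by rewrite lt_neqAle eq_sym Zt0.
(* The numerator is a difference of two numbers that both lie between 0 and [Z - Zt], so the errors
   do not add up. *)
have -> : b i / Z - bt i / Zt = ((b i - bt i) - (bt i / Zt) * (Z - Zt)) / Z.
  by field; rewrite Zt0 gt_eqF.
have /andP[f0 f1] := weight_tilde_ge0_le1 i.
have ZZt : 0 <= Z - Zt.
  by apply: le_trans (diff_le i); rewrite subr_ge0.
rewrite normrM [`|Z^-1|]gtr0_norm ?invr_gt0// ler_pM2r ?invr_gt0//.
have d1 := diff_le i; have d2 := bt_le i.
rewrite ler_norml; apply/andP; split; nra.
Qed.

End discretized_weights.

(** * Integrals of functions close to step functions *)

Section integral_approximation.
Local Open Scope ereal_scope.
Context d (Om : measurableType d) (R : realType) (P : probability Om R).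

Lemma integral_sandwich (F G H : Om -> R) :
  (forall w, 0 <= F w)%R -> (forall w, 0 <= G w)%R -> (forall w, 0 <= H w)%R ->
  measurable_fun setT G -> measurable_fun setT H ->
  (forall w, `|F w - G w| <= H w)%R ->
  \int[P]_w (F w)%:E <= \int[P]_w (G w)%:E + \int[P]_w (H w)%:E /\
  \int[P]_w (G w)%:E <= \int[P]_w (F w)%:E + \int[P]_w (H w)%:E.
Proof.
move=> F0 G0 H0 mG mH FGH.
have mGE : measurable_fun setT (fun w => (G w)%:E) by exact/measurable_EFinP.
have mHE : measurable_fun setT (fun w => (H w)%:E) by exact/measurable_EFinP.
split.
  rewrite -ge0_integralD//; last 2 first.
  - by move=> w _; rewrite lee_fin.
  - by move=> w _; rewrite lee_fin.
  apply: ge0_le_integral_nonmeas => w; rewrite ?lee_fin//.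
  by have := FGH w; rewrite ler_norml => /andP[_]; lra.
(* Additivity is applied to measurable functions only, so [F] is replaced by a measurable
   minorant. *)
pose K w := Num.max (G w - H w)%R 0%R.
have K0 w : (0 <= K w)%R by rewrite le_max lexx orbT.
have mK : measurable_fun setT K.
  by apply: measurable_maxr => //; exact: measurable_funB.
apply: (@le_trans _ _ (\int[P]_w (K w)%:E + \int[P]_w (H w)%:E)).
  rewrite -ge0_integralD//; last 3 first.
  - by move=> w _; rewrite lee_fin.
  - exact/measurable_EFinP.
  - by move=> w _; rewrite lee_fin.
  apply: ge0_le_integral_nonmeas => w; rewrite ?lee_fin//.
  rewrite /K.
  by rewrite -lerBlDr le_max lexx.
rewrite leeD2r//; apply: ge0_le_integral_nonmeas => w; rewrite ?lee_fin//.
by rewrite /K ge_max F0 andbT; have := FGH w; rewrite ler_norml => /andP[]; lra.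
Qed.

(** The integral of any [F] is the difference of those of its positive and negative parts. Each part
    is within the integral of [H] of the corresponding part of [G], whence the factor 2 and the
    finiteness. *)
Lemma integral_approx (F G H : Om -> R) :
  P.-integrable setT (EFin \o G) -> P.-integrable setT (EFin \o H) ->
  (forall w, `|F w - G w| <= H w)%R ->
  exists2 v : R, \int[P]_w (F w)%:E = v%:E &
    (`|v - fine (\int[P]_w (G w)%:E)| <= 2 * fine (\int[P]_w (H w)%:E))%R.
Proof.
move=> iG iH FGH.
have mG : measurable_fun setT G by apply/measurable_EFinP; case/integrableP: iG.
have mH : measurable_fun setT H by apply/measurable_EFinP; case/integrableP: iH.
have H0 w : (0 <= H w)%R by exact: le_trans (FGH w).
pose Fp w := Num.max (F w) 0%R. pose Fn w := Num.max (- F w)%R 0%R.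
pose Gp w := Num.max (G w) 0%R. pose Gn w := Num.max (- G w)%R 0%R.
have max0 (x : R) : (0 <= Num.max x 0)%R by rewrite le_max lexx orbT.
have maxd (x y h : R) : (`|x - y| <= h)%R -> (`|Num.max x 0 - Num.max y 0| <= h)%R.
  rewrite !ler_norml => /andP[h1 h2].
  by rewrite /Num.max; case: ltP => ?; case: ltP => ?; apply/andP; split; lra.
have mGp : measurable_fun setT Gp by exact: measurable_maxr.
have mGn : measurable_fun setT Gn by apply: measurable_maxr => //; exact: measurable_funN.
have [p1 p2] := @integral_sandwich Fp Gp H (fun=> max0 _) (fun=> max0 _) H0 mGp mH
  (fun w => maxd _ _ _ (FGH w)).
have FGH' w : (`|- F w - - G w| <= H w)%R by rewrite -opprD normrN.
have [n1 n2] := @integral_sandwich Fn Gn H (fun=> max0 _) (fun=> max0 _) H0 mGn mH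
  (fun w => maxd _ _ _ (FGH' w)).
have FE : \int[P]_w (F w)%:E = \int[P]_w (Fp w)%:E - \int[P]_w (Fn w)%:E.
  rewrite integralE; congr (_ - _); apply: eq_integral => w _.
    by rewrite funeposE EFin_max.
  by rewrite funenegE EFin_max.
have GE : \int[P]_w (G w)%:E = \int[P]_w (Gp w)%:E - \int[P]_w (Gn w)%:E.
  rewrite integralE; congr (_ - _); apply: eq_integral => w _.
    by rewrite funeposE EFin_max.
  by rewrite funenegE EFin_max.
have fH : \int[P]_w (H w)%:E \is a fin_num by exact: integrable_fin_num iH.
have fGp : \int[P]_w (Gp w)%:E \is a fin_num.
  have := integrable_fin_num measurableT (integrable_funepos measurableT iG).
  by under eq_integral do rewrite funeposE -EFin_max.
have fGn : \int[P]_w (Gn w)%:E \is a fin_num.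
  have := integrable_fin_num measurableT (integrable_funeneg measurableT iG).
  by under eq_integral do rewrite funenegE -EFin_max.
have fin (x y z : \bar R) : 0 <= x -> y \is a fin_num -> z \is a fin_num ->
   x <= y + z -> x \is a fin_num.
  move=> x0 fy fz; rewrite ge0_fin_numE// => /le_lt_trans; apply.
  by rewrite -(fineK fy) -(fineK fz) -EFinD ltry.
have fFp : \int[P]_w (Fp w)%:E \is a fin_num.
  by apply: fin p1 => //; apply: integral_ge0 => w _; rewrite lee_fin; exact: max0.
have fFn : \int[P]_w (Fn w)%:E \is a fin_num.
  by apply: fin n1 => //; apply: integral_ge0 => w _; rewrite lee_fin; exact: max0.
move: p1 p2 n1 n2; rewrite FE GE -(fineK fFp) -(fineK fFn) -(fineK fGp) -(fineK fGn) -(fineK fH).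
rewrite -!EFinD !lee_fin /= => p1 p2 n1 n2; eexists; first reflexivity.
by rewrite ler_norml; apply/andP; split; lra.
Qed.

(** The comparison function is the step function with value [psi t] on [E t]; the error function is
    [eps + 2 * B] times the indicator of [bad], and doubling its integral gives the stated bound. *)
Lemma integral_step_approx (T : eqType) (s : seq T) (E : T -> set Om) (psi : T -> R)
    (bad : set Om) (F : Om -> R) (B eps : R) :
  uniq s -> (forall t, measurable (E t)) ->
  (forall t u w, E t w -> E u w -> t = u) ->
  measurable bad -> (0 <= eps)%R -> (0 <= B)%R ->
  (forall w, `|F w| <= B)%R -> (forall t, `|psi t| <= B)%R ->
  (forall w, ~ bad w -> exists t, [/\ t \in s, E t w & `|F w - psi t| <= eps])%R ->
  exists2 v : R, \int[P]_w (F w)%:E = v%:E &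
    (`|v - \sum_(t <- s) psi t * fine (P (E t))| <= 2 * eps + 4 * B * fine (P bad))%R.
Proof.
move=> us mE dE mbad e0 B0 FB pB Fbad.
pose G w := (\sum_(t <- s) psi t * \1_(E t) w)%R.
pose H w := (eps + 2 * B * \1_bad w)%R.
have GE t w : t \in s -> E t w -> G w = psi t.
  move=> ts Etw; rewrite /G (bigD1_seq t)//= indicE mem_set// mulr1 big_seq_cond big1 ?addr0//.
  move=> u /andP[us' ut]; rewrite indicE memNset ?mulr0// => Euw.
  by move/eqP : ut; apply; exact: dE Euw Etw.
have GB w : (`|G w| <= B)%R.
  have [[t [ts Et]]|h] := pselect (exists t, t \in s /\ E t w).
    by rewrite (GE t).
  rewrite /G big_seq_cond big1 ?normr0// => t /andP[ts _].
  by rewrite indicE memNset ?mulr0// => Et; apply: h; exists t.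
have iE t : P.-integrable setT (fun w => (psi t)%:E * (\1_(E t) w)%:E).
  by apply: integrableZl => //; exact: integrable_indic.
have iG : P.-integrable setT (EFin \o G).
  have : P.-integrable setT (fun w => \sum_(t <- s) (psi t)%:E * (\1_(E t) w)%:E).
    by apply: integrable_sum.
  apply: eq_integrable => // w _; rewrite /G /= -sumEFin.
  by apply: eq_bigr => t _; rewrite EFinM.
have iH : P.-integrable setT (EFin \o H).
  rewrite (_ : EFin \o H = (fun w => (cst eps%:E w) + (2 * B)%:E * (\1_bad w)%:E)); last first.
    by apply/funext => w; rewrite /H /= EFinD EFinM.
  apply: integrableD => //; first exact: finite_measure_integrable_cst.
  by apply: integrableZl => //; exact: integrable_indic.
have FGH w : (`|F w - G w| <= H w)%R.
  rewrite /H indicE; have [bw|nbw] := pselect (bad w).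
    rewrite mem_set// mulr1; have := ler_normB (F w) (G w).
    have := FB w; have := GB w; lra.
  have [t [ts Et h]] := Fbad w nbw.
  by rewrite memNset// mulr0 addr0 (GE t).
have [v Fv hv] := integral_approx iG iH FGH.
exists v => //.
have -> : (\sum_(t <- s) psi t * fine (P (E t)) = fine (\int[P]_w (G w)%:E))%R.
  have -> : \int[P]_w (G w)%:E = \sum_(t <- s) (psi t)%:E * P (E t).
    rewrite (eq_integral (fun w => \sum_(t <- s) (psi t)%:E * (\1_(E t) w)%:E)); last first.
      move=> w _; rewrite /G -sumEFin.
      by apply: eq_bigr => t _; rewrite EFinM.
    rewrite integral_sum//; apply: eq_bigr => t _.
    rewrite integralZl//; last exact: integrable_indic.
    by rewrite integral_indic ?setIT.
  transitivity (fine (\sum_(t <- s) (psi t * fine (P (E t)))%:E)); last first.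
    by congr fine; apply: eq_bigr => t _; rewrite EFinM fineK// fin_num_measure.
  by rewrite sumEFin.
have hH : fine (\int[P]_w (H w)%:E) = (eps + 2 * B * fine (P bad))%R.
  rewrite (eq_integral (fun w => cst eps%:E w + (2 * B)%:E * (\1_bad w)%:E)); last first.
    by move=> w _; rewrite /H /= EFinD EFinM.
  rewrite integralD//; last 2 first.
  - exact: finite_measure_integrable_cst.
  - by apply: integrableZl => //; exact: integrable_indic.
  rewrite integral_cst// integralZl//; last exact: integrable_indic.
  have -> : \int[P]_w (\1_bad w)%:E = P bad by rewrite integral_indic// setIT.
  have -> : eps%:E * P setT = eps%:E by rewrite probability_setT mule1.
  by rewrite fineD// ?fineM// ?fin_num_measure// fin_numM// fin_num_measure.
by apply: (le_trans hv); rewrite hH; lra.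
Qed.

End integral_approximation.

(** * The multinomial law and its recursion *)

Section multinomial.
Context {R : realType}.
Variable J : nat.
Implicit Types (m : {ffun 'I_J -> nat}) (pr : nat -> R).

Definition total m : nat := (\sum_j m j)%N.

(** [n] trials over cells 0 to J, where the count of cell J is the remainder. The falling factorial
    divided by the factorials is the multinomial coefficient; it vanishes when [total m > n], so the
    truncated subtraction does no harm. *)
Definition multinom_pmf pr (n : nat) m : R :=
  (n ^_ (total m))%:R * (\prod_(j < J) (pr j ^+ m j / (m j)`!%:R)) * pr J ^+ (n - total m).

Definition ffun_dec m (j : 'I_J) : {ffun 'I_J -> nat} := [ffun i => (m i - (i == j))%N].

Lemma total_dec m j : (0 < m j)%N -> total m = (total (ffun_dec m j)).+1.
Proof.
move=> mj; rewrite /total (bigD1 j)//= [in RHS](bigD1 j)//= ffunE eqxx.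
rewrite (eq_bigr (fun i => ffun_dec m j i)); first by rewrite -addSn subn1 prednK.
by move=> i ij; rewrite ffunE (negbTE ij) subn0.
Qed.

Lemma prod_dec pr m j : (0 < m j)%N ->
  (\prod_(i < J) (pr i ^+ ffun_dec m j i / (ffun_dec m j i)`!%:R)) * pr j =
  (m j)%:R * \prod_(i < J) (pr i ^+ m i / (m i)`!%:R).
Proof.
move=> mj; rewrite (bigD1 j)//= [in RHS](bigD1 j)//= ffunE eqxx subn1.
rewrite (eq_bigr (fun i : 'I_J => pr i ^+ m i / (m i)`!%:R)); last first.
  by move=> i ij; rewrite ffunE (negbTE ij) subn0.
case: (m j) mj => // k _ /=; rewrite exprS factS natrM.
have h1 : (k`!%:R : R) != 0 by rewrite pnatr_eq0 -lt0n fact_gt0.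
have h2 : (k.+1%:R : R) != 0 by rewrite pnatr_eq0.
by move: (k.+1%:R : R) (k`!%:R : R) h2 h1 => u v h2 h1; field; rewrite h1 h2.
Qed.

(** Pascal's rule multiplied by (s+1)!. *)
Lemma ffact_pascal (n s : nat) : (n.+1 ^_ s.+1 = n ^_ s.+1 + s.+1 * n ^_ s)%N.
Proof.
rewrite ffactSS ffactnSr mulnC [(s.+1 * _)%N]mulnC -mulnDr.
have [sn|ns] := leqP s n; last by rewrite ffact_small.
by congr (_ * _)%N; rewrite addnS subnK.
Qed.

(** The last trial falls either in the remainder cell J or in a cell [j] with positive count. By
    [prod_dec] each term of the second kind is [m j] times a common product, and the [m j] add up to
    [total m], as in Pascal's rule. *)
Lemma multinom_pmf_rec pr n m :
  multinom_pmf pr n.+1 m = multinom_pmf pr n m * pr J +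
    \sum_(j < J | (0 < m j)%N) multinom_pmf pr n (ffun_dec m j) * pr j.
Proof.
set Q := \prod_(i < J) (pr i ^+ m i / (m i)`!%:R).
have [s0|s0] := posnP (total m).
  rewrite big1 ?addr0.
    by rewrite /multinom_pmf s0 !ffactn0 !subn0 exprSr mulrA.
  move=> j mj; have := total_dec mj; rewrite s0; done.
have -> : \sum_(j < J | (0 < m j)%N) multinom_pmf pr n (ffun_dec m j) * pr j =
   (n ^_ (total m).-1)%:R * Q * (total m)%:R * pr J ^+ (n - (total m).-1).
  rewrite -[in RHS]mulrA [X in _ = _ * X]mulrC [in RHS]mulrA.
  have -> : (total m)%:R = \sum_j (m j)%:R :> R by rewrite /total natr_sum.
  rewrite mulr_sumr big_mkcond/=.
  apply: eq_bigr => j _; case: posnP => [->|mj]; first by rewrite mulr0.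
  rewrite /multinom_pmf (total_dec mj)/= -!mulrA [pr J ^+ _ * _]mulrC !mulrA.
  by rewrite -[X in X * pr J ^+ _ = _]mulrA prod_dec// -/Q; ring.
rewrite /multinom_pmf -/Q.
case: (total m) s0 => // s _ /=.
rewrite ffact_pascal natrD natrM subSS.
have [sn|ns] := ltnP s n.
  by rewrite -(subnSK sn) exprSr; ring.
rewrite (@ffact_small n s.+1) ?ltnS//; ring.
Qed.

End multinomial.

(** * Cell counts of independent trials are multinomial *)

Section counts.
Local Open Scope ereal_scope.
Context d (Om : measurableType d) (R : realType) (P : probability Om R).
Variables (J : nat) (c : nat -> Om -> nat) (pr : nat -> R).
Hypothesis cJ : forall i w, (c i w <= J)%N.
Hypothesis mc : forall i k, measurable [set w | c i w = k].

Definition cylinder (Jl : seq nat) (a : nat -> nat) : set Om :=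
  \bigcap_(i in [set i | i \in Jl]) [set w | c i w = a i].

Hypothesis indep : forall Jl a, uniq Jl ->
  P (cylinder Jl a) = (\prod_(i <- Jl) pr (a i))%:E.

Definition count_event (n : nat) (m : {ffun 'I_J -> nat}) : set Om :=
  [set w | forall j : 'I_J, (\sum_(i < n) (c i w == j) = m j)%N].

Lemma measurable_cylinder Jl a : measurable (cylinder Jl a).
Proof. by apply: bigcap_measurableType => // i _; exact: mc. Qed.

Lemma measurable_cell_count n k l :
  measurable [set w | (\sum_(i < n) (c i w == k) = l)%N].
Proof.
elim: n l => [|n IH] l.
  have [->|l0] := eqVneq l 0%N.
    rewrite (_ : [set _ | _] = setT)//; apply/seteqP; split => // w _ /=.
    by rewrite big_ord0.
  rewrite (_ : [set _ | _] = set0)//; apply/seteqP; split => // w /=.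
  by rewrite big_ord0 => /esym/eqP; rewrite (negbTE l0).
rewrite (_ : [set _ | _] =
  (([set w | (\sum_(i < n) (c i w == k) = l)%N] `&` ~` [set w | c n w = k]) `|`
   ([set w | ((\sum_(i < n) (c i w == k)).+1 = l)%N] `&` [set w | c n w = k]))).
  apply: measurableU; apply: measurableI => //.
    exact: measurableC.
  case: l => [|l]; last first.
    rewrite (_ : [set _ | _] = [set w | (\sum_(i < n) (c i w == k) = l)%N])//.
    by apply/seteqP; split => w /= => [[]|->].
  by rewrite (_ : [set _ | _] = set0)//; apply/seteqP; split.
apply/seteqP; split => w /=; rewrite big_ord_recr/=.
  case: (eqVneq (c n w) k) => h; first by rewrite addn1; right.
  by rewrite addn0; left; split => //; exact/eqP.
move=> [[h1 /eqP/negbTE ->]|[h1 ->]]; first by rewrite addn0.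
by rewrite eqxx addn1.
Qed.

Lemma measurable_count_event n m : measurable (count_event n m).
Proof.
rewrite (_ : count_event n m = \bigcap_(j in [set: 'I_J]) [set w | (\sum_(i < n) (c i w == j) = m j)%N]).
  by apply: fin_bigcap_measurable => // j _; exact: measurable_cell_count.
by apply/seteqP; split => w h j; [move=> _|]; exact: h.
Qed.

Lemma partition_cell (A : set Om) n : measurable A ->
  P A = \sum_(k < J.+1) P (A `&` [set w | c n w = k]).
Proof.
move=> mA; rewrite -measure_semi_additive_ord//.
- congr (P _); rewrite -(bigcup_mkord J.+1 (fun k => A `&` [set w | c n w = k])).
  apply/seteqP; split => w /=; last by move=> [k _ []].
  by move=> Aw; exists (c n w) => //=; rewrite ltnS.
- by move=> k; exact: measurableI.
- by move=> k l _ _ [w [[_ /= h1] [_ /= h2]]]; apply/val_inj; rewrite /= -h1 -h2.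
- by apply: bigsetU_measurable => k _; exact: measurableI.
Qed.

(** Induction on the number of counted trials, splitting by the cell of the last one. That trial
    then passes into the cylinder; this is why the statement carries a cylinder over trials not yet
    counted. *)
Lemma count_event_indep n m Jl a : uniq Jl -> {in Jl, forall i, (n <= i)%N} ->
  P (count_event n m `&` cylinder Jl a) =
  (multinom_pmf pr n m * \prod_(i <- Jl) pr (a i))%:E.
Proof.
elim: n m Jl a => [|n IH] m Jl a uJ nJ.
  have [m0|m0] := pselect (forall j, m j = 0%N).
    have -> : multinom_pmf pr 0 m = 1%R.
      rewrite /multinom_pmf /total big1// subn0 ffactn0 expr0 mulr1 mul1r.
      by rewrite big1// => j _; rewrite m0 expr0 fact0 divr1.
    rewrite mul1r -indep//; congr (P _); apply/seteqP; split => w /=; first by case.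
    by move=> h; split => // j; rewrite big_ord0 m0.
  have tm : (0 < total m)%N.
    rewrite lt0n; apply/eqP => t0; apply: m0 => j.
    by move/eqP : t0; rewrite /total sum_nat_eq0 => /forallP/(_ j)/eqP.
  rewrite /multinom_pmf ffact_small// !mul0r; transitivity (P set0); last by rewrite measure0.
  congr (P _).
  apply/seteqP; split => w //= -[h _]; apply: m0 => j.
  by rewrite -(h j) big_ord0.
pose upd k i := if i == n then k else a i.
have nJl : n \notin Jl by apply/negP => /nJ; rewrite ltnn.
have uJ' : uniq (n :: Jl) by rewrite /= nJl.
have nJ' : {in n :: Jl, forall i, (n <= i)%N}.
  by move=> i; rewrite inE => /orP[/eqP ->//|/nJ /ltnW].
have cylE k : cylinder (n :: Jl) (upd k) = cylinder Jl a `&` [set w | c n w = k].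
  apply/seteqP; split => w.
    move=> h; split.
      move=> i /= iJ; have := h i; rewrite /= inE iJ orbT /upd.
      by rewrite (negbTE (_ : i != n)) => [/(_ isT)//|]; apply: contraNneq nJl => <-.
    by have := h n; rewrite /= inE eqxx /upd eqxx => /(_ isT).
  move=> [h1 h2] i /=; rewrite inE /upd => /orP[/eqP ->|iJ]; first by rewrite eqxx.
  rewrite (negbTE (_ : i != n)); first exact: h1.
  by apply: contraNneq nJl => <-.
have prodE k : (\prod_(i <- n :: Jl) pr (upd k i) = pr k * \prod_(i <- Jl) pr (a i))%R.
  rewrite big_cons /upd eqxx; congr (_ * _)%R.
  apply: eq_big_seq => i iJ; rewrite (negbTE (_ : i != n))//.
  by apply: contraNneq nJl => <-.
rewrite (partition_cell n); last first.
  by apply: measurableI; [exact: measurable_count_event|exact: measurable_cylinder].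
rewrite big_ord_recr/=.
(* A trial in cell J changes none of the counts, because [m] is indexed by the cells below J. *)
have -> : count_event n.+1 m `&` cylinder Jl a `&` [set w | c n w = J] =
    count_event n m `&` cylinder (n :: Jl) (upd J).
  rewrite cylE setIA; apply/seteqP; split => w [[h1 h2] h3]; do 2 split => //.
    by move=> j; rewrite -(h1 j) big_ord_recr/= h3 gtn_eqF ?addn0.
  by move=> j; rewrite big_ord_recr/= h3 gtn_eqF ?addn0// h1.
rewrite IH// prodE.
have step (j : 'I_J) : P (count_event n.+1 m `&` cylinder Jl a `&` [set w | c n w = j]) =
   (if (0 < m j)%N then multinom_pmf pr n (ffun_dec m j) * (pr j * \prod_(i <- Jl) pr (a i)) else 0)%R%:E.
  case: posnP => mj.
    transitivity (P set0); last by rewrite measure0.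
    congr (P _); apply/seteqP; split => w //= -[[h _] hc].
    by have := h j; rewrite big_ord_recr/= hc eqxx addn1 mj.
  have -> : count_event n.+1 m `&` cylinder Jl a `&` [set w | c n w = j] =
     count_event n (ffun_dec m j) `&` cylinder (n :: Jl) (upd j).
    rewrite cylE setIA; apply/seteqP; split => w [[h1 h2] h3]; do 2 split => //.
      move=> i; rewrite ffunE -(h1 i) big_ord_recr/= h3.
      by rewrite [(i == j)]eq_sym addnK.
    move=> i; rewrite big_ord_recr/= h3 h1 ffunE.
    have -> : (nat_of_ord j == i) = (i == j) by rewrite eq_sym.
    case: (eqVneq i j) => [->|ij].
      by rewrite subn1 addn1 prednK.
    by rewrite subn0 addn0.
  by rewrite IH// prodE.
under eq_bigr do rewrite step.
rewrite sumEFin -EFinD multinom_pmf_rec; congr (_%:E).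
rewrite addrC mulrDl -mulrA; congr (_ + _)%R; rewrite mulr_suml [RHS]big_mkcond/=.
by apply: eq_bigr => j _; case: ifP => // _; rewrite mulrA.
Qed.

Lemma count_event_prob n m : P (count_event n m) = (multinom_pmf pr n m)%:E.
Proof.
have := @count_event_indep n m [::] (fun=> 0%N) isT (fun i (h : i \in [::]) => ltac:(by rewrite in_nil in h)).
rewrite big_nil mulr1 => <-; congr (P _); apply/seteqP; split => w; last by case.
by move=> h; split.
Qed.

End counts.

(** * Poisson limit of the multinomial law *)

Section poisson_limit.
Context {R : realType}.

Lemma cvg_ffact_ratio (s : nat) : (n ^_ s)%:R / n%:R ^+ s @[n --> \oo] --> (1 : R).
Proof.
elim: s => [|s IH].
  by under eq_fun do rewrite ffactn0 expr0 divr1; exact: cvg_cst.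
have h : (1 - s%:R * n%:R^-1 : R) @[n --> \oo] --> (1 - s%:R * 0 : R).
  apply: cvgB; first exact: cvg_cst.
  apply: cvgM; first exact: cvg_cst.
  apply/cvgrPdist_lt => e e0; near=> n.
  have n0 : (0 : R) < n%:R by rewrite ltr0n; near: n; exact: nbhs_infty_gt.
  rewrite sub0r normrN gtr0_norm ?invr_gt0// invf_plt ?posrE//.
  by near: n; exact: nbhs_infty_gtr.
rewrite mulr0 subr0 in h.
rewrite -[X in _ --> X]mulr1; apply: cvg_trans (cvgM IH h).
apply: near_eq_cvg.
near=> n.
have n0 : (0 < n)%N by near: n; exact: nbhs_infty_gt.
have sn : (s <= n)%N by near: n; exact: nbhs_infty_ge.
rewrite /= ffactnSr natrM natrB// exprS.
have nn : (n%:R : R) != 0 by rewrite pnatr_eq0 -lt0n.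
by field; rewrite nn expf_neq0.
Unshelve. all: by end_near.
Qed.

(** Squeeze: [1 - q] lies between exp(-q/(1-q)) and exp(-q), both by 1 + x <= exp x, and [n * q n]
    tends to [lam]. *)
Lemma cvg_pow_exp (q : nat -> R) (lam : R) : (\forall n \near \oo, 0 <= q n) ->
  n%:R * q n @[n --> \oo] --> lam -> q n @[n --> \oo] --> 0 /\
  (1 - q n) ^+ n @[n --> \oo] --> expR (- lam).
Proof.
move=> q0 hq.
have invn : (n%:R^-1 : R) @[n --> \oo] --> (0 : R).
  apply/cvgrPdist_lt => e e0; near=> n.
  have n0 : (0 : R) < n%:R by rewrite ltr0n; near: n; exact: nbhs_infty_gt.
  rewrite sub0r normrN gtr0_norm ?invr_gt0// invf_plt ?posrE//.
  by near: n; exact: nbhs_infty_gtr.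
have cq : q n @[n --> \oo] --> 0.
  rewrite -(mul0r lam); apply: cvg_trans (cvgM invn hq).
  apply: near_eq_cvg.
  near=> n.
  have n0 : (n%:R : R) != 0.
    by rewrite pnatr_eq0 -lt0n; near: n; exact: nbhs_infty_gt.
  by rewrite /= mulKf.
split => //.
have cexp : {for (- lam), continuous (@expR R)} by exact: continuous_expR.
apply: (@squeeze_cvgr _ _ _ _ (fun n => expR (- (n%:R * q n) / (1 - q n)))
                              (fun n => expR (- (n%:R * q n)))).
- near=> n.
  have q1 : q n < 1.
    near: n; move/cvgrPdist_lt : cq => /(_ 1 ltr01); apply: filterS => n.
    by rewrite sub0r normrN => h; exact: le_lt_trans (ler_norm _) h.
  have qn0 : 0 <= q n by near: n.
  have q1' : 0 < 1 - q n by rewrite subr_gt0.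
  apply/andP; split.
    have h : expR (- (q n / (1 - q n))) <= 1 - q n.
      rewrite expRN -[X in _ <= X]invrK lef_pV2 ?posrE ?expR_gt0 ?invr_gt0//.
      apply: le_trans (expR_ge1Dx _).
      by rewrite le_eqVlt; apply/orP; left; apply/eqP; field; rewrite gt_eqF.
    rewrite (_ : - (n%:R * q n) / (1 - q n) = n%:R * (- (q n / (1 - q n)))); last by ring.
    by rewrite expRM_natl lerXn2r ?nnegrE ?expR_ge0 ?(ltW q1').
  rewrite (_ : - (n%:R * q n) = n%:R * (- q n)); last by ring.
  rewrite expRM_natl lerXn2r ?nnegrE ?expR_ge0 ?(ltW q1')//.
  exact: expR_ge1Dx.
- have h : - (n%:R * q n) / (1 - q n) @[n --> \oo] --> - lam.
    rewrite (_ : - lam = - lam / (1 - 0)); last by rewrite subr0 divr1.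
    apply: cvgM; first exact: cvgN.
    apply: cvgV; first by rewrite subr0 oner_neq0.
    by apply: cvgB => //; exact: cvg_cst.
  exact: (cvg_comp _ _ h cexp).
- have h : - (n%:R * q n) @[n --> \oo] --> - lam by exact: cvgN.
  exact: (cvg_comp _ _ h cexp).
Unshelve. all: by end_near.
Qed.

(** A factor n^s, with s the fixed total, is moved from the falling factorial to the cell
    probabilities. The ratio tends to 1, each [n%:R * pr n j] to its intensity, and the power of the
    remainder supplies all the exponentials together. *)
Lemma multinom_pmf_cvg (J : nat) (pr : nat -> nat -> R) (lam : 'I_J -> R)
    (m : {ffun 'I_J -> nat}) :
  (forall n j, 0 <= pr n j) ->
  (forall n, pr n J = 1 - \sum_(j < J) pr n j) ->
  (forall j : 'I_J, n%:R * pr n j @[n --> \oo] --> lam j) ->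
  multinom_pmf (pr n) n m @[n --> \oo] --> \prod_(j < J) poisson_p (lam j) (m j).
Proof.
move=> p0 pJ pl; pose s := total m; pose q n := \sum_(j < J) pr n j.
have nq : n%:R * q n @[n --> \oo] --> \sum_j lam j.
  rewrite /q; under eq_fun do rewrite mulr_sumr.
  by apply: cvg_big => [|j _]; [exact: add_continuous|exact: pl].
have q0 : \forall n \near \oo, 0 <= q n by apply: nearW => n; exact: sumr_ge0.
have [cq ce] := cvg_pow_exp q0 nq.
have -> : \prod_(j < J) poisson_p (lam j) (m j) =
    1 * (\prod_(j < J) (lam j ^+ m j / (m j)`!%:R)) * (expR (- \sum_j lam j) / (1 - 0) ^+ s).
  rewrite /poisson_p big_split/= mul1r subr0 expr1n divr1; congr (_ * _).
  by rewrite -sumrN expR_sum.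
have c1 : \prod_(j < J) ((n%:R * pr n j) ^+ m j / (m j)`!%:R) @[n --> \oo] -->
    \prod_(j < J) (lam j ^+ m j / (m j)`!%:R).
  apply: cvg_big => [|j _]; first exact: mul_continuous.
  apply: cvgM; last exact: cvg_cst.
  exact: (@cvg_comp _ _ _ (fun n => n%:R * pr n j) (fun x : R => x ^+ m j) _ _ _ (pl j) (@exprn_continuous _ (m j) (lam j))).
have c2 : (1 - q n) ^+ n / (1 - q n) ^+ s @[n --> \oo] --> expR (- \sum_j lam j) / (1 - 0) ^+ s.
  apply: cvgM => //; apply: cvgV; first by rewrite subr0 expr1n oner_neq0.
  apply: (@cvg_comp _ _ _ (fun n => 1 - q n) (fun x : R => x ^+ s)); last exact: exprn_continuous.
  by apply: cvgB => //; exact: cvg_cst.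
apply: cvg_trans (cvgM (cvgM (cvg_ffact_ratio s) c1) c2).
apply: near_eq_cvg; near=> n.
have n0 : (n%:R : R) != 0.
  by rewrite pnatr_eq0 -lt0n; near: n; exact: nbhs_infty_gt.
have sn : (s <= n)%N by near: n; exact: nbhs_infty_ge.
have q1 : 1 - q n != 0.
  rewrite subr_eq0 gt_eqF//; near: n; move/cvgrPdist_lt : cq => /(_ 1 ltr01); apply: filterS => n.
  by rewrite sub0r normrN => h; exact: le_lt_trans (ler_norm _) h.
rewrite /multinom_pmf -/s pJ -/(q n) /=.
have -> : (1 - q n) ^+ n / (1 - q n) ^+ s = (1 - q n) ^+ (n - s).
  by apply: (mulIf (expf_neq0 s q1)); rewrite mulfVK ?expf_neq0// -exprD subnK.
congr (_ * _).
have -> : \prod_(j < J) ((n%:R * pr n j) ^+ m j / (m j)`!%:R) =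
   n%:R ^+ s * \prod_(j < J) (pr n j ^+ m j / (m j)`!%:R).
  rewrite /s /total -prodrXr -big_split/=.
  by apply: eq_bigr => j _; rewrite exprMn mulrA.
by rewrite mulrA mulfVK// expf_neq0.
Unshelve. all: by end_near.
Qed.

End poisson_limit.

(** * Exponentially weighted sums of powers *)

Section tail.
Context {R : realType}.

Lemma pow_le_expR (k : nat) (x : R) : 0 <= x -> x ^+ k <= k`!%:R * expR x.
Proof.
move=> x0; case: k => [|k]; first by rewrite expr0 fact0 mul1r; have := expR_ge1Dx x; lra.
have f0 : (0 : R) < k.+1`!%:R by rewrite ltr0n fact_gt0.
have h := @expR_ge1Dxn R x k x0; rewrite mulrC -ler_pdivrMr//; lra.
Qed.

Let theta : R := expR (- 2^-1).

(** By x^k <= k! e^x at x = (m+1)/2, the term e^{-m} (m+1)^k is at most k! 2^k e^{1/2} [theta ^+ m];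
    the denominator comes from the geometric series. *)
Definition tail_const (k : nat) : R := k`!%:R * 2 ^+ k * expR 2^-1 / (1 - theta).

Let theta1 : theta < 1. Proof. by rewrite -[X in _ < X]expR0 ltr_expR; lra. Qed.
Let theta0 : 0 < theta. Proof. exact: expR_gt0. Qed.

Lemma tail_sum_le (k M M' : nat) :
  \sum_(M <= m < M') expR (- m%:R) * m.+1%:R ^+ k <= tail_const k * expR (- 2^-1) ^+ M.
Proof.
have step (m : nat) : expR (- m%:R) * m.+1%:R ^+ k <= k`!%:R * 2 ^+ k * expR 2^-1 * theta ^+ m.
  have h : 0 <= m.+1%:R / 2 :> R by rewrite divr_ge0.
  have := pow_le_expR k h; rewrite expr_div_n ler_pdivrMr ?exprn_gt0// => h2.
  apply: (@le_trans _ _ (expR (- m%:R) * (k`!%:R * expR (m.+1%:R / 2) * 2 ^+ k))).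
    by rewrite ler_wpM2l ?expR_ge0.
  rewrite le_eqVlt; apply/orP; left; apply/eqP.
  rewrite /theta -expRM_natl.
  have -> : m%:R * - 2^-1 = - m%:R + m%:R / 2 :> R by field.
  have -> : m.+1%:R / 2 = m%:R / 2 + 2^-1 :> R by rewrite -natr1; field.
  by rewrite !expRD; ring.
have geo : \sum_(M <= m < M') theta ^+ m <= theta ^+ M / (1 - theta).
  have t1 : 0 < 1 - theta by rewrite subr_gt0.
  have [MM|MM] := leqP M' M.
    by rewrite big_geq// divr_ge0 ?exprn_ge0 ?(ltW theta0) ?(ltW t1).
  rewrite ler_pdivlMr// mulrC mulr_sumr.
  rewrite (eq_bigr (fun m => - (theta ^+ m.+1 - theta ^+ m))); last first.
    by move=> m _; rewrite exprS; ring.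
  rewrite sumrN telescope_sumr ?(ltnW MM)// opprB lerBlDr lerDl.
  by rewrite exprn_ge0 ?ltW.
apply: (le_trans (ler_sum _ (fun m _ => step m))).
rewrite -mulr_sumr [X in _ <= X](_ : _ = k`!%:R * 2 ^+ k * expR 2^-1 * (theta ^+ M / (1 - theta))); last first.
  by rewrite /tail_const mulrA [RHS]mulrAC.
by rewrite ler_wpM2l// ?mulr_ge0 ?exprn_ge0 ?expR_ge0.
Qed.

Lemma tail_const_cvg k (D : R) : D * (tail_const k * expR (- 2^-1) ^+ M) @[M --> \oo] --> 0.
Proof.
rewrite -(mulr0 D); apply: cvgM; first exact: cvg_cst.
rewrite -(mulr0 (tail_const k)); apply: cvgM; first exact: cvg_cst.
by apply: cvg_expr; rewrite gtr0_norm.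
Qed.

End tail.

(** * Probability of a large tail sum *)

Section tail_probability.
Local Open Scope ereal_scope.
Context d (Om : measurableType d) (R : realType) (P : probability Om R).
Variables (Kc : nat -> Om -> \bar R) (D eta : R) (k M : nat).
Hypothesis mKc : forall m, measurable_fun setT (Kc m).
Hypothesis Kc0 : forall m w, 0 <= Kc m w.
Hypothesis eKc : forall m, \int[P]_w Kc m.+1 w <= (D * m.+1%:R ^+ k)%:E.
Hypothesis D0 : (0 <= D)%R.
Hypothesis eta0 : (0 < eta)%R.

(** In the applications [Kc m.+1] counts all points up to m+1, not only those of the last unit
    interval. Its mean grows polynomially, so the exponential weight absorbs the excess. *)
Definition tail_sum (M' : nat) (w : Om) : \bar R :=
  \sum_(M <= m < M') (expR (- m%:R))%:E * Kc m.+1 w.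

Definition tail_bad : set Om := \bigcup_M' [set w | eta%:E < tail_sum M' w].

Let mts M' : measurable_fun setT (tail_sum M').
Proof.
by apply: emeasurable_sum => m; apply: emeasurable_funM => //; exact: measurable_cst.
Qed.

Let mA M' : measurable [set w | eta%:E < tail_sum M' w].
Proof.
have := mts M' => /(_ measurableT `]eta%:E, +oo[%classic).
rewrite setTI => /(_ (emeasurable_itv _)); congr measurable.
by apply/seteqP; split => w /=; rewrite in_itv/= andbT.
Qed.

Lemma measurable_tail_bad : measurable tail_bad.
Proof. exact: bigcupT_measurable. Qed.

Let ts_nd w : {homo tail_sum^~ w : M1 M2 / (M1 <= M2)%N >-> M1 <= M2}.
Proof.
move=> M1 M2 M12; apply: lee_sum_nneg_natr => // m _ _.
by rewrite mule_ge0// lee_fin expR_ge0.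
Qed.

Let prob_A M' : P [set w | eta%:E < tail_sum M' w] <=
  (D / eta * (tail_const k * expR (- 2^-1) ^+ M))%:E.
Proof.
set A := [set w | _].
have mAA : measurable A by exact: mA.
have PA : \int[P]_w (\1_A w)%:E = P A by rewrite integral_indic// setIT.
have h : eta%:E * P A <= (D * (tail_const k * expR (- 2^-1) ^+ M))%:E.
  apply: (@le_trans _ _ (\int[P]_w tail_sum M' w)).
    rewrite -PA.
    rewrite -ge0_integralZl//; last 2 first.
    - exact/measurable_EFinP.
    - by rewrite lee_fin ltW.
    apply: ge0_le_integral_nonmeas => w.
      by rewrite mule_ge0// lee_fin// ltW.
    rewrite indicE; case: (boolP (w \in A)) => hA.
      by rewrite mule1 ltW//; move: hA; rewrite inE.
    by rewrite mule0; apply: sume_ge0 => m _; rewrite mule_ge0// lee_fin expR_ge0.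
  rewrite /tail_sum ge0_integral_sum//; last 2 first.
  - by move=> m; apply: emeasurable_funM => //; exact: measurable_cst.
  - by move=> m w _; rewrite mule_ge0// lee_fin expR_ge0.
  apply: (@le_trans _ _ (\sum_(M <= m < M') (expR (- m%:R) * (D * m.+1%:R ^+ k))%:E)).
    apply: lee_sum => m _; rewrite ge0_integralZl// ?lee_fin ?expR_ge0//.
    by rewrite EFinM lee_wpmul2l// lee_fin expR_ge0.
  rewrite sumEFin lee_fin.
  rewrite (eq_bigr (fun m : nat => D * (expR (- m%:R) * m.+1%:R ^+ k))%R); last by move=> m _; ring.
  by rewrite -mulr_sumr ler_wpM2l// tail_sum_le.
rewrite -[X in X <= _]fineK ?fin_num_measure// lee_fin.
move: h; rewrite -[P A]fineK ?fin_num_measure// -EFinM lee_fin /= => h.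
by rewrite mulrAC ler_pdivlMr// mulrC.
Qed.

(** Markov's inequality gives a bound that does not depend on [M']; the events increase with [M'],
    and continuity from below passes it to their union. *)
Lemma prob_tail_bad : P tail_bad <= (D / eta * (tail_const k * expR (- 2^-1) ^+ M))%:E.
Proof.
have nd : nondecreasing_seq (fun M' => [set w | eta%:E < tail_sum M' w]).
  move=> M1 M2 M12; apply/subsetPset => w /= /lt_le_trans; apply; exact: ts_nd.
have cv := @nondecreasing_cvg_mu _ _ _ P _ mA measurable_tail_bad nd.
rewrite /tail_bad -(cvg_lim _ cv)//; apply: lime_le; first by apply/cvg_ex; eexists; exact: cv.
by apply: nearW => M'; exact: prob_A.
Qed.

Lemma not_tail_bad w : ~ tail_bad w -> forall M', tail_sum M' w <= eta%:E.
Proof. by move=> h M'; rewrite leNgt; apply/negP => h2; apply: h; exists M'. Qed.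

End tail_probability.

(** * The common estimate for the sample and for the Poisson process *)

Section one_side.
Local Open Scope ereal_scope.
Context {R : realType}.

Definition cumul J (m : {ffun 'I_J -> nat}) (j : nat) : nat :=
  (\sum_(l < J | (l <= j)%N) m l)%N.

Definition cell_weights k (r J : nat) (m : {ffun 'I_J -> nat}) : 'rV[R]_k :=
  (\row_(i < k) (top_tilde (grid r J) J (cumul m) i / Z_tilde (grid r J) J (cumul m)))%R.

(** Exact and approximate weights lie in the cube [0, 1]^k, where a continuous test function is
    uniformly continuous; closeness is coordinatewise to match [weight_approx]. *)
Definition unif_on_box k (f : 'rV[R]_k -> R) (delta eps : R) :=
  forall u v : 'rV[R]_k, (forall i, 0 <= u 0 i <= 1)%R -> (forall i, 0 <= v 0 i <= 1)%R ->
    (forall i, `|u 0 i - v 0 i| <= delta)%R -> (`|f u - f v| <= eps)%R.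

Context d (Om : measurableType d) (P : probability Om R).
Variables (k : nat) (f : 'rV[R]_k -> R) (B eps delta eta D : R) (r M L dim : nat).
Variables (b : Om -> nat -> R) (K : Om -> R -> nat) (Kc : nat -> Om -> \bar R).
Variables (Null : set Om) (E : {ffun 'I_(M * r) -> nat} -> set Om).
Variable s : seq {ffun 'I_(M * r) -> nat}.
Hypothesis fB : forall v, (`|f v| <= B)%R.
Hypothesis eps0 : (0 <= eps)%R.
Hypothesis uf : unif_on_box f delta eps.
Hypothesis r0 : (0 < r)%N.
Hypothesis L0 : (0 < L)%N.
Hypothesis LM : (L <= M)%N.
Hypothesis eta0 : (0 < eta)%R.
Hypothesis hdelta : ((1 - expR (- r%:R^-1)) + eta * expR L%:R <= delta)%R.
Hypothesis D0 : (0 <= D)%R.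
Hypothesis mNull : measurable Null.
Hypothesis PNull : P Null = 0.
Hypothesis b01 : forall w, ~ Null w -> forall i, (0 <= b w i <= 1)%R.
Hypothesis bK : forall w, ~ Null w -> forall y i, (0 <= y)%R ->
  (expR (- y) <= b w i)%R = (i < K w y)%N.
Hypothesis mKc : forall m, measurable_fun setT (Kc m).
Hypothesis Kc0 : forall m w, 0 <= Kc m w.
Hypothesis KcE : forall w, ~ Null w -> forall m, Kc m w = (K w m%:R)%:R%:E.
Hypothesis eKc : forall m, \int[P]_w Kc m.+1 w <= (D * m.+1%:R ^+ dim)%:E.
Hypothesis mE : forall m, measurable (E m).
Hypothesis dE : forall m1 m2 w, E m1 w -> E m2 w -> m1 = m2.
Hypothesis EK : forall w m, ~ Null w -> E m w ->
  forall j, (j < M * r)%N -> K w (j.+1%:R / r%:R) = cumul m j.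
Hypothesis us : uniq s.
Hypothesis sL : forall m, m \in s -> (0 < cumul m (L * r).-1)%N.

Definition cover_event : set Om := \big[setU/set0]_(m <- s) E m.

Let mcover : measurable cover_event.
Proof. by apply: bigsetU_measurable. Qed.

Lemma prob_cover : P cover_event = (\sum_(m <- s) fine (P (E m)))%:E.
Proof.
rewrite /cover_event; elim: s us => [|m t IH] /=.
  by rewrite !big_nil measure0.
move=> /andP[mt ut]; rewrite !big_cons EFinD -IH// fineK ?fin_num_measure//.
rewrite measureU//; first by apply: bigsetU_measurable.
apply/seteqP; split => w //= -[h1].
rewrite -bigcup_seq => -[m' /= m't h2].
by move: mt; rewrite (dE h1 h2) m't.
Qed.

Let bad := Null `|` tail_bad Kc eta M `|` ~` cover_event.

(** Outside [bad] the counts are one of the vectors in [s], the tail sum is at most [eta], and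
    [0, L] contains a point; the weights are then within [delta] of those computed from the counts.
    The last summand of the bound is the probability missed by the family [s]. *)
Lemma one_side_bound : exists2 v : R,
  \int[P]_w (f (\row_(i < k) (b w i / limn (fun n => \sum_(j < n) b w j)))%R)%:E = v%:E &
  (`|v - \sum_(m <- s) f (cell_weights k r m) * fine (P (E m))| <=
   2 * eps + 4 * B * (D / eta * (tail_const dim * expR (- 2^-1) ^+ M) +
                      (1 - \sum_(m <- s) fine (P (E m)))))%R.
Proof.
have B0 : (0 <= B)%R by exact: le_trans (fB 0).
have mtail : measurable (tail_bad Kc eta M) by exact: measurable_tail_bad.
have mbad : measurable bad.
  by apply: measurableU; [exact: measurableU|exact: measurableC].
have Pbad : (fine (P bad) <= D / eta * (tail_const dim * expR (- 2^-1) ^+ M) +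
                      (1 - \sum_(m <- s) fine (P (E m))))%R.
  have h1 : P bad <= P Null + P (tail_bad Kc eta M) + P (~` cover_event).
    apply: (@le_trans _ _ (P (Null `|` tail_bad Kc eta M) + P (~` cover_event))).
      by apply: measureU2; [exact: measurableU|exact: measurableC].
    by rewrite leeD2r// measureU2.
  have h2 := @prob_tail_bad _ _ _ P Kc D eta dim M mKc Kc0 eKc D0 eta0.
  rewrite PNull add0e probability_setC// prob_cover in h1.
  rewrite -lee_fin fineK ?fin_num_measure//; apply: (le_trans h1).
  by rewrite EFinD EFinB leeD2r.
have Fbad w : ~ bad w -> exists m, [/\ m \in s, E m w &
    (`|f (\row_(i < k) (b w i / limn (fun n => \sum_(j < n) b w j)))%R - f (cell_weights k r m)| <= eps)%R].
  move=> nb.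
  have nN : ~ Null w by move=> h; apply: nb; left; left.
  have nt : ~ tail_bad Kc eta M w by move=> h; apply: nb; left; right.
  have [m ms Em] : exists2 m, m \in s & E m w.
    have : cover_event w by apply: contrapT => h; apply: nb; right.
    by rewrite /cover_event -bigcup_seq => -[m /= ms Em]; exists m.
  exists m; split => //.
  have tl M' : (\sum_(M <= m < M') expR (- m%:R) * (K w m.+1%:R)%:R <= eta)%R.
    have := not_tail_bad nt M'; rewrite /tail_sum.
    under eq_bigr do rewrite KcE// -EFinM.
    by rewrite sumEFin lee_fin.
  (* The cell of index [(L * r).-1] ends exactly at [L]. *)
  have KL : (0 < K w L%:R)%N.
    have Lr : (0 < L * r)%N by rewrite muln_gt0 L0.
    have := EK nN Em (_ : ((L * r).-1 < M * r)%N).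
    rewrite prednK// leq_mul2r LM orbT => /(_ isT).
    rewrite natrM mulfK ?pnatr_eq0 -?lt0n// => ->.
    exact: sL.
  have M0 : (0 < M)%N by exact: leq_trans LM.
  have L0' : (0 <= L%:R :> R)%R by [].
  have e1 i : top_tilde (grid r (M * r) : nat -> R) (M * r) (cumul m) i =
     top_tilde (grid r (M * r)) (M * r) (fun j => K w (j.+1%:R / r%:R)) i.
    by apply: eq_bigr => j _; rewrite (EK nN Em).
  have e2 : Z_tilde (grid r (M * r) : nat -> R) (M * r) (cumul m) =
     Z_tilde (grid r (M * r)) (M * r) (fun j => K w (j.+1%:R / r%:R)).
    by apply: eq_bigr => j _; rewrite (EK nN Em).
  apply: uf => i; rewrite !mxE ?e1 ?e2.
  - exact: (weight_ge0_le1 (b01 nN) (bK nN) M0 r0 tl L0' KL).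
  - exact: (weight_tilde_ge0_le1 M r (bK nN)).
  - apply: le_trans hdelta.
    exact: (weight_approx (b01 nN) (bK nN) M0 r0 tl L0' KL).
have [v Fv hv] := @integral_step_approx _ Om R P _ s E (fun m => f (cell_weights k r m)) bad
  (fun w => f (\row_(i < k) (b w i / limn (fun n => \sum_(j < n) b w j)))%R) B eps
  us mE dE mbad eps0 B0 (fun=> fB _) (fun=> fB _) Fbad.
exists v; first exact: Fv.
apply: (le_trans hv); rewrite lerD2l ler_wpM2l//.
by rewrite mulr_ge0.
Qed.

End one_side.

(** * Poisson variables: almost sure finiteness and mean *)

Section poisson_law.
Context {R : realType}.

Lemma poisson_p_ge0 (lam : R) k : 0 <= lam -> 0 <= poisson_p lam k.
Proof. by move=> l0; rewrite /poisson_p mulr_ge0 ?expR_ge0// divr_ge0// exprn_ge0. Qed.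

Lemma poisson_sum_cvg (lam : R) : (fun n => \sum_(k < n) poisson_p lam k) @ \oo --> (1 : R).
Proof.
have h : series (exp_coeff lam) @ \oo --> expR lam by exact: is_cvg_series_exp_coeff.
have <- : expR lam * expR (- lam) = 1 by rewrite -expRD subrr expR0.
apply: cvg_trans (cvgM h (cvg_cst (expR (- lam)))).
apply: near_eq_cvg.
apply: nearW => n /=; rewrite /series/= big_mkord mulr_suml.
by apply: eq_bigr => k _; rewrite /poisson_p /exp_coeff/=.
Qed.

Lemma poisson_sum_le1 (lam : R) n : 0 <= lam -> \sum_(k < n) poisson_p lam k <= 1.
Proof.
move=> l0; have cv := poisson_sum_cvg lam.
rewrite -(cvg_lim _ cv)//; apply: (nondecreasing_cvgn_le _ (cvgP _ cv) n).
by apply/nondecreasing_seqP => m; rewrite big_ord_recr/= lerDl poisson_p_ge0.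
Qed.

(** The weights satisfy k p_k = lam p_{k-1}, so a partial mean is [lam] times a partial sum of
    probabilities. *)
Lemma poisson_mean_partial (lam : R) n : 0 <= lam ->
  \sum_(k < n) k%:R * poisson_p lam k <= lam.
Proof.
move=> l0; case: n => [|n]; first by rewrite big_ord0.
rewrite big_ord_recl mul0r add0r.
apply: (@le_trans _ _ (lam * \sum_(k < n) poisson_p lam k)); last first.
  by rewrite ler_piMr// poisson_sum_le1.
rewrite mulr_sumr; apply: ler_sum => k _.
rewrite lift0 /poisson_p exprS factS natrM.
have h1 : (k`!%:R : R) != 0 by rewrite pnatr_eq0 -lt0n fact_gt0.
have h2 : (k.+1%:R : R) != 0 by rewrite pnatr_eq0.
move: (k.+1%:R : R) (k`!%:R : R) h2 h1 => u v h2 h1.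
by rewrite le_eqVlt; apply/orP; left; apply/eqP; field; rewrite h1 h2.
Qed.

End poisson_law.

Section poisson_variable.
Local Open Scope ereal_scope.
Context d (Om : measurableType d) (R : realType) (P : probability Om R).
Variables (f : Om -> \bar R) (lam : R).
Hypothesis mf : measurable_fun setT f.
Hypothesis f0 : forall w, 0 <= f w.
Hypothesis lam0 : (0 <= lam)%R.
Hypothesis Pf : forall k : nat, P [set w | f w = (k%:R)%:E] = (poisson_p lam k)%:E.

Let A (k : nat) := [set w | f w = (k%:R)%:E].

Let mA k : measurable (A k).
Proof. by rewrite -[A k]setTI; exact: (mf measurableT (emeasurable_set1 _)). Qed.

Let tA : trivIset setT A.
Proof.
move=> i j _ _ [w [/= h1 h2]]; move: h2; rewrite /A/= h1 => -[] /eqP.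
by rewrite eqr_nat => /eqP.
Qed.

(** The Poisson probabilities sum to 1, leaving none for non-natural values, in particular for an
    infinite one. *)
Lemma poisson_finite_as : P (~` \bigcup_k A k) = 0.
Proof.
have mU : measurable (\bigcup_k A k) by exact: bigcupT_measurable.
rewrite probability_setC// measure_bigcup//.
rewrite (_ : \sum_(i <oo | i \in setT) P (A i) = 1) ?subee//.
rewrite (eq_eseriesl (Q := xpredT)) ?(eq_eseriesr (fun i _ => Pf i))//; last by move=> i; rewrite in_setT.
apply/cvg_lim => //.
rewrite (_ : (fun n => \sum_(0 <= k < n) (poisson_p lam k)%:E) =
  EFin \o (fun n => (\sum_(k < n) poisson_p lam k)%R)); last first.
  by apply/funext => n /=; rewrite sumEFin big_mkord.
by apply: cvg_EFin; [exact: nearW|exact: poisson_sum_cvg].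
Qed.

(** Almost everywhere [f] is the series of [k] times the indicator of its level [k]; integrating
    term by term leaves partial means. *)
Lemma poisson_mean_le : \int[P]_w f w <= lam%:E.
Proof.
pose g w : \bar R := \sum_(k <oo) ((k%:R : R)%:E * (\1_(A k) w)%:E).
have g0 k w : 0 <= (k%:R : R)%:E * (\1_(A k) w)%:E by rewrite mule_ge0// lee_fin.
have mg k : measurable_fun setT (fun w => (k%:R : R)%:E * (\1_(A k) w)%:E).
  apply: emeasurable_funM; first exact: measurable_cst.
  exact/measurable_EFinP/measurable_indic.
have -> : \int[P]_w f w = \int[P]_w g w.
  apply: ge0_ae_eq_integral => //.
  - by apply: ge0_emeasurable_sum => //= k w *; exact: g0.
  - by move=> w _; exact: nneseries_ge0.
  exists (~` \bigcup_k A k); split.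
  - by apply: measurableC; exact: bigcupT_measurable.
  - exact: poisson_finite_as.
  move=> w /= h1 [k _ Ak]; apply: h1 => _.
  rewrite /g (@nneseriesD1 _ _ k)// eseries0 ?adde0.
    by rewrite indicE mem_set// mule1.
  move=> l _ lk; rewrite indicE memNset ?mule0// => Al.
  by move/eqP : lk; apply; apply: tA => //; exists w.
rewrite /g integral_nneseries//.
apply: lime_le.
  by apply: is_cvg_nneseries => l _ _; apply: integral_ge0 => w _.
apply: nearW => n.
rewrite (eq_bigr (fun k => (k%:R * poisson_p lam k)%:E)); last first.
  move=> k _; rewrite ge0_integralZl//; last exact/measurable_EFinP/measurable_indic.
  by rewrite integral_indic// setIT EFinM; congr (_ * _); exact: Pf.
by rewrite sumEFin lee_fin big_mkord poisson_mean_partial.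
Qed.

End poisson_variable.

(* Restates [measureU] for the coercion of [{measure set _ -> _}], so that
   its right-hand side can be rewritten. *)
Lemma measure_setU_disj d (T : measurableType d) (R : realType)
    (mu : {measure set T -> \bar R}) (A B : set T) :
  measurable A -> measurable B -> A `&` B = set0 ->
  (mu (A `|` B) = mu A + mu B)%E.
Proof. exact: measureU. Qed.

(** * Cells, counts and atoms of the Poisson process *)

Section poisson_process.
Local Open Scope ereal_scope.
Context d (Om : measurableType d) (R : realType) (P : probability Om R).
Variables (Lam : {measure set R -> \bar R}) (N : Om -> {measure set R -> \bar R}).
Variables (Y : Om -> nat -> R) (G : R -> R).
Hypothesis ppp : is_PPP P N Lam.
Hypothesis LamE : forall y : R, (0 <= y)%R -> Lam `[0%R, y]%classic = (G y)%:E.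
Hypothesis Lam0 : Lam `]-oo, 0%R[%classic = 0.
Hypothesis hY : {ae P, forall w, atoms_increasing (N w) (Y w)}.

Let mN B : measurable B -> measurable_fun setT (fun w => N w B).
Proof. by case: ppp => _ h _ _ _; exact: h. Qed.

Lemma Lam_half_line (y : R) : (0 <= y)%R -> Lam `]-oo, y]%classic = (G y)%:E.
Proof.
move=> y0.
rewrite (_ : `]-oo, y]%classic = `]-oo, 0%R[%classic `|` `[0%R, y]%classic).
  rewrite measure_setU_disj//; first by rewrite Lam0 add0e LamE.
  apply/seteqP; split => x //=; rewrite !in_itv/= => -[h /andP[h2 _]].
  by move: h; rewrite ltNge h2.
apply/seteqP; split => x /=; rewrite !in_itv/=.
  by move=> h; case: (ltP x 0%R) => h0; [left|right; rewrite h].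
by move=> [/ltW/le_trans|/andP[_]//]; apply.
Qed.

(* Cell 0 includes the negative half-line, where [Lam] vanishes, so that the
   union of the first cells is a half-line. *)
Definition ppp_cell (r j : nat) : set R :=
  if j == 0%N then `]-oo, (r%:R^-1)%R]%classic
  else `](j%:R / r%:R)%R, (j.+1%:R / r%:R)%R]%classic.

Definition cell_mass (r j : nat) : R :=
  if j == 0%N then G r%:R^-1 else (G (j.+1%:R / r%:R) - G (j%:R / r%:R))%R.

Lemma measurable_ppp_cell r j : measurable (ppp_cell r j).
Proof. by rewrite /ppp_cell; case: ifP => _; exact: measurable_itv. Qed.

Lemma half_lineS r j :
  `]-oo, (j.+2%:R / r%:R)%R]%classic = `]-oo, (j.+1%:R / r%:R)%R]%classic `|` ppp_cell r j.+1 :> set R.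
Proof.
rewrite /ppp_cell/=; apply/seteqP; split => x /=; rewrite !in_itv/=.
  by move=> h; case: (leP x (j.+1%:R / r%:R)%R) => h0; [left|right; rewrite h].
move=> [h|/andP[]//]; apply: (le_trans h).
by rewrite ler_wpM2r ?invr_ge0// ler_nat.
Qed.

Lemma half_line_disj r j : `]-oo, (j.+1%:R / r%:R)%R]%classic `&` ppp_cell r j.+1 = set0 :> set R.
Proof.
rewrite /ppp_cell/=; apply/seteqP; split => x //=; rewrite !in_itv/= => -[h /andP[h2 _]].
by move: h2; rewrite ltNge h.
Qed.

Lemma measure_half_line (mu : {measure set R -> \bar R}) r j :
  mu `]-oo, (j.+1%:R / r%:R)%R]%classic = \sum_(l < j.+1) mu (ppp_cell r l).
Proof.
elim: j => [|j IH].
  by rewrite big_ord1 /ppp_cell/= div1r.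
rewrite half_lineS measure_setU_disj//; first by rewrite IH [RHS]big_ord_recr.
- exact: measurable_ppp_cell.
- exact: half_line_disj.
Qed.

Lemma ppp_cell_sub r j l : (l <= j)%N -> ppp_cell r l `<=` `]-oo, (j.+1%:R / r%:R)%R]%classic.
Proof.
move=> lj x; rewrite /ppp_cell; case: ifP => _ /=; rewrite !in_itv/=.
  move/le_trans; apply; rewrite -[X in (X <= _)%R]mul1r ler_wpM2r ?invr_ge0//.
  by rewrite ler1n.
move=> /andP[_ /le_trans]; apply.
by rewrite ler_wpM2r ?invr_ge0// ler_nat.
Qed.

Lemma ppp_cell_disj r i j : i != j -> ppp_cell r i `&` ppp_cell r j = set0.
Proof.
wlog ij : i j / (i < j)%N.
  move=> H; rewrite neq_ltn => /orP[ij|ji]; first by rewrite H ?ltn_eqF.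
  by rewrite setIC H ?ltn_eqF.
case: j ij => // j ij _.
apply/seteqP; split => x //= -[/(@ppp_cell_sub r j i)].
rewrite -ltnS => /(_ ij) h1 h2.
have : (`]-oo, (j.+1%:R / r%:R)%R]%classic `&` ppp_cell r j.+1) x by split.
by rewrite half_line_disj.
Qed.

Lemma Lam_cell r j : Lam (ppp_cell r j) = (cell_mass r j)%:E.
Proof.
rewrite /cell_mass; case: eqP => [->|/eqP j0].
  by rewrite /ppp_cell/= Lam_half_line// invr_ge0.
case: j j0 => // j _ /=.
have h : Lam `]-oo, (j.+2%:R / r%:R)%R]%classic =
   Lam `]-oo, (j.+1%:R / r%:R)%R]%classic + Lam (ppp_cell r j.+1).
  rewrite half_lineS measure_setU_disj//; [exact: measurable_ppp_cell|exact: half_line_disj].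
move: h; rewrite !Lam_half_line ?divr_ge0// EFinB.
by move=> ->; rewrite [in RHS]addeAC subee ?add0e.
Qed.

Let PN B (lam : R) : measurable B -> Lam B = lam%:E ->
  forall k : nat, P [set w | N w B = (k%:R)%:E] = (poisson_p lam k)%:E.
Proof.
move=> mB LB k; case: ppp => _ _ h _ _.
by rewrite h// LB ?ltry.
Qed.

Let Null_line m := ~` \bigcup_k [set w | N w `]-oo, (m%:R : R)]%classic = (k%:R : R)%:E].

(** The union of a measurable null set outside which [Y] enumerates the atoms, and of the countably
    many null events that a half-line ending at an integer has a non-natural mass. *)
Lemma ppp_null : exists Null : set Om, [/\ measurable Null, P Null = 0,
  forall w, ~ Null w -> atoms_increasing (N w) (Y w) &
  forall w, ~ Null w -> forall m, exists k, N w `]-oo, (m%:R : R)]%classic = (k%:R : R)%:E].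
Proof.
have [N0 [mN0 PN0 sN0]] := hY.
have mL m : measurable (Null_line m).
  apply: measurableC; apply: bigcupT_measurable => k.
  rewrite -[[set _ | _]]setTI; exact: (mN (measurable_itv _) measurableT (emeasurable_set1 _)).
have PL m : P (Null_line m) = 0.
  apply: (@poisson_finite_as _ _ _ P _ (G m%:R)).
  - exact: mN.
  - by move=> k; apply: PN => //; rewrite Lam_half_line.
exists (N0 `|` \bigcup_m Null_line m); split.
- by apply: measurableU => //; exact: bigcupT_measurable.
- apply/eqP; rewrite -measure_le0.
  have mU : measurable (\bigcup_m Null_line m) by exact: bigcupT_measurable.
  have h : P (N0 `|` \bigcup_m Null_line m) <= P N0 + P (\bigcup_m Null_line m).
    exact: measureU2.
  have h2 : P (\bigcup_m Null_line m) <= \sum_(m <oo) P (Null_line m).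
    exact: measure_sigma_subadditive.
  rewrite PN0 add0e in h; apply: (le_trans h); apply: (le_trans h2).
  by rewrite eseries0// => i _ _; exact: PL.
- by move=> w h; apply: contrapT => h2; apply: h; left; exact: sN0.
- move=> w h m; apply: contrapT => h2; apply: h; right; exists m => //.
  by move=> [k _ hk]; apply: h2; exists k.
Qed.

Definition ppp_event r J (m : {ffun 'I_J -> nat}) : set Om :=
  [set w | forall j : 'I_J, N w (ppp_cell r j) = ((m j)%:R : R)%:E].

Let ppp_eventE r J (m : {ffun 'I_J -> nat}) : ppp_event r m =
  \bigcap_(j in [set: 'I_J]) [set w | [set ((m j)%:R : R)%:E] (N w (ppp_cell r j))].
Proof. by apply/seteqP; split => w h j; [move=> _|]; exact: h. Qed.

Lemma measurable_ppp_event r J (m : {ffun 'I_J -> nat}) : measurable (ppp_event r m).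
Proof.
rewrite ppp_eventE; apply: fin_bigcap_measurable => // j _.
rewrite -[[set _ | _]]setTI.
exact: (mN (measurable_ppp_cell _ _) measurableT (emeasurable_set1 _)).
Qed.

Lemma ppp_event_prob r J (m : {ffun 'I_J -> nat}) :
  P (ppp_event r m) = (\prod_(j < J) poisson_p (cell_mass r j) (m j))%:E.
Proof.
rewrite ppp_eventE; case: ppp => _ _ _ _ h.
rewrite (h J (fun j => ppp_cell r j) (fun j => [set ((m j)%:R : R)%:E])).
- rewrite -prodEFin; apply: eq_bigr => j _.
  exact: (PN (measurable_ppp_cell _ _) (Lam_cell _ _)).
- by move=> j; exact: measurable_ppp_cell.
- by move=> j; exact: emeasurable_set1.
- by move=> i j ij; exact: ppp_cell_disj.
Qed.

Lemma ppp_event_disj r J (m1 m2 : {ffun 'I_J -> nat}) w :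
  ppp_event r m1 w -> ppp_event r m2 w -> m1 = m2.
Proof.
move=> h1 h2; apply/ffunP => j; have := h1 j; rewrite (h2 j) => -[] /eqP.
by rewrite eqr_nat => /eqP.
Qed.

Lemma ppp_mean m : \int[P]_w N w `]-oo, (m%:R : R)]%classic <= (G m%:R)%:E.
Proof.
have G0 : (0 <= G m%:R)%R by rewrite -lee_fin -Lam_half_line.
apply: poisson_mean_le => //.
- exact: mN.
- by apply: PN => //; rewrite Lam_half_line.
Qed.

Definition ppp_count (w : Om) (y : R) : nat :=
  Num.truncn (fine (N w `]-oo, y]%classic)).

Let countE w y k : N w `]-oo, y]%classic = (k%:R : R)%:E -> ppp_count w y = k.
Proof. by rewrite /ppp_count => -> /=; rewrite natrK. Qed.

Section good_point.
Variable w : Om.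
Hypothesis hat : atoms_increasing (N w) (Y w).
Hypothesis hfin : forall m, exists k, N w `]-oo, (m%:R : R)]%classic = (k%:R : R)%:E.

Let Y_gt0 i : (0 < Y w i)%R.
Proof. case: hat => h0 hi _; elim: i => // i IH; exact: lt_trans (hi i). Qed.

Let Y_mono i j : (i <= j)%N -> (Y w i <= Y w j)%R.
Proof.
have /nondecreasing_seqP : forall i, (Y w i <= Y w i.+1)%R by move=> l; case: hat => _ /(_ l)/ltW.
by apply.
Qed.

Let N_line y : N w `]-oo, y]%classic = \sum_(j <oo) ((Y w j <= y)%R%:R : R)%:E.
Proof.
case: hat => _ _ h; rewrite h//; apply: eq_eseriesr => j _.
rewrite indicE; congr ((nat_of_bool _)%:R%:E).
by apply/idP/idP; rewrite inE /= in_itv.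
Qed.

Let N_line_index y n : (forall j, (Y w j <= y)%R = (j < n)%N) ->
  N w `]-oo, y]%classic = (n%:R : R)%:E.
Proof.
move=> h; rewrite N_line; apply/cvg_lim => //.
rewrite -(cvg_shiftn n) /= (_ : (fun _ => _) = cst (n%:R : R)%:E); first exact: cvg_cst.
apply/funext => M /=.
rewrite (eq_bigr (fun j => ((j < n)%N%:R : R)%:E)) => [|j _]; last by rewrite h.
by rewrite sumEFin big_mkord -natr_sum sum_ltn_minn (minn_idPr (leq_addl _ _)).
Qed.

(** Were all atoms at most [y], a half-line ending at an integer above [y] would contain more atoms
    than its finite mass. So some atom exceeds [y], and the least such index is the number of atoms
    up to [y]. *)
Let Y_index y : exists n, forall j, (Y w j <= y)%R = (j < n)%N.
Proof.
have [n hn] : exists n, (y < Y w n)%R.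
  apply: contrapT => hno.
  have all_le j : (Y w j <= y)%R by rewrite leNgt; apply/negP => h; apply: hno; exists j.
  have [k hk] := hfin (Num.truncn y).+1.
  have : (k.+1%:R : R)%:E <= (k%:R : R)%:E.
    rewrite -hk N_line.
    apply: (@le_trans _ _ (\sum_(0 <= j < k.+1) ((Y w j <= (Num.truncn y).+1%:R)%R%:R : R)%:E)).
      rewrite sumEFin lee_fin (eq_bigr (fun=> 1%R)); last first.
        by move=> j _; rewrite (le_trans (all_le j))// ltW// truncnS_gt.
      by rewrite big_mkord sumr_const card_ord.
    by apply: nneseries_lim_ge => j _; rewrite lee_fin.
  by rewrite lee_fin ler_nat ltnn.
have ex : exists n, (y < Y w n)%R by exists n.
case: (ex_minnP ex) => m hm mmin; exists m => j.
apply/idP/idP => [|jm].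
  by apply: contraTT; rewrite -leqNgt -ltNge => /Y_mono; exact: lt_le_trans.
by rewrite leNgt; apply/negP => /mmin; rewrite leqNgt jm.
Qed.

Lemma ppp_countP y i : (Y w i <= y)%R = (i < ppp_count w y)%N.
Proof. by have [n hn] := Y_index y; rewrite (countE (N_line_index hn)). Qed.

Lemma ppp_countE y : N w `]-oo, y]%classic = ((ppp_count w y)%:R : R)%:E.
Proof. by have [n hn] := Y_index y; rewrite (countE (N_line_index hn)) (N_line_index hn). Qed.

Lemma ppp_atom_gt0 i : (0 < Y w i)%R. Proof. exact: Y_gt0. Qed.

Lemma ppp_count_cumul r J (m : {ffun 'I_J -> nat}) j : ppp_event r m w -> (j < J)%N ->
  ppp_count w (j.+1%:R / r%:R) = cumul m j.
Proof.
move=> h jJ; apply: countE; rewrite measure_half_line /cumul natr_sum -sumEFin.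
rewrite (big_ord_widen J (fun l => N w (ppp_cell r l)))//.
by apply: eq_bigr => l _; exact: h.
Qed.

End good_point.

End poisson_process.

(** * Finite families of count vectors that carry most of the Poisson probability *)

Definition box J K : seq {ffun 'I_J -> nat} :=
  [seq [ffun j => nat_of_ord (g j)] | g : {ffun 'I_J -> 'I_K}].

Lemma uniq_box J K : uniq (box J K).
Proof.
rewrite map_inj_uniq ?enum_uniq// => g1 g2 /ffunP h; apply/ffunP => j.
by apply: val_inj; have := h j; rewrite !ffunE.
Qed.

Lemma sum_box (R : comNzRingType) J K (F : 'I_J -> nat -> R) :
  \sum_(m <- box J K) \prod_(j < J) F j (m j) = \prod_(j < J) \sum_(k < K) F j k.
Proof.
rewrite bigA_distr_bigA/= /box big_map big_enum/=; apply: eq_bigr => g _.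
by apply: eq_bigr => j _; rewrite ffunE.
Qed.

Section poisson_cover.
Local Open Scope ereal_scope.
Context d (Om : measurableType d) (R : realType) (P : probability Om R).
Variables (Lam : {measure set R -> \bar R}) (N : Om -> {measure set R -> \bar R}).
Variables (Y : Om -> nat -> R) (G : R -> R).
Hypothesis ppp : is_PPP P N Lam.
Hypothesis LamE : forall y : R, (0 <= y)%R -> Lam `[0%R, y]%classic = (G y)%:E.
Hypothesis Lam0 : Lam `]-oo, 0%R[%classic = 0.
Hypothesis hY : {ae P, forall w, atoms_increasing (N w) (Y w)}.

(** The family is a large box restricted to vectors with a point up to [L]. The box misses at most
    [eps], since its probability is a product of partial Poisson sums. The discarded vectors force
    the half-line up to [L] to be empty, an event of probability [expR (- G L%:R)]. *)
Lemma ppp_cover eps r L M : (0 < eps)%R -> (0 < r)%N -> (0 < L)%N -> (L <= M)%N ->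
  (expR (- G L%:R) <= eps)%R ->
  exists s : seq {ffun 'I_(M * r) -> nat}, [/\ uniq s,
    forall m, m \in s -> (0 < cumul m (L * r).-1)%N &
    (1 - \sum_(m <- s) fine (P (ppp_event N r m)) <= 2 * eps)%R].
Proof.
move=> eps0 r0 L0 LM hG; set J := (M * r)%N.
have Lr : (L * r).-1.+1 = (L * r)%N by rewrite prednK// muln_gt0 L0.
have LrJ : ((L * r).-1 < J)%N by rewrite Lr leq_mul2r LM orbT.
have pE m : fine (P (ppp_event N r m)) =
    (\prod_(j < J) poisson_p (cell_mass G r j) (m j))%R.
  by rewrite (ppp_event_prob ppp LamE Lam0).
have c1 : (\prod_(j < J) \sum_(k < K) poisson_p (cell_mass G r j) k)%R @[K --> \oo] --> (1 : R)%R.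
  rewrite [X in _ --> X](_ : _ = (\prod_(j < J) 1)%R :> R); last by rewrite big1.
  apply: cvg_big => [|j _]; first exact: mul_continuous.
  exact: poisson_sum_cvg.
have [K hK] : exists K, (1 - eps <= \sum_(m <- box J K) fine (P (ppp_event N r m)))%R.
  move/cvgrPdist_le : c1 => /(_ eps eps0) [K _ /(_ K (leqnn K)) h]; exists K.
  rewrite (eq_bigr _ (fun m _ => pE m)) (sum_box K (fun j => poisson_p (cell_mass G r j))).
  by move: h; rewrite ler_norml => /andP[_]; lra.
pose good (m : {ffun 'I_J -> nat}) := (0 < cumul m (L * r).-1)%N.
exists [seq m <- box J K | good m]; split.
- by rewrite filter_uniq// uniq_box.
- by move=> m; rewrite mem_filter => /andP[].
rewrite (bigID good)/= -(big_filter _ good) -(big_filter _ (fun m => ~~ good m)) in hK.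
suff : (\sum_(m <- [seq m <- box J K | ~~ good m]) fine (P (ppp_event N r m)) <= eps)%R by lra.
rewrite -lee_fin -(@prob_cover _ _ _ P _ _ (@ppp_event _ _ _ N r J)); first last.
- by rewrite filter_uniq// uniq_box.
- exact: ppp_event_disj.
- by move=> m; exact: (measurable_ppp_event ppp).
have mZ : measurable [set w | N w `]-oo, (L%:R : R)]%classic = (0%:R : R)%:E].
  rewrite -[[set _ | _]]setTI; case: ppp => _ mN _ _ _.
  exact: (mN _ (measurable_itv _) measurableT _ (emeasurable_set1 _)).
apply: (@le_trans _ _ (P [set w | N w `]-oo, (L%:R : R)]%classic = (0%:R : R)%:E])).
  apply: le_measure; rewrite ?inE//.
    by apply: bigsetU_measurable => m _; exact: (measurable_ppp_event ppp).
  rewrite /cover_event -bigcup_seq => w [m /=].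
  rewrite mem_filter /good -leqNgt leqn0 => /andP[/eqP m0 _] h.
  have -> : (L%:R : R)%R = ((L * r).-1.+1%:R / r%:R)%R.
    by rewrite Lr natrM mulfK// pnatr_eq0 -lt0n.
  rewrite measure_half_line -m0 /cumul natr_sum -sumEFin.
  rewrite (big_ord_widen J (fun l => N w (ppp_cell r l)))//.
  by apply: eq_bigr => l _; exact: h.
case: ppp => _ _ PN _ _.
rewrite PN//; last by rewrite (Lam_half_line LamE Lam0)// ltry.
by rewrite (Lam_half_line LamE Lam0)//= /poisson_p expr0 fact0 divr1 mul1r lee_fin.
Qed.

End poisson_cover.

(** Compactness of the cube in near-covering form: around each point of the cube one right
    neighbourhood of 0 for [delta] serves a whole neighbourhood, hence one serves the cube. *)
Lemma unif_on_box_continuous (R : realType) k (f : 'rV[R]_k -> R) eps :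
  continuous f -> 0 < eps -> exists2 delta, 0 < delta & unif_on_box f delta eps.
Proof.
move=> cf e0.
have cK : compact [set v : 'rV[R]_k | forall i, `[0, 1]%classic (v ord0 i)].
  by apply: (@rV_compact R k (fun=> `[0, 1]%classic)) => i; exact: segment_compact.
have ncov := (iffLR (compact_near_coveringP _) cK).
have := ncov _ (0 : R)^'+ (fun delta u => forall v : 'rV[R]_k,
  (forall i, `|u 0 i - v 0 i| <= delta) -> `|f u - f v| <= eps) _.
case=> [u0 _|delta /= d0 h].
  have e2 : 0 < eps / 2 by lra.
  have /cvgrPdist_lt/(_ _ e2)/nbhs_ballP[e /= epos he] := cf u0.
  have ee : 0 < e / 2 by lra.
  near=> u delta => /= v huv.
  have hu : ball u0 (e / 2) u.
    by near: u; exact: nbhsx_ballx.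
  have hd : delta < e / 2 by near: delta; exact: nbhs_right_lt.
  have hfu : `|f u0 - f u| < eps / 2 by apply: he; apply: le_ball hu; lra.
  have hfv : `|f u0 - f v| < eps / 2.
    apply: he; split => // i j; rewrite /ball/= (ord1 i).
    have h1 : `|u0 0 j - u 0 j| < e / 2 by exact: (hu.2 0 j).
    by have := ler_distD (u 0 j) (u0 0 j) (v 0 j); have := huv j; lra.
  by have := ler_distD (f u0) (f u) (f v); rewrite (distrC (f u) (f u0)); lra.
have [e e0' he] : exists2 e : R, 0 < e & [set v : 'rV[R]_k | forall i, `[0, 1]%classic (v ord0 i)] `<=`
    (fun u => forall v : 'rV[R]_k, (forall i, `|u 0 i - v 0 i| <= e) -> `|f u - f v| <= eps).
  exists (delta / 2); first by lra.
  by apply: h => /=; rewrite ?sub0r ?normrN ?gtr0_norm//; lra.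
by exists e => // u v hu hv huv; apply: he => // i; rewrite /= in_itv/=; exact: hu.
Unshelve. all: by end_near.
Qed.

(** In a decreasing list the entries at least [g] form an initial segment. Positivity of [g] makes
    the default value 0 of [nth] fail the test beyond the end. *)
Lemma sorted_ge_count (R : realDomainType) (t : seq R) g i : 0 < g ->
  sorted (fun a c : R => c <= a) t -> (g <= nth 0 t i) = (i < count (fun a => g <= a)%R t)%N.
Proof.
move=> g0; elim: t i => [|a t IH] i; first by rewrite nth_nil leNgt g0.
move=> /= pt; have [ga|ag] := leP g a; last first.
  rewrite add0n; have /allP ta : all (fun c => c <= a) t.
    by apply: order_path_min pt => x y z h1 h2; exact: le_trans h2 h1.
  have -> : count (fun c => g <= c) t = 0%N.
    by apply/eqP; rewrite -leqn0 leqNgt -has_count; apply/hasPn => c /ta ca; rewrite -ltNge (le_lt_trans ca).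
  rewrite ltn0; apply/negbTE; rewrite -ltNge; case: i => //= i.
  have [ti|it] := leqP (size t) i; first by rewrite nth_default.
  by apply: le_lt_trans ag; apply: ta; exact: mem_nth.
by case: i => [|i]/=; rewrite ?ga ?add1n ?ltnS// IH// (path_sorted pt).
Qed.

Lemma sort_ge_count (R : realDomainType) (s : seq R) g i : 0 < g ->
  (g <= nth 0 (sort (fun a c : R => c <= a) s) i) = (i < count (fun a => g <= a)%R s)%N.
Proof.
move=> g0; rewrite sorted_ge_count//.
  by have /permP -> : perm_eq (sort (fun a c : R => c <= a) s) s by rewrite perm_sort.
by apply: sort_sorted => a c; exact: le_total.
Qed.

(** Continued by zeros, a list has eventually constant partial sums; this lets a finite sample share
    the statements made for infinitely many points. *)
Lemma sum_nth_lim (R : realType) (t : seq R) :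
  limn (fun n => \sum_(j < n) nth 0 t j) = \sum_(a <- t) a.
Proof.
apply/cvg_lim => //; rewrite -(cvg_shiftn (size t)) /=.
rewrite (_ : (fun _ => _) = cst (\sum_(a <- t) a)); first exact: cvg_cst.
apply/funext => n /=; rewrite addnC big_split_ord/= [X in _ + X]big1 ?addr0.
  by rewrite (big_nth 0) big_mkord.
by move=> i _; rewrite nth_default// leq_addr.
Qed.

(** * The finite sample: sorted weights and cell counts *)

Section sample.
Local Open Scope ereal_scope.
Context d (Om : measurableType d) (R : realType) (P : probability Om R).
Variables (S : nat -> Om -> R) (F : R -> R).
Hypothesis mS : forall i, measurable_fun setT (S i).
Hypothesis SF : forall i t, P [set w | (S i w <= t)%R] = (F t)%:E.
Hypothesis S0 : forall i, P [set w | (S i w < 0)%R] = 0.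
Hypothesis indS : forall Jl (B : nat -> set R), uniq Jl -> (forall j, measurable (B j)) ->
  P (\bigcap_(j in [set j | j \in Jl]) (S j @^-1` B j)) = \prod_(j <- Jl) P (S j @^-1` B j).
Variables (n : nat) (beta : R).
Hypothesis n0 : (0 < n)%N.
Hypothesis beta0 : (0 < beta)%R.

Definition softmax_Z (w : Om) : R := (\sum_(i < n) expR (- beta * S i w))%R.

Definition softmax (w : Om) : seq R :=
  [seq (expR (- beta * S i w) / softmax_Z w)%R | i <- iota 0 n].

(** The i-th largest of the numbers e^{-beta S}, recovered from the sorted normalised weights so
    that the sort is the one in [attn_sorted]; it is 0 from index [n] on. *)
Definition unnormalized (w : Om) (i : nat) : R :=
  (nth 0 (sort (fun a c : R => c <= a) (softmax w)) i * softmax_Z w)%R.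

Definition sample_count (w : Om) (y : R) : nat := (\sum_(i < n) (beta * S i w <= y)%R)%N.

Lemma softmax_Z_gt0 w : (0 < softmax_Z w)%R.
Proof.
rewrite /softmax_Z; case: n n0 => // m _; rewrite big_ord_recl ltr_pwDl ?expR_gt0//.
by apply: sumr_ge0 => i _; exact: expR_ge0.
Qed.

Lemma unnormalized_lim w : limn (fun N => \sum_(j < N) unnormalized w j)%R = softmax_Z w.
Proof.
have Z0 := softmax_Z_gt0 w.
set t := sort (fun a c : R => (c <= a)%R) (softmax w).
transitivity (\sum_(a <- [seq (a * softmax_Z w)%R | a <- t]) a)%R.
  rewrite -sum_nth_lim; congr (lim (_ @ \oo)); apply/funext => N.
  apply: eq_bigr => j _; rewrite /unnormalized -/t.
  have [jt|tj] := ltnP j (size t); first by rewrite (nth_map 0%R).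
  by rewrite !nth_default ?size_map// mul0r.
rewrite big_map -mulr_suml (perm_big _ (permEl (perm_sort _ _)))/= /softmax big_map.
rewrite -mulr_suml -[X in _ = X]mul1r; congr (_ * _)%R.
have -> : iota 0 n = index_iota 0 n by rewrite /index_iota subn0.
by rewrite big_mkord divff// gt_eqF.
Qed.

Lemma unnormalized_ge w y i : (expR (- y) <= unnormalized w i)%R = (i < sample_count w y)%N.
Proof.
have Z0 := softmax_Z_gt0 w.
rewrite /unnormalized -ler_pdivrMr// sort_ge_count ?divr_gt0 ?expR_gt0//.
rewrite /softmax count_map -sum1_count /sample_count big_mkcond/=; congr (_ < _)%N.
have -> : iota 0 n = index_iota 0 n by rewrite /index_iota subn0.
rewrite big_mkord; apply: eq_bigr => j _.
by rewrite ler_pM2r ?invr_gt0// ler_expR mulNr lerN2; case: (_ <= _)%R.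
Qed.

Lemma unnormalized_ge0_le1 w i : (forall j, (0 <= S j w)%R) -> (0 <= unnormalized w i <= 1)%R.
Proof.
move=> Sw; have Z0 := softmax_Z_gt0 w.
set t := sort (fun a c : R => (c <= a)%R) (softmax w).
rewrite /unnormalized -/t; have [it|ti] := ltnP i (size t); last first.
  by rewrite nth_default// mul0r lexx ler01.
have : nth 0%R t i \in softmax w by rewrite -(mem_sort (fun a c : R => (c <= a)%R)) mem_nth.
move=> /mapP[j _ ->]; rewrite divfK ?gt_eqF// expR_ge0 -expR0 ler_expR.
by rewrite mulNr oppr_le0 mulr_ge0// ltW.
Qed.

Let mle i t : measurable [set w | (S i w <= t)%R].
Proof.
have := @mS i measurableT _ (measurable_itv `]-oo, t]); rewrite setTI.
by congr measurable; apply/seteqP; split => w /=; rewrite in_itv.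
Qed.

Definition sample_countE (m : nat) (w : Om) : \bar R := (sample_count w m%:R)%:R%:E.

Let countE m w : sample_countE m w =
  \sum_(i < n) (\1_[set w | (S i w <= m%:R / beta)%R] w)%:E.
Proof.
rewrite /sample_countE /sample_count natr_sum -sumEFin; apply: eq_bigr => i _.
rewrite indicE; congr ((nat_of_bool _)%:R%:E).
by apply/idP/idP; rewrite inE/= ler_pdivlMr// mulrC.
Qed.

Lemma measurable_sample_countE m : measurable_fun setT (sample_countE m).
Proof.
rewrite (_ : sample_countE m = fun w => \sum_(i < n) (\1_[set w | (S i w <= m%:R / beta)%R] w)%:E);
  last by apply/funext => w; exact: countE.
apply: emeasurable_sum => i; apply/measurable_EFinP; exact: measurable_indic.
Qed.

Lemma integral_sample_countE m :
  \int[P]_w sample_countE m w = (n%:R * F (m%:R / beta))%:E.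
Proof.
under eq_integral do rewrite countE.
rewrite ge0_integral_sum//.
- rewrite (eq_bigr (fun=> (F (m%:R / beta))%:E)) => [|i _].
    by rewrite sumEFin sumr_const card_ord [in RHS]mulr_natl.
  rewrite -(SF i) (@integral_indic _ _ _ P setT measurableT _ (mle i _)).
  by congr (P _); exact: setIT.
- by move=> i; apply/measurable_EFinP; exact: measurable_indic.
Qed.

Section cells.
Variables (r J : nat).
Hypothesis r0 : (0 < r)%N.
Hypothesis J0 : (0 < J)%N.

Definition le_cell (j : nat) : set R :=
  if (j < J)%N then `]-oo, (j.+1%:R / r%:R / beta)%R]%classic else setT.

(** The number of right endpoints strictly below the scaled point, which is the index of its cell;
    the value [J] stands for everything beyond the grid. *)
Definition cell_index (i : nat) (w : Om) : nat :=
  (\sum_(l < J) (l.+1%:R / r%:R < beta * S i w)%R)%N.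

(** The value 1 from index [J] on makes the increment at [J] the mass beyond the grid. *)
Definition cell_cdf (j : nat) : R :=
  if (j < J)%N then F (j.+1%:R / r%:R / beta) else 1%R.

Definition cell_prob (j : nat) : R :=
  if j is j'.+1 then (cell_cdf j - cell_cdf j')%R else cell_cdf 0.

Let mle_cell j : measurable (le_cell j).
Proof. by rewrite /le_cell; case: ifP. Qed.

Let P_le_cell i j : P (S i @^-1` le_cell j) = (cell_cdf j)%:E.
Proof.
rewrite /le_cell /cell_cdf; case: ifP => _; last by rewrite preimage_setT probability_setT.
rewrite -(SF i); by congr (P _); apply/seteqP; split => w /=; rewrite in_itv.
Qed.

Let mS_pre i (A : set R) : measurable A -> measurable (S i @^-1` A).
Proof. by move=> mA; have := @mS i measurableT _ mA; rewrite setTI. Qed.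

Lemma cell_index_le i w j : (j < J)%N ->
  (cell_index i w <= j)%N = (beta * S i w <= j.+1%:R / r%:R)%R.
Proof.
move=> jJ; rewrite /cell_index; set x := (beta * S i w)%R.
have mono a b : (a <= b)%N -> (a.+1%:R / r%:R <= b.+1%:R / r%:R :> R)%R.
  by move=> ab; rewrite ler_wpM2r ?invr_ge0// ler_nat.
apply/idP/idP => h.
  rewrite leNgt; apply/negP => h2.
  have : (j.+1 <= \sum_(l < J) (l.+1%:R / r%:R < x)%R)%N.
    rewrite -{1}[j.+1](minn_idPr jJ) -sum_ltn_minn leq_sum// => l _.
    case: ltnP => // lj; rewrite (le_lt_trans _ h2)//.
    by apply: mono; rewrite -ltnS.
  by rewrite leqNgt ltnS h.
have -> : j = (\sum_(l < J) (l < j)%N)%N :> nat by rewrite sum_ltn_minn (minn_idPr (ltnW jJ)).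
apply: leq_sum => l _; case: (ltnP l j) => // jl; first by case: (_ < _)%R.
by rewrite ltNge (le_trans h)// mono.
Qed.

Lemma cell_index_leJ i w : (cell_index i w <= J)%N.
Proof.
rewrite [X in (_ <= X)%N](_ : J = (\sum_(l < J) 1)%N); last by rewrite sum1_card card_ord.
by apply: leq_sum => l _; case: (_ < _)%R.
Qed.

Let cell_index_leE i w j : (cell_index i w <= j)%N <-> le_cell j (S i w).
Proof.
rewrite /le_cell; case: ltnP => jJ.
  by rewrite cell_index_le//= in_itv/= (ler_pdivlMr _ _ beta0) (mulrC beta).
by split=> // _; exact: leq_trans (cell_index_leJ _ _) jJ.
Qed.

Let cell (j : nat) : set R := if j is j'.+1 then le_cell j `\` le_cell j' else le_cell 0.

Let mcell j : measurable (cell j).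
Proof. by case: j => [|j] //=; apply: measurableD. Qed.

Let cell_indexE i j : [set w | cell_index i w = j] = S i @^-1` cell j.
Proof.
apply/seteqP; split => w /=.
  move=> <-; case e: (cell_index i w) => [|j'] /=; first by apply/cell_index_leE; rewrite e.
  by split; [apply/cell_index_leE|move/cell_index_leE]; rewrite e// ltnn.
case: j => [/cell_index_leE|j /= [/cell_index_leE h1 h2]].
  by rewrite leqn0 => /eqP.
apply/eqP; rewrite eqn_leq h1/= ltnNge; apply/negP => /cell_index_leE; exact: h2.
Qed.

Let P_cell i j : P (S i @^-1` cell j) = (cell_prob j)%:E.
Proof.
case: j => [|j] /=; first exact: P_le_cell.
have sub : S i @^-1` le_cell j.+1 `&` S i @^-1` le_cell j = S i @^-1` le_cell j.
  by apply: setIidr => w /= /cell_index_leE h; apply/cell_index_leE; exact: leqW.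
have fin : P (S i @^-1` le_cell j.+1) < +oo by rewrite P_le_cell ltry.
rewrite EFinB -!(P_le_cell i) -sub.
exact: (measureD (mS_pre i (mle_cell j.+1)) (mS_pre i (mle_cell j)) fin).
Qed.

Lemma cell_prob_ge0 j : (0 <= cell_prob j)%R.
Proof. by rewrite -lee_fin -(P_cell 0). Qed.

Lemma cell_prob_last : cell_prob J = (1 - \sum_(j < J) cell_prob j)%R.
Proof.
have h j : (\sum_(l < j.+1) cell_prob l = cell_cdf j)%R.
  by elim: j => [|j IH]; rewrite big_ord_recr/= ?big_ord0 ?add0r// IH addrC subrK.
have e : (\sum_(j < J) cell_prob j = cell_cdf J.-1)%R by rewrite -h prednK.
have : (cell_prob J.-1.+1 = cell_cdf J.-1.+1 - cell_cdf J.-1)%R by [].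
by rewrite prednK// e => ->; rewrite {1}/cell_cdf ltnn.
Qed.

Let mindex i k : measurable [set w | cell_index i w = k].
Proof. by rewrite cell_indexE; exact: mS_pre. Qed.

Lemma cell_cylinder Jl a : uniq Jl ->
  P (cylinder cell_index Jl a) = (\prod_(i <- Jl) cell_prob (a i))%:E.
Proof.
move=> uJ; rewrite /cylinder.
rewrite (eq_bigcapr (G := fun i => S i @^-1` cell (a i))); last by move=> i _; exact: cell_indexE.
rewrite indS// -prodEFin; apply: eq_bigr => i _; exact: P_cell.
Qed.

Lemma cell_count_prob m :
  P (@count_event d Om J cell_index n m) = (multinom_pmf cell_prob n m)%:E.
Proof. by apply: count_event_prob => //; [exact: cell_index_leJ|exact: cell_cylinder]. Qed.

Lemma measurable_cell_count_event m : measurable (@count_event d Om J cell_index n m).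
Proof. exact: measurable_count_event. Qed.

Lemma sample_count_cumul w m : @count_event d Om J cell_index n m w ->
  forall j, (j < J)%N -> sample_count w (j.+1%:R / r%:R) = cumul m j.
Proof.
move=> h j jJ; rewrite /sample_count /cumul.
under [RHS]eq_bigr do rewrite -h.
rewrite exchange_big/=; apply: eq_bigr => i _.
rewrite -cell_index_le//; case: leqP => hij.
  have cJ : (cell_index i w < J)%N by exact: leq_ltn_trans jJ.
  rewrite (bigD1 (Ordinal cJ))//= eqxx big1// => l /andP[_ /eqP lc].
  by case: eqP => // e; exfalso; apply: lc; apply: val_inj.
rewrite big1// => l lj; case: eqP => // e.
by move: hij; rewrite e ltnNge lj.
Qed.

End cells.

(** Negative values are excluded only almost surely: for [S i w = T_ q (x i w)], the vector may
    leave the sphere on a null event. *)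
Let Null := \bigcup_i [set w | (S i w < 0)%R].

Let mlt i : measurable [set w | (S i w < 0)%R].
Proof.
have := @mS i measurableT _ (measurable_itv `]-oo, 0%R[); rewrite setTI.
by congr measurable; apply/seteqP; split => w /=; rewrite in_itv.
Qed.

Lemma sample_side k (f : 'rV[R]_k -> R) B eps delta eta D (r M L dim : nat)
    (s : seq {ffun 'I_(M * r) -> nat}) :
  (forall v, `|f v| <= B)%R -> (0 <= eps)%R -> unif_on_box f delta eps ->
  (0 < r)%N -> (0 < L)%N -> (L <= M)%N -> (0 < eta)%R ->
  ((1 - expR (- r%:R^-1)) + eta * expR L%:R <= delta)%R -> (0 <= D)%R ->
  (forall m, n%:R * F (m.+1%:R / beta) <= D * m.+1%:R ^+ dim)%R ->
  uniq s -> (forall m, m \in s -> (0 < cumul m (L * r).-1)%N) ->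
  exists2 v : R, \int[P]_w (f (\row_(i < k) nth 0 (sort (fun a c : R => c <= a) (softmax w)) i)%R)%:E = v%:E &
  (`|v - \sum_(m <- s) f (cell_weights k r m) * multinom_pmf (cell_prob r (M * r)) n m| <=
   2 * eps + 4 * B * (D / eta * (tail_const dim * expR (- 2^-1) ^+ M) +
                      (1 - \sum_(m <- s) multinom_pmf (cell_prob r (M * r)) n m)))%R.
Proof.
move=> fB eps0 uf r0 L0 LM eta0 hd D0 hD us sL.
have J0 : (0 < M * r)%N by rewrite muln_gt0 r0 andbT (leq_trans L0).
have mNull : measurable Null by exact: bigcupT_measurable.
have PNull : P Null = 0.
  apply/eqP; rewrite -measure_le0.
  apply: (@le_trans _ _ (\sum_(i <oo) P [set w | (S i w < 0)%R])); last by rewrite eseries0.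
  by apply: measure_sigma_subadditive => //.
have b01 w : ~ Null w -> forall i, (0 <= unnormalized w i <= 1)%R.
  move=> nw i; apply: unnormalized_ge0_le1 => j; rewrite leNgt; apply/negP => hj.
  by apply: nw; exists j.
have bK w : ~ Null w -> forall y i, (0 <= y)%R ->
  (expR (- y) <= unnormalized w i)%R = (i < sample_count w y)%N.
  by move=> _ y i _; exact: unnormalized_ge.
have Kc0 m w : 0 <= sample_countE m w by rewrite /sample_countE lee_fin.
have KcE w : ~ Null w -> forall m, sample_countE m w = (sample_count w m%:R)%:R%:E by [].
have eKc m : \int[P]_w sample_countE m.+1 w <= (D * m.+1%:R ^+ dim)%:E.
  by rewrite integral_sample_countE lee_fin.
pose E := @count_event d Om (M * r) (cell_index r (M * r)) n.
have mE m : measurable (E m) by exact: measurable_cell_count_event.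
have dE m1 m2 w : E m1 w -> E m2 w -> m1 = m2.
  by move=> h1 h2; apply/ffunP => j; rewrite -h1 -h2.
have EK w m : ~ Null w -> E m w ->
  forall j, (j < M * r)%N -> sample_count w (j.+1%:R / r%:R) = cumul m j.
  by move=> _; exact: sample_count_cumul.
have [v fv hv] := one_side_bound fB eps0 uf r0 L0 LM eta0 hd D0 mNull PNull b01 bK
  measurable_sample_countE Kc0 KcE eKc mE dE EK us sL.
exists v.
  rewrite -fv; apply: eq_integral => w _; congr (f _)%:E; apply/rowP => i.
  by rewrite !mxE unnormalized_lim /unnormalized mulfK// gt_eqF// softmax_Z_gt0.
have pE m : fine (P (E m)) = multinom_pmf (cell_prob r (M * r)) n m.
  by rewrite /E cell_count_prob.
by under eq_bigr do rewrite -pE; under [X in (1 - X)%R]eq_bigr do rewrite -pE.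
Qed.

End sample.

(** * The common estimate for the Poisson process *)

Section poisson_side.
Local Open Scope ereal_scope.
Context d (Om : measurableType d) (R : realType) (P : probability Om R).
Variables (Lam : {measure set R -> \bar R}) (N : Om -> {measure set R -> \bar R}).
Variables (Y : Om -> nat -> R) (G : R -> R).
Hypothesis ppp : is_PPP P N Lam.
Hypothesis LamE : forall y : R, (0 <= y)%R -> Lam `[0%R, y]%classic = (G y)%:E.
Hypothesis Lam0 : Lam `]-oo, 0%R[%classic = 0.
Hypothesis hY : {ae P, forall w, atoms_increasing (N w) (Y w)}.

Lemma ppp_side k (f : 'rV[R]_k -> R) B eps delta eta D (r M L dim : nat)
    (s : seq {ffun 'I_(M * r) -> nat}) :
  (forall v, `|f v| <= B)%R -> (0 <= eps)%R -> unif_on_box f delta eps ->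
  (0 < r)%N -> (0 < L)%N -> (L <= M)%N -> (0 < eta)%R ->
  ((1 - expR (- r%:R^-1)) + eta * expR L%:R <= delta)%R -> (0 <= D)%R ->
  (forall m, G m.+1%:R <= D * m.+1%:R ^+ dim)%R ->
  uniq s -> (forall m, m \in s -> (0 < cumul m (L * r).-1)%N) ->
  exists2 v : R, \int[P]_w (f (W_vec k (Y w)))%:E = v%:E &
  (`|v - \sum_(m <- s) f (cell_weights k r m) * \prod_(j < M * r) poisson_p (cell_mass G r j) (m j)| <=
   2 * eps + 4 * B * (D / eta * (tail_const dim * expR (- 2^-1) ^+ M) +
     (1 - \sum_(m <- s) \prod_(j < M * r) poisson_p (cell_mass G r j) (m j))))%R.
Proof.
move=> fB eps0 uf r0 L0 LM eta0 hd D0 hD us sL.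
have [Null [mNull PNull hat hfin]] := ppp_null ppp LamE Lam0 hY.
have b01 w : ~ Null w -> forall i, (0 <= expR (- Y w i) <= 1)%R.
  move=> /hat nw i; rewrite expR_ge0 -expR0 ler_expR oppr_le0 ltW//.
  exact: (ppp_atom_gt0 nw).
have bK w : ~ Null w -> forall y i, (0 <= y)%R ->
  (expR (- y) <= expR (- Y w i))%R = (i < ppp_count N w y)%N.
  by move=> nw y i _; rewrite ler_expR lerN2 (ppp_countP (hat _ nw) (hfin _ nw)).
have mN m : measurable_fun setT (fun w => N w `]-oo, (m%:R : R)]%classic).
  by case: ppp => _ mN _ _ _; exact: mN.
have KcE w : ~ Null w -> forall m, N w `]-oo, (m%:R : R)]%classic = (ppp_count N w m%:R)%:R%:E.
  by move=> nw m; exact: (ppp_countE (hat _ nw) (hfin _ nw)).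
have eKc m : \int[P]_w N w `]-oo, (m.+1%:R : R)]%classic <= (D * m.+1%:R ^+ dim)%:E.
  by apply: (le_trans (ppp_mean ppp LamE Lam0 _)); rewrite lee_fin.
have mE m : measurable (@ppp_event _ _ _ N r (M * r) m) by exact: (measurable_ppp_event ppp).
have EK w (m : {ffun 'I_(M * r) -> nat}) : ~ Null w -> ppp_event N r m w ->
  forall j, (j < M * r)%N -> ppp_count N w (j.+1%:R / r%:R) = cumul m j.
  by move=> nw h j jJ; exact: ppp_count_cumul.
have [v fv hv] := one_side_bound fB eps0 uf r0 L0 LM eta0 hd D0 mNull PNull b01 bK
  mN (fun m w => measure_ge0 _ _) KcE eKc mE (@ppp_event_disj _ _ _ N r (M * r)) EK us sL.
exists v; first exact: fv.
have pE (m : {ffun 'I_(M * r) -> nat}) : fine (P (ppp_event N r m)) =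
    (\prod_(j < M * r) poisson_p (cell_mass G r j) (m j))%R.
  by rewrite (ppp_event_prob ppp LamE Lam0).
by under eq_bigr do rewrite -pE; under [X in (1 - X)%R]eq_bigr do rewrite -pE.
Qed.

End poisson_side.

(** * Convergence of the sorted weights for one-dimensional samples *)

Section softmax_limit.
Context d (Om : measurableType d) (R : realType) (P : probability Om R).
Context d' (Om' : measurableType d') (P' : probability Om' R).
Variables (S : nat -> Om -> R) (F : R -> R) (p C : R) (beta : nat -> R) (gamma : R).
Variables (Lam : {measure set R -> \bar R}) (N : Om' -> {measure set R -> \bar R}).
Variables (Y : Om' -> nat -> R).
Hypothesis mS : forall i, measurable_fun setT (S i).
Hypothesis SF : forall i t, P [set w | S i w <= t] = (F t)%:E.
Hypothesis S0 : forall i, P [set w | S i w < 0] = 0%E.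
Hypothesis indS : forall Jl (B : nat -> set R), uniq Jl -> (forall j, measurable (B j)) ->
  P (\bigcap_(j in [set j | j \in Jl]) (S j @^-1` B j)) = (\prod_(j <- Jl) P (S j @^-1` B j))%E.
Hypothesis p0 : 0 < p.
Hypothesis C0 : 0 < C.
Hypothesis FC : F t / t `^ p @[t --> 0^'+] --> C.
Hypothesis beta0 : forall n, 0 < beta n.
Hypothesis gamma0 : 0 < gamma.
Hypothesis cbeta : beta n * n%:R `^ (- p^-1) @[n --> \oo] --> gamma.
Let G y := C * (y / gamma) `^ p.
Hypothesis ppp : is_PPP P' N Lam.
Hypothesis LamE : forall y : R, 0 <= y -> Lam `[0, y]%classic = (G y)%:E.
Hypothesis Lam0 : Lam `]-oo, 0[%classic = 0%E.
Hypothesis hY : {ae P', forall w, atoms_increasing (N w) (Y w)}.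

Let F01 t : 0 <= F t <= 1.
Proof.
have mle : measurable [set w | S 0%N w <= t].
  have := @mS 0%N measurableT _ (measurable_itv `]-oo, t]); rewrite setTI.
  by congr measurable; apply/seteqP; split => w /=; rewrite in_itv.
by rewrite -!lee_fin -(SF 0%N) measure_ge0 probability_le1.
Qed.

Let beta0' n : (0 < n)%N -> 0 < beta n. Proof. by []. Qed.

Lemma intensity_unbounded e : 0 < e -> exists2 L : nat, (0 < L)%N & expR (- G L%:R) <= e.
Proof.
move=> e0; pose x := Num.max 0 (- ln e).
have x0 : 0 <= x by rewrite le_max lexx.
(* The solution of [G y = x], to be rounded up to an integer. *)
pose y := gamma * (x / C) `^ p^-1.
have y0 : 0 <= y by rewrite mulr_ge0 ?powR_ge0// ltW.
exists (Num.truncn y).+1 => //.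
have yL : y <= (Num.truncn y).+1%:R by rewrite ltW// truncnS_gt.
have Gy : G y = x.
  rewrite /G /y mulrAC divff ?gt_eqF// mul1r -powRrM mulVf ?gt_eqF//.
  by rewrite powRr1 ?divr_ge0 ?(ltW C0)// mulrC divfK// gt_eqF.
have : x <= G (Num.truncn y).+1%:R.
  rewrite -Gy /G ler_pM2l// ge0_ler_powR ?nnegrE ?divr_ge0 ?(ltW p0) ?(ltW gamma0)//.
  by rewrite ler_pM2r ?invr_gt0.
move=> h; apply: (@le_trans _ _ (expR (- x))); first by rewrite ler_expR lerN2.
rewrite -[leRHS]lnK ?posrE// ler_expR lerNl.
by rewrite le_max lexx orbT.
Qed.

Lemma cell_prob_cvg r J (j : 'I_J) : (0 < r)%N ->
  n%:R * cell_prob F (beta n) r J j @[n --> \oo] --> cell_mass G r j.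
Proof.
move=> r0; have r0' : (0 : R) < r%:R by rewrite ltr0n.
have cdf i : (i < J)%N ->
    n%:R * cell_cdf F (beta n) r J i @[n --> \oo] --> G (i.+1%:R / r%:R).
  move=> iJ; rewrite /cell_cdf iJ.
  by apply: (scaled_cvg p0 FC beta0' gamma0 cbeta); rewrite divr_gt0.
have jJ := ltn_ord j; rewrite /cell_mass; case: (nat_of_ord j) jJ => [|i] iJ /=.
  by have := cdf _ iJ; rewrite div1r.
rewrite [X in X @ _ --> _](_ : _ = fun n => n%:R * cell_cdf F (beta n) r J i.+1 -
   n%:R * cell_cdf F (beta n) r J i); last by apply/funext => n; rewrite mulrBr.
by apply: cvgB; [exact: cdf|apply: cdf; exact: ltnW].
Qed.

Lemma count_pmf_cvg r J (m : {ffun 'I_J -> nat}) : (0 < r)%N -> (0 < J)%N ->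
  multinom_pmf (cell_prob F (beta n) r J) n m @[n --> \oo] -->
  \prod_(j < J) poisson_p (cell_mass G r j) (m j).
Proof.
move=> r0 J0; apply: (@multinom_pmf_cvg _ _ (fun n => cell_prob F (beta n) r J)
    (fun j : 'I_J => cell_mass G r j)).
- by move=> n j; exact: (cell_prob_ge0 mS SF).
- by move=> n; exact: cell_prob_last.
- by move=> j; exact: cell_prob_cvg.
Qed.

(** All parameters [delta], [L], [r], [eta], [M] and the family [s] are fixed before [n]. The
    constant adds up [2 * e + 4 * B * (e + 3 * e)] from the sample, [2 * e + 4 * B * (e + 2 * e)]
    from the Poisson process, and [e] from comparing the two finite sums. The sample misses one more
    [e] of probability than the process because its count probabilities only converge. *)
Lemma softmax_limit_eps k (f : 'rV[R]_k -> R) B e : continuous f ->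
  (forall v, `|f v| <= B) -> 0 < e ->
  exists2 v', (\int[P']_w (f (W_vec k (Y w)))%:E = v'%:E)%E &
  \forall n \near \oo, exists2 v,
    (\int[P]_w (f (\row_(i < k)
       nth 0 (sort (fun a c : R => c <= a) (softmax S n (beta n) w)) i)%R)%:E = v%:E)%E &
    `|v - v'| <= (5 + 28 * B) * e.
Proof.
move=> cf fB e0.
have B0 : 0 <= B by exact: le_trans (fB 0).
have [delta delta0 uf] := unif_on_box_continuous cf e0.
have [L L0 GL] := intensity_unbounded e0.
(* The tolerance is split in halves: 1 - e^{-1/r} <= 1/r <= delta/2, and [eta * expR L%:R] equals
   [delta / 2]. *)
pose r := (Num.truncn (2 / delta)).+1.
have r0 : (0 < r)%N by [].
pose eta := delta / 2 / expR L%:R.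
have eta0 : 0 < eta by rewrite !divr_gt0// expR_gt0.
have hdelta : (1 - expR (- r%:R^-1)) + eta * expR L%:R <= delta.
  rewrite /eta divfK ?gt_eqF ?expR_gt0//.
  suff : r%:R^-1 <= delta / 2 by have := expR_ge1Dx (- (r%:R^-1 : R)); lra.
  rewrite -[leRHS]invrK lef_pV2 ?posrE ?invr_gt0 ?divr_gt0// invf_div.
  by rewrite ltW// truncnS_gt.
have [D1 D10 hD1] := scaled_bound F01 p0 FC beta0' gamma0 cbeta.
(* One constant for both sides: [D1] dominates the sample means, and the other summand is the
   coefficient of y^p in [G]. *)
pose D := D1 + C * gamma^-1 `^ p.
have D2 : 0 <= C * gamma^-1 `^ p by rewrite mulr_ge0 ?powR_ge0// ltW.
have D0 : 0 <= D by rewrite addr_ge0// ltW.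
(* An integer exponent above [p], as the tail estimate uses natural powers; it dominates [p] because
   the bases are at least 1. *)
pose dim := (Num.truncn p).+1.
have pow_dim m : (m.+1%:R : R) `^ p <= m.+1%:R ^+ dim.
  rewrite -powR_mulrn// ler_powR ?ler1n// ltW// truncnS_gt//.
have GD m : G m.+1%:R <= D * m.+1%:R ^+ dim.
  rewrite /G powRM ?invr_ge0 ?(ltW gamma0)// mulrCA mulrC.
  apply: (@le_trans _ _ (C * gamma^-1 `^ p * m.+1%:R ^+ dim)); first by rewrite ler_wpM2l.
  by rewrite ler_wpM2r ?exprn_ge0// lerDr ltW.
have [M LM hM] : exists2 M, (L <= M)%N &
    D / eta * (tail_const dim * expR (- 2^-1) ^+ M) <= e.
  have /cvgrPdist_le/(_ e e0)[M0 _ hM0] := tail_const_cvg dim (D / eta).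
  exists (maxn L M0); first exact: leq_maxl.
  have := hM0 _ (leq_maxr L M0); rewrite sub0r normrN; exact: le_trans (ler_norm _).
have [s [us sL hs]] := ppp_cover ppp LamE Lam0 e0 r0 L0 LM GL.
pose J := (M * r)%N; have J0 : (0 < J)%N by rewrite muln_gt0 r0 andbT (leq_trans L0).
pose p' (m : {ffun 'I_J -> nat}) := \prod_(j < J) poisson_p (cell_mass G r j) (m j).
pose pn n (m : {ffun 'I_J -> nat}) := multinom_pmf (cell_prob F (beta n) r J) n m.
pose psi m := f (@cell_weights R k r J m).
have hs' : 1 - \sum_(m <- s) p' m <= 2 * e.
  by apply: le_trans hs; rewrite lerD2l lerN2; apply: ler_sum => m _;
    rewrite (ppp_event_prob ppp LamE Lam0).
have [v' fv' hv'] := ppp_side ppp LamE Lam0 hY fB (ltW e0) uf r0 L0 LM eta0 hdelta D0 GD us sL.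
exists v'; first exact: fv'.
have c1 : \sum_(m <- s) pn n m @[n --> \oo] --> \sum_(m <- s) p' m.
  apply: cvg_big => [|m _]; [exact: add_continuous|exact: count_pmf_cvg].
have c2 : \sum_(m <- s) psi m * pn n m @[n --> \oo] --> \sum_(m <- s) psi m * p' m.
  apply: cvg_big => [|m _]; first exact: add_continuous.
  by apply: cvgM; [exact: cvg_cst|exact: count_pmf_cvg].
move/cvgrPdist_le : c1 => /(_ e e0) c1; move/cvgrPdist_le : c2 => /(_ e e0) c2.
near=> n.
have n0 : (0 < n)%N by near: n; exact: nbhs_infty_gt.
have hD m : n%:R * F (m.+1%:R / beta n) <= D * m.+1%:R ^+ dim.
  have hn : forall y, 0 < y -> n%:R * F (y / beta n) <= D1 * y `^ p by near: n.
  apply: (le_trans (hn _ (ltr0Sn _ _))).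
  apply: (@le_trans _ _ (D1 * m.+1%:R ^+ dim)); first by rewrite ler_pM2l.
  by rewrite ler_wpM2r ?exprn_ge0// lerDl.
have [v fv hv] := sample_side mS SF S0 indS n0 (beta0 n) fB (ltW e0) uf r0 L0 LM eta0
  hdelta D0 hD us sL.
exists v; first exact: fv.
have d1 : `|\sum_(m <- s) p' m - \sum_(m <- s) pn n m| <= e by near: n.
have d2 : `|\sum_(m <- s) psi m * p' m - \sum_(m <- s) psi m * pn n m| <= e by near: n.
rewrite -/J -/(psi _) in hv hv'.
have hv2 : `|v - \sum_(m <- s) psi m * pn n m| <= 2 * e + 4 * B * (e + 3 * e).
  apply: (le_trans hv); rewrite lerD2l ler_wpM2l ?mulr_ge0//.
  apply: lerD => //; move: d1 hs'; rewrite ler_norml => /andP[_].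
  by rewrite /pn; lra.
have hv3 : `|v' - \sum_(m <- s) psi m * p' m| <= 2 * e + 4 * B * (e + 2 * e).
  by apply: (le_trans hv'); rewrite lerD2l ler_wpM2l ?mulr_ge0// lerD.
move: hv2 hv3 d2; rewrite !ler_norml => /andP[h1 h2] /andP[h3 h4] /andP[h5 h6].
by apply/andP; split; lra.
Unshelve. all: by end_near.
Qed.

Theorem softmax_limit k (f : 'rV[R]_k -> R) : continuous f ->
  (exists M : R, forall v, `|f v| <= M) ->
  (fun n => \int[P]_w (f (\row_(i < k)
       nth 0 (sort (fun a c : R => (c <= a)%R) (softmax S n (beta n) w)) i)%R)%:E)%E @ \oo -->
  (\int[P']_w (f (W_vec k (Y w)))%:E)%E.
Proof.
move=> cf [B fB].
have B0 : 0 <= B by exact: le_trans (fB 0).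
(* A first use with tolerance 1 only shows that the limit integral is finite; later uses return the
   same value. *)
have [v' fv' _] := softmax_limit_eps cf fB ltr01.
have key e : 0 < e -> \forall n \near \oo, exists2 v,
    (\int[P]_w (f (\row_(i < k)
       nth 0 (sort (fun a c : R => c <= a) (softmax S n (beta n) w)) i)%R)%:E = v%:E)%E &
    `|v - v'| <= e.
  move=> e0; have A0 : 0 < 5 + 28 * B by lra.
  have [v'' fv'' h] := softmax_limit_eps cf fB (divr_gt0 e0 A0).
  move: fv''; rewrite fv' => -[->]; apply: filterS h => n [v fv hv].
  by exists v => //; move: hv; rewrite mulrC divfK// gt_eqF.
rewrite fv'; apply/fine_cvgP; split.
  by apply: filterS (key _ ltr01) => n [v -> _].
apply/cvgrPdist_le => e e0; apply: filterS (key _ e0) => n [v ev hv].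
by rewrite /= ev /= distrC.
Qed.

End softmax_limit.

(** * Positivity of the limiting constant *)

Section density_constant.
Local Open Scope ereal_scope.
Context {R : realType}.
Notation mu := (@lebesgue_measure R).
Notation RR := (measurableTypeR R).

Lemma cube_vol_ge1 m :
  1 <= iter_leb_int m (fun v : nat -> R => ereal_of_bool [forall i : 'I_m, (0 < v i <= 1)%R]).
Proof.
elim: m => [|m IH] /=.
  by rewrite /ereal_of_bool ifT//; apply/forallP => -[].
have -> : 1 = \int[mu]_t (\1_(`]0%R, 1%R] : set R) t)%:E :> \bar R.
  transitivity (mu (`]0%R, 1%R] : set RR)); last by rewrite integral_indic// setIT.
  by rewrite lebesgue_measure_itv/= lte_fin ltr01 oppr0 adde0.
apply: ge0_le_integral_nonmeas => t; first by rewrite lee_fin.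
rewrite indicE; case: (boolP (t \in _)) => ht /=; last first.
  by apply: iter_leb_int_ge0 => v; exact: ereal_of_bool_ge0.
apply: (le_trans IH); apply: le_iter_leb_int => v; first exact: ereal_of_bool_ge0.
apply: le_ereal_of_bool => /forallP h; apply/forallP => i.
case: eqP => im; first by move: ht; rewrite inE/= in_itv.
have iltm : (i < m)%N by rewrite ltn_neqAle -ltnS ltn_ord andbT; apply/eqP.
exact: h (Ordinal iltm).
Qed.

(** The ball of radius n+1 contains the cube with sides []0, 1]], of volume at least 1, and scaling
    relates it to the unit ball. A positive [C] is what makes the intensity unbounded. *)
Lemma ball_vol_gt0 n : (0 < fine (ball_vol n.+1 1 : \bar R))%R.
Proof.
rewrite lt_neqAle fine_ge0 ?ball_vol_ge0// andbT eq_sym; apply/negP => /eqP h0.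
have : 1 <= ball_vol n.+1 (n.+1%:R ^+ 2 : R)%R.
  apply: (le_trans (cube_vol_ge1 n.+1)).
  apply: le_iter_leb_int => v; first exact: ereal_of_bool_ge0.
  apply: le_ereal_of_bool => /forallP h; apply/andP; split.
    rewrite /sumsq big_ord_recl ltr_pwDl ?sumr_ge0// => [|i _]; last exact: sqr_ge0.
    by rewrite exprn_gt0//; have /andP[] := h ord0.
  apply: (@le_trans _ _ n.+1%:R); last by rewrite expr2 ler_peMr// ler1n.
  rewrite -{2}[n.+1]card_ord -sum1_card natr_sum; apply: ler_sum => i _.
  by have /andP[v0 v1] := h i; rewrite exprn_ile1// ltW.
by rewrite ball_vol_scale// -(fineK (ball_vol_fin _)) h0 mule0 lee_fin ler10.
Qed.

End density_constant.

(** * The map [T_] on the sphere and its Borel preimages *)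

Section borel.
Context {R : realType}.

Lemma borel_preimage d (g : 'rV[R]_d -> R) (B : set R) :
  continuous g -> measurable B -> borel_rV (g @^-1` B).
Proof.
move=> cg mB; rewrite /borel_rV; pose O : set (set 'rV[R]_d) := [set A | open A]; rewrite -/O.
have mg : measurable_fun setT (g : g_sigma_algebraType O -> R).
  apply: (measurability _ (RGenOpens.measurableE R)).
  move=> _ [_ [a [b ->] <-]]; rewrite setTI; apply: sub_sigma_algebra.
  by apply: open_comp => [x _|]; [exact: cg|exact: interval_open].
by have := mg measurableT _ mB; rewrite setTI.
Qed.

Lemma continuous_T d (q : 'rV[R]_d) : continuous (T_ q).
Proof.
have h : continuous (fun y : 'rV[R]_d => \sum_(i < d) q 0 i * y 0 i).
  apply: continuous_big => [|i _ y]; first exact: add_continuous.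
  exact: (continuousM (@cst_continuous _ _ (q 0 i) y) (@coord_continuous _ _ _ 0 i y)).
by move=> x; exact: (continuousB (@cst_continuous _ _ (1 : R) x) (h x)).
Qed.

Lemma T_ge0 d (q y : 'rV[R]_d) : sphere q -> sphere y -> 0 <= T_ q y.
Proof.
move=> q1 y1.
have e (z : 'rV[R]_d) : sphere z -> dotp z z = 1 by rewrite -enorm_sq => ->; rewrite expr1n.
have : 0 <= \sum_(i < d) (q 0 i - y 0 i) ^+ 2 by apply: sumr_ge0 => i _; exact: sqr_ge0.
have -> : \sum_(i < d) (q 0 i - y 0 i) ^+ 2 = dotp q q + dotp y y - 2 * dotp q y.
  rewrite /dotp mulr_sumr -big_split -sumrB/=; apply: eq_bigr => i _; ring.
by rewrite !e// /T_; lra.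
Qed.

Lemma sphere_int_eq0 d (g : 'rV[R]_d -> R) : (forall y, sphere y -> g y = 0) ->
  sphere_int g = 0%E.
Proof.
move=> g0; rewrite /sphere_int (_ : cone_integrand g = fun=> 0%E); last first.
  apply/funext => x; rewrite /cone_integrand; case: ifP => // /andP[x0 _].
  rewrite g0// /sphere /= -[RHS](mulVf (lt0r_neq0 x0)).
  rewrite /enorm dotpZr; have -> : dotp ((enorm x)^-1 *: x) x = dotp x ((enorm x)^-1 *: x).
    by apply: eq_bigr => i _; exact: mulrC.
  rewrite dotpZr mulrA -expr2 sqrtrM ?sqr_ge0// sqrtr_sqr ger0_norm ?invr_ge0 ?ltW//.
by rewrite /leb_int iter_leb_int0 mule0.
Qed.

End borel.

(** * Passage from random points on the sphere to the real variables [T_ q (x i)] *)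

Unset Implicit Arguments.

Theorem mainTheorem2 (R : realType) (d : nat) (q : 'rV[R]_d) (rho : 'rV[R]_d -> R)
  (dO : measure_display) (Om : measurableType dO) (P : probability Om R)
  (x : nat -> Om -> 'rV[R]_d) (beta : nat -> R) (gamma : R)
  (dO' : measure_display) (Om' : measurableType dO') (P' : probability Om' R)
  (Lam : {measure set R -> \bar R}) (N : Om' -> {measure set R -> \bar R})
  (Y : Om' -> nat -> R) (k : nat) :
  (2 <= d)%N ->
  sphere q ->
  C2_density_on_sphere rho ->
  0 < rho q ->
  iid_law_density P x rho ->
  (forall n, (0 < n)%N -> 0 < beta n) ->
  0 < gamma ->
  let alpha : R := 2 / (d.-1)%:R in
  (fun n : nat => beta n * (n%:R) `^ (- alpha)) @ \oo --> gamma ->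
  let C : R := 2 `^ (alpha^-1) * sphere_area R d.-1 / (d.-1)%:R * rho q in
  (forall y : R, 0 <= y -> Lam `[0, y]%classic = (C * (y / gamma) `^ (alpha^-1))%:E) ->
  Lam `]-oo, 0[%classic = 0%E ->
  is_PPP P' N Lam ->
  {ae P', forall w, atoms_increasing (N w) (Y w)} ->
  (0 < k)%N ->
  cvg_in_distribution P (fun n w => top_attn k q (beta n) n (fun i => x i w))
                      P' (fun w => W_vec k (Y w)).
Proof.
case: d q rho x => [|[|d]] q rho x // _ q1 [rho0 _ rhoC2] rhoq [mx lawx indx] beta0 gamma0 alpha
  cbeta C LamE Lam0 ppp hY _ f cf fB.
(* Regularity is stated for the homogeneous extension away from the origin, and [q] is not the
   origin because its norm is 1. *)
have crho : {for q, continuous (hom_ext rho)}.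
  suff /rhoC2[] : q != 0 by [].
  apply/eqP => q0; move: q1; rewrite /sphere /= q0 => /eqP.
  rewrite /enorm /dotp big1 ?sqrtr0 ?(eq_sym 0) ?oner_eq0// => i _.
  by rewrite mxE mul0r.
have alphaV : alpha^-1 = d.+1%:R / 2 by rewrite invf_div.
have p0 : 0 < alpha^-1 by rewrite alphaV divr_gt0.
pose S i w := T_ q (x i w).
have bT (B : set R) : measurable B -> borel_rV (T_ q @^-1` B).
  by move=> mB; apply: borel_preimage => //; exact: continuous_T.
have bTle t : borel_rV [set y | T_ q y <= t].
  have := bT _ (measurable_itv `]-oo, t]).
  by congr borel_rV; apply/seteqP; split => y /=; rewrite in_itv.
have bTlt : borel_rV [set y | T_ q y < 0].
  have := bT _ (measurable_itv `]-oo, 0[).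
  by congr borel_rV; apply/seteqP; split => y /=; rewrite in_itv.
have mS i : measurable_fun setT (S i).
  by move=> _ B mB; rewrite setTI; exact: (mx i _ (bT _ mB)).
pose F t := fine (cap_law q rho t).
have SF i t : P [set w | S i w <= t] = (F t)%:E.
  by rewrite /F /cap_law -(lawx i _ (bTle t)) fineK// fin_num_measure//; exact: mx (bTle t).
(* The surface integral only evaluates its integrand on the sphere, where [T_] is nonnegative. *)
have S0 i : P [set w | S i w < 0] = 0%E.
  rewrite (lawx i _ bTlt) sphere_int_eq0// => y y1.
  rewrite indicE memNset ?mul0r//= => /lt_geF; rewrite T_ge0//.
have indS Jl (B : nat -> set R) : uniq Jl -> (forall j, measurable (B j)) ->
    P (\bigcap_(j in [set j | j \in Jl]) (S j @^-1` B j)) = (\prod_(j <- Jl) P (S j @^-1` B j))%E.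
  by move=> uJ mB; exact: (indx Jl (fun j => T_ q @^-1` B j) uJ (fun j => bT _ (mB j))).
(* The area of the sphere one dimension down is its ambient dimension [d.+1] times the volume of the
   unit ball, and [d.+1] cancels the denominator of [C]. *)
have CE : C = rho q * (fine (ball_vol d.+1 1 : \bar R) * 2 `^ (d.+1%:R / 2)).
  rewrite /C alphaV sphere_areaE /=.
  have : d.+1%:R != 0 :> R by rewrite pnatr_eq0.
  by move: (d.+1%:R : R) => D D0; field.
have C0 : 0 < C by rewrite CE !mulr_gt0 ?powR_gt0 ?ball_vol_gt0.
have FC : F t / t `^ alpha^-1 @[t --> 0^'+] --> C.
  by rewrite CE alphaV; exact: cap_law_cvg.
(* [beta 0] is not assumed positive. *)
pose beta' n := if n is 0 then 1 else beta n.
have beta'0 n : 0 < beta' n by case: n => // n; exact: beta0.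
have cbeta' : beta' n * n%:R `^ (- (alpha^-1)^-1) @[n --> \oo] --> gamma.
  rewrite invrK; apply: cvg_trans cbeta; apply: near_eq_cvg.
  by exists 1%N => // -[].
apply: cvg_trans (softmax_limit mS SF S0 indS p0 C0 FC beta'0 gamma0 cbeta' ppp LamE Lam0 hY cf fB).
apply: near_eq_cvg.
exists 1%N => [//|[|n _]]; first by rewrite /= ltn0.
reflexivity.
Qed.
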